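(* Let $\mathcal{T}$ be the random spanning tree in random environment with parameter $\beta=\beta(n)$ on the complete graph with $n$ vertices and environment $\omega=(\omega_e)$ given by i.i.d. uniform random variables on $[0,1]$, and let $L(\mathcal{T})=\sum_{e\in\mathcal{T}}\omega_e$ be its total length. (i) If $0<\beta=\beta(n)\ll n/\log n$, then with high probability (and in $\mathbb{P}$-expectation) $$\mathbf{E}^\omega_{n,\beta}\big[L(\mathcal{T})\big]=\big(1+o_\beta(1)\big)\,\frac n\beta\cdot\frac{1-\beta e^{-\beta}-e^{-\beta}}{1-e^{-\beta}}.$$ (ii) If $\beta=\beta(n)\gg n(\log n)^5$, then with high probability (and in $\mathbb{P}$-expectation) $$\mathbf{E}^\omega_{n,\beta}\big[L(\mathcal{T})\big]=\big(1+o_\beta(1)\big)\,\zeta(3),$$ where $\zeta(3)=\sum_{k=1}^\infty k^{-3}$ is Apéry's constant.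
   Context: Random spanning tree in random environment (RSTRE): $K_n=(V,E)$ is the complete graph on $V=\{1,\dots,n\}$; $\omega=(\omega_e)_{e\in E}$ are i.i.d. uniform on $[0,1]$ under $\mathbb{P}$ with expectation $\mathbb{E}$. For $\beta\ge0$ put $\mathrm{w}(e)=\exp(-\beta\omega_e)$. Given $\omega$, the quenched law on spanning trees $T$ of $K_n$ (identified with edge sets) is $\mathbf{P}^\omega_{n,\beta}(\mathcal{T}=T)=\frac1{Z^\omega_\beta}\prod_{e\in T}\mathrm{w}(e)$, with $Z^\omega_\beta$ the normalizing constant; $\mathbf{E}^\omega_{n,\beta}$ is the corresponding expectation (a function of $\omega$). The averaged law is $\widehat{\mathbb{P}}(\cdot)=\mathbb{E}[\mathbf{P}^\omega_{n,\beta}(\cdot)]$. Asymptotic notation ($n\to\infty$): $f\ll g$ means $f(n)/g(n)\to0$; $f\gg g$ means $g(n)/f(n)\to0$. An event holds with high probability if its $\widehat{\mathbb{P}}$-probability (equivalently its $\mathbb{P}$-probability if it depends only on $\omega$) tends to $1$. ''$X_n=(1+o_\beta(1))f$ with high probability'' means that there are functions $h_1,h_2:\mathbb{R}\times\mathbb{N}\to[0,\infty)$ with $h_1(\beta(n),n)\to0$, $h_2(\beta(n),n)\to0$ whenever $\beta(n)$ satisfies the stated growth condition, such that $\widehat{\mathbb{P}}(|X_n-f|\ge h_1(\beta(n),n)f)\le h_2(\beta(n),n)$. ''In $\mathbb{P}$-expectation'' means that the same asymptotic equality holds with the left-hand side replaced by $\mathbb{E}\big[\mathbf{E}^\omega_{n,\beta}[L(\mathcal{T})]\big]$.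 *)

(* Defs.v *)
From HB Require Import structures.
From mathcomp Require Import all_boot all_order all_algebra.
From mathcomp Require Import all_classical all_reals all_analysis.
Import Order.TTheory GRing.Theory Num.Theory.
Import numFieldNormedType.Exports.

Set Implicit Arguments.
Unset Strict Implicit.
Unset Printing Implicit Defensive.

Local Open Scope classical_set_scope.
Local Open Scope ring_scope.

(** * Spanning trees of the complete graph on ['I_n] *)

Definition edge (n : nat) := {e : {set 'I_n} | #|e| == 2}.

Definition adj (n : nat) (T : {set edge n}) : rel 'I_n :=
  fun x y => [exists e : edge n, (e \in T) && (val e == [set x; y]%SET)].

Definition connected_graph (n : nat) (T : {set edge n}) : Prop :=
  forall x y : 'I_n, connect (adj T) x y.

(* A closed walk x y x through a single edge is a [ucycle] of length 2, so
   genuine cycles are those of length at least 3. *)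
Definition acyclic_graph (n : nat) (T : {set edge n}) : Prop :=
  forall c : seq 'I_n, (2 < size c)%N -> ~ ucycle (adj T) c.

Definition spanning_tree (n : nat) (T : {set edge n}) : Prop :=
  connected_graph T /\ acyclic_graph T.

(** * The random spanning tree in a fixed environment [w] *)

Section Quenched.
Variables (R : realType) (n : nat) (b : R) (w : edge n -> R).

Definition tree_weight (T : {set edge n}) : R :=
  \prod_(e in T) expR (- b * w e).

Definition partition_function : R :=
  \sum_(T : {set edge n} | `[< spanning_tree T >]) tree_weight T.

Definition quenched_law (T : {set edge n}) : R :=
  if `[< spanning_tree T >] then tree_weight T / partition_function else 0.

Definition quenched_expectation (F : {set edge n} -> R) : R :=
  \sum_(T : {set edge n}) quenched_law T * F T.

Definition tree_length (T : {set edge n}) : R := \sum_(e in T) w e.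

Definition mean_length : R := quenched_expectation tree_length.

End Quenched.

(** * I.i.d. uniform environments *)

Definition mutually_independent (d : measure_display) (Om : measurableType d)
    (R : realType) (P : probability Om R) (I : finType)
    (X : I -> {RV P >-> R}) : Prop :=
  forall (J : {set I}) (A : I -> set R), (forall i, measurable (A i)) ->
    P (\bigcap_(i in [set i | i \in J]) (X i @^-1` A i)) =
    (\prod_(i in J) P (X i @^-1` A i))%E.

Definition iid_uniform01 (d : measure_display) (Om : measurableType d)
    (R : realType) (P : probability Om R) (I : finType)
    (X : I -> {RV P >-> R}) : Prop :=
  mutually_independent X /\
  forall i (A : set R), measurable A ->
    distribution P (X i) A = uniform_prob (@ltr01 R) A.

(** * Asymptotics as [n] tends to infinity *)

(* Since [x / 0 = 0], the denominator is required to be eventually nonzero. *)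
Definition much_less (R : realType) (f g : nat -> R) : Prop :=
  (\forall n \near \oo, g n != 0) /\ (f n / g n @[n --> \oo] --> 0).

Definition vanishing (R : realType) (growth : (nat -> R) -> Prop)
    (h : R -> nat -> R) : Prop :=
  (forall b n, 0 <= h b n) /\
  forall beta, growth beta -> h (beta n) n @[n --> \oo] --> 0.

(* [X n b = (1 + o_beta(1)) f n b] with high probability, where [b] stands for
   [beta n].  The functions [h1] and [h2] do not depend on the sequence. *)
Definition asymp_whp (R : realType) (growth : (nat -> R) -> Prop)
    (d : nat -> measure_display) (Om : forall n, measurableType (d n))
    (P : forall n, probability (Om n) R) (X : forall n, R -> Om n -> R)
    (f : nat -> R -> R) : Prop :=
  exists h1 h2 : R -> nat -> R,
    [/\ vanishing growth h1, vanishing growth h2 &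
      forall beta, growth beta -> forall n, (0 < n)%N ->
        (P n [set t | (h1 (beta n) n * f n (beta n) <=
                       `|X n (beta n) t - f n (beta n)|)%R]
         <= (h2 (beta n) n)%:E)%E].

Definition asymp_expectation (R : realType) (growth : (nat -> R) -> Prop)
    (d : nat -> measure_display) (Om : forall n, measurableType (d n))
    (P : forall n, probability (Om n) R) (X : forall n, R -> Om n -> R)
    (f : nat -> R -> R) : Prop :=
  exists h : R -> nat -> R,
    vanishing growth h /\
    forall beta, growth beta -> forall n, (0 < n)%N ->
      (`| 'E_(P n)[X n (beta n)] - (f n (beta n))%:E |
       <= (h (beta n) n * f n (beta n))%:E)%E.

Definition low_disorder (R : realType) (beta : nat -> R) : Prop :=
  (forall n, 0 < beta n) /\ much_less beta (fun n => n%:R / ln n%:R).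

Definition high_disorder (R : realType) (beta : nat -> R) : Prop :=
  (forall n, 0 <= beta n) /\ much_less (fun n => n%:R * ln n%:R ^+ 5) beta.

Definition zeta3 (R : realType) : R :=
  limn (fun n => \sum_(1 <= k < n) (k%:R ^- 3 : R)).

(* Main.v *)
Require Import Defs.
From mathcomp Require Import all_boot all_order all_algebra all_fingroup.
From mathcomp Require Import all_classical all_reals all_analysis.
From mathcomp Require Import measurable_realfun.
From mathcomp Require Import ring lra zify.
Import Order.TTheory GRing.Theory Num.Theory.
Import numFieldNormedType.Exports.

Set Implicit Arguments.
Unset Strict Implicit.
Unset Printing Implicit Defensive.

Local Open Scope ring_scope.

(** Write X for the mean length of the random tree in the environment omega. In both
    regimes the error of X is shown to be small in L^1, relative to the limit; Markov's
    inequality then gives both assertions ([asymp_of_L1]). As X is a continuous function of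
    finitely many independent uniform variables, omega may be replaced by an environment
    with values on a finite grid of mesh 1/N, with N as large as desired ([grid_approx]).
    Expectations become averages over a finite product and integrals become Riemann sums.

    Spanning trees are encoded by parent maps, and Kirchhoff's theorem turns the inclusion
    probability of an edge e into w_e C / (1 + w_e C), where C is the effective resistance
    between the ends of e in the graph without e, which is independent of w_e.

    Low disorder. When C is small, the inclusion probability is nearly w_e C, and the mean
    length of e, given that e is in the tree, is nearly the ratio of the means of omega w
    and w, that is, the quotient of two Laplace moments of the uniform law. By Foster's
    theorem the inclusion probabilities add up to n - 1, whence the upper bound
    ([avg_length_upper]). Large resistances are excluded by cutting the environment into m
    disjoint layers, m being of order n / (1 + beta): in each of them the resistance is
    bounded with good probability by symmetry, the layers are negatively associated, and
    resistances in parallel combine, so that C > 8 / m has probability exponentially small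
    in m ([resistance_tail]). This is where beta << n / log n is used. For the lower bound,
    Dirichlet's principle bounds C from below by a local expression, and Chebyshev's
    inequality applies ([avg_length_lower]).

    High disorder. There are at most n^n trees, so X exceeds the length of a minimal
    spanning tree by at most (1 + n log n) / beta ([gibbs_upper]), which tends to 0. The
    length of the minimal tree is the integral over p in [0, 1] of the number of components
    of the graph of the edges with omega_e <= p, minus one ([exists_kruskal_tree]). By
    Cayley's formula the mean number of components of size k is about
    C(n, k) k^(k-2) p^(k-1) (1 - p)^(k (n - k)); its integral is a Beta integral and tends
    to 1 / k^3. Larger components are negligible: there are at most n / K of size above K
    while p is of order 1 / n, and beyond that all but one are exponentially rare
    ([avg_excess_le]). In the other direction one counts only the components that are trees
    with at most K vertices, whose number has small variance ([tree_count_deviation],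
    [avg_shortfall_le]). Letting K grow, the sum of 1 / k^3 appears. *)

(** * Forests as parent maps, and their determinant *)

Section ParentMaps.
Variables (m : nat).
Let V := 'I_m.
Implicit Types (B : {set V}) (p : {ffun V -> V}) (v x y : V).

(** A rooted forest on the whole vertex set, with B as its set of roots; p sends a
    vertex to its parent. *)
Definition parent_map B p : bool :=
  [forall v in B, p v == v] && [forall v, exists b in B, fconnect p v b].

Lemma parent_map_fix B p v : parent_map B p -> v \in B -> p v = v.
Proof. by case/andP=> /forall_inP H _ /H /eqP. Qed.

Lemma parent_map_reach B p v : parent_map B p ->
  exists2 b, b \in B & fconnect p v b.
Proof. by case/andP=> _ /forallP /(_ v) /exists_inP. Qed.

Lemma parent_mapP B p : (forall v, v \in B -> p v = v) ->
  (forall v, exists2 b, b \in B & fconnect p v b) -> parent_map B p.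
Proof.
move=> H1 H2; apply/andP; split; first by apply/forall_inP => v /H1 ->.
by apply/forallP => v; apply/exists_inP.
Qed.

Lemma parent_map_ind B p (Q : V -> Prop) : parent_map B p ->
  (forall v, v \in B -> Q v) -> (forall v, v \notin B -> Q (p v) -> Q v) ->
  forall v, Q v.
Proof.
move=> pm Q0 QS v; have [b bB /iter_findex] := parent_map_reach v pm.
move: (findex p v b) => k; elim: k v => [|k IH] v /=; first by move=> ->; exact: Q0.
rewrite -iterS iterSr => /IH Qpv.
by have [vB|vB] := boolP (v \in B); [exact: Q0 | exact: QS].
Qed.

(** A set Q of non-roots stable under p would trap the orbit of each of its points away
    from B. This is how the finiteness of branches is used below. *)
Lemma parent_map_escape B p (Q : pred V) : parent_map B p ->
  (forall v, Q v -> v \notin B) -> (forall v, Q v -> Q (p v)) -> forall v, ~~ Q v.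
Proof.
move=> pm QB Qp; apply: (parent_map_ind pm) => v vB.
  by apply/negP => /QB; rewrite vB.
by apply: contra; exact: Qp.
Qed.

Lemma parent_map_neq B p v : parent_map B p -> v \notin B -> p v != v.
Proof.
move=> pm vB; apply/negP => /eqP E.
have := @parent_map_escape _ _ (pred1 v) pm _ _ v; rewrite /= eqxx => H.
by suff: false by []; apply: H => x /eqP -> //; rewrite E.
Qed.

Lemma parent_map_neq2 B p v : parent_map B p -> v \notin B -> p v \notin B ->
  p (p v) != v.
Proof.
move=> pm vB pB; apply/negP => /eqP E.
have := @parent_map_escape _ _ (pred2 v (p v)) pm _ _ v; rewrite /= eqxx => H.
suff: false by [].
apply: H => x /orP[] /eqP -> //; last by rewrite E eqxx.
by rewrite eqxx orbT.
Qed.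

Variable R : comUnitRingType.

Definition parent_matrix B p : 'M[R]_m :=
  \matrix_(v, u) ((v == u)%:R - ((v \notin B) && (p v == u))%:R).

(** Only the identity contributes to the determinant: a permutation with a nonzero term
    that moves a vertex must send it to its parent, and then moves the parent too, so it
    would follow a branch for ever. *)
Lemma det_parent_matrix B p : parent_map B p -> \det (parent_matrix B p) = 1.
Proof.
move=> pm; rewrite /determinant (bigD1 1%g) //= [X in _ + X]big1 ?addr0 => [|s s1].
  rewrite odd_perm1 expr0 mul1r big1 // => i _.
  rewrite mxE perm1 eqxx; case: (boolP (i \notin B)) => iB; last by rewrite subr0.
  by rewrite (negbTE (parent_map_neq pm iB)) subr0.
have [/existsP[v /eqP H]|Hall] := boolP [exists v, parent_matrix B p v (s v) == 0].
  by rewrite (bigD1 v) //= H mul0r mulr0.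
case/negP: s1; apply/eqP/permP => v; rewrite perm1; apply/eqP.
rewrite -[_ == _]negbK.
apply: (parent_map_escape (Q := fun v => s v != v) pm) => {}v sv.
  move: Hall; rewrite negb_exists => /forallP /(_ v).
  rewrite mxE [v == _]eq_sym (negbTE sv).
  by case: (v \in B) => //=; rewrite subrr eqxx.
move: Hall; rewrite negb_exists => /forallP /(_ v).
rewrite mxE [v == _]eq_sym (negbTE sv) sub0r oppr_eq0.
have [->|_] := altP (p v =P s v); first by rewrite (inj_eq perm_inj) sv.
by rewrite andbF eqxx.
Qed.

End ParentMaps.

Section NonParent.
Variables (m : nat) (R : fieldType).
Let V := 'I_m.
Implicit Types (B : {set V}) (p : {ffun V -> V}) (v x y : V).

(** The indicator of the vertices from which B is never reached lies in the kernel. *)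
Lemma det_parent_matrix0 B p : (forall v, v \in B -> p v = v) ->
  ~~ parent_map B p -> \det (parent_matrix R B p) = 0.
Proof.
move=> pB npm.
pose r v := [exists b in B, fconnect p v b].
have rp v : v \notin B -> r (p v) = r v.
  move=> vB; apply/exists_inP/exists_inP => -[b bB H]; exists b => //.
    by apply: connect_trans H; exact: fconnect1.
  move/iter_findex: H; case: (findex p v b) => [|k] /=.
    by move=> E; rewrite E bB in vB.
  by rewrite -iterS iterSr => <-; exact: fconnect_iter.
have rB v : v \in B -> r v by move=> vB; apply/exists_inP; exists v.
pose z : 'cV[R]_m := \col_v (~~ r v)%:R.
have [x rx] : exists x, ~~ r x.
  apply/existsP; move: npm; rewrite negb_and; case/orP; last by rewrite negb_forall.
  by case/forall_inPn => v /pB ->; rewrite eqxx.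
have Mz : parent_matrix R B p *m z = 0.
  apply/colP => v; rewrite !mxE.
  under eq_bigr do rewrite !mxE mulrBl.
  rewrite big_split /= (bigD1 v) //= eqxx mul1r big1 ?addr0; last first.
    by move=> i iv; rewrite eq_sym (negbTE iv) mul0r.
  have [vB|vB] /= := boolP (v \in B).
    by rewrite rB // big1 ?addr0 // => i _; rewrite mul0r oppr0.
  rewrite (bigD1 (p v)) //= eqxx mul1r big1 ?addr0 ?rp ?subrr //.
  by move=> i iv; rewrite eq_sym (negbTE iv) mul0r oppr0.
apply/eqP; apply: contraT => det0.
have U : parent_matrix R B p \in unitmx by rewrite unitmxE unitfE.
have : z = 0 by rewrite -[z](mulKmx U) Mz mulmx0.
by move/colP/(_ x)/eqP; rewrite !mxE rx oner_eq0.
Qed.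

(** The rows of B are replaced by rows of the identity instead of being deleted, which
    keeps the size of the matrix independent of B; the determinant is that of the usual
    reduced Laplacian. *)
Definition rooted_laplacian B (c : V -> V -> R) : 'M[R]_m :=
  \matrix_(v, u) if v \in B then (v == u)%:R
                 else (\sum_x c v x) * (v == u)%:R - c v u.

(** All minors version of the matrix-tree theorem. The row of v is the combination, with
    weights c v x, of the rows it would have if x were the parent of v. Multilinearity
    gives one determinant for each choice of parents, equal to 1 for a forest rooted in
    B and to 0 otherwise. *)
Theorem matrix_forest B (c : V -> V -> R) :
  \sum_(p : {ffun V -> V} | parent_map B p) \prod_(v | v \notin B) c v (p v) =
  \det (rooted_laplacian B c).
Proof.
pose k v x u : R := (v == u)%:R - ((v \notin B) && (x == u))%:R.
pose c' v x := if v \in B then (x == v)%:R else c v x.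
have -> : rooted_laplacian B c = \matrix_(v, u) \sum_x c' v x * k v x u.
  apply/matrixP => v u; rewrite !mxE /c' /k; case: (boolP (v \in B)) => vB /=.
    rewrite (bigD1 v) //= eqxx mul1r subr0 big1 ?addr0 // => i iv.
    by rewrite (negbTE iv) mul0r.
  under [in RHS]eq_bigr do rewrite mulrBr.
  rewrite big_split /= -mulr_suml; congr (_ + _).
  rewrite sumrN (bigD1 u) //= eqxx mulr1 big1 ?addr0 // => i iu.
  by rewrite (negbTE iu) mulr0.
rewrite /determinant.
under [RHS]eq_bigr => s _.
  under eq_bigr do rewrite mxE.
  rewrite bigA_distr_bigA mulr_sumr.
  under eq_bigr => p _ do rewrite big_split /= mulrCA.
  over.
rewrite exchange_big /=.
rewrite [RHS](bigID (fun p : {ffun V -> V} => [forall v in B, p v == v])) /=.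
rewrite [X in _ + X]big1 ?addr0; last first.
  move=> p /forall_inPn[v vB pv]; rewrite big1 // => s _.
  by rewrite (bigD1 v) //= /c' vB (negbTE pv) !mul0r.
rewrite [RHS](bigID (parent_map B)) /= [X in _ + X]big1 ?addr0; last first.
  move=> p /andP[/forall_inP pB np]; rewrite -mulr_sumr.
  have := @det_parent_matrix0 B p (fun v vB => eqP (pB v vB)) np.
  rewrite /determinant => H; apply/eqP; rewrite mulf_eq0; apply/orP; right.
  apply/eqP; rewrite -[RHS]H; apply: eq_bigr => s _; congr (_ * _).
  by apply: eq_bigr => v _; rewrite mxE.
apply: eq_big => [p|p pm]; first by rewrite /parent_map andbA andbb.
rewrite -mulr_sumr.
have := det_parent_matrix R pm; rewrite /determinant => H.
(* The remaining terms are forests, whose determinant is 1. *)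
transitivity (\prod_v c' v (p v) * 1); last first.
  congr (_ * _); rewrite -[LHS]H; apply: eq_bigr => s _; congr (_ * _).
  by apply: eq_bigr => v _; rewrite mxE.
rewrite mulr1 [RHS](bigID (mem B)) /= [X in _ = X * _]big1 ?mul1r.
  by apply: eq_bigr => v vB; rewrite /c' (negbTE vB).
by move=> v vB; rewrite /c' vB (parent_map_fix pm vB) eqxx.
Qed.

End NonParent.

(** * Spanning trees as parent maps: Kirchhoff's theorem *)

Lemma eq_set2 (T : finType) (a b x y : T) :
  ([set a; b]%SET == [set x; y]%SET) = ((a == x) && (b == y)) || ((a == y) && (b == x)).
Proof.
apply/eqP/idP => [E|/orP[/andP[/eqP-> /eqP->]|/andP[/eqP-> /eqP->]]] //; last first.
  by rewrite finset.setUC.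
have : a \in [set x; y]%SET by rewrite -E finset.set21.
have : b \in [set x; y]%SET by rewrite -E finset.set22.
have : x \in [set a; b]%SET by rewrite E finset.set21.
have : y \in [set a; b]%SET by rewrite E finset.set22.
rewrite !inE ![a == _]eq_sym ![b == _]eq_sym.
by do 4 case: eqP => [->|] //=; rewrite ?eqxx ?orbT.
Qed.

Section Breadth.
Variables (m : nat).
Let V := 'I_m.

(** The number of steps to B is a height that drops along p: it is what excludes
    cycles. *)
Lemma parent_map_depth (B : {set V}) (p : {ffun V -> V}) : parent_map B p ->
  exists d : V -> nat, forall v, v \notin B -> (d (p v) < d v)%N.
Proof.
move=> pm.
have ex v : exists k, iter k p v \in B.
  have [b bB /iter_findex H] := parent_map_reach v pm.
  by exists (findex p v b); rewrite H.
exists (fun v => ex_minn (ex v)) => v vB.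
case: (ex_minnP (ex v)) => -[|k]; first by rewrite /= (negbTE vB).
rewrite iterSr => kB _; case: ex_minnP => j _ /(_ k kB); by rewrite ltnS.
Qed.

(** Parents are chosen strictly closer to B for the graph distance of e, so that
    branches end. *)
Lemma exists_parent_map (e : rel V) (B : {set V}) :
  (forall v, exists2 b, b \in B & connect e v b) ->
  exists2 p : {ffun V -> V}, parent_map B p & forall v, v \notin B -> e v (p v).
Proof.
move=> H.
pose D v k := `[< exists q, [/\ path e v q, last v q \in B & size q = k] >].
have ex v : exists k, D v k.
  have [b bB /connectP[q pq E]] := H v.
  by exists (size q); apply/asboolP; exists q; rewrite -E.
pose d v := ex_minn (ex v).
have step v : v \notin B -> exists y, e v y && (d y < d v)%N.
  move=> vB; rewrite {2}/d; case: ex_minnP => k /asboolP[[|y q]] [] /=.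
    by rewrite (negbTE vB).
  case/andP=> evy pq lB <- _; exists y; rewrite evy /= /d ltnS.
  by case: ex_minnP => j _; apply; apply/asboolP; exists q.
pose p := [ffun v => if v \in B then v else odflt v [pick y | e v y && (d y < d v)%N]].
have pP v : v \notin B -> e v (p v) && (d (p v) < d v)%N.
  move=> vB; rewrite ffunE (negbTE vB); case: pickP => //= N.
  by have [y] := step v vB; rewrite N.
exists p; last by move=> v /pP /andP[].
apply: parent_mapP => [v vB|v]; first by rewrite ffunE vB.
move: {2}(d v) (leqnn (d v)) => k; elim: k v => [|k IH] v dk.
  have [vB|vB] := boolP (v \in B); first by exists v.
  by have /andP[_] := pP v vB; rewrite ltnNge (leq_trans dk).
have [vB|vB] := boolP (v \in B); first by exists v.
have /andP[_ lt] := pP v vB; have [|b bB c] := IH (p v).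
  by rewrite -ltnS (leq_trans lt).
by exists b => //; apply: connect_trans c; exact: fconnect1.
Qed.

End Breadth.

Section TreeParent.
Variable n : nat.
Let V := 'I_n.
Implicit Types (T : {set edge n}) (B : {set V}) (p q : {ffun V -> V}) (x y v : V).

Lemma adj_sym T : symmetric (adj T).
Proof. by move=> x y; rewrite /adj finset.setUC. Qed.

Lemma connect_adjC T x y : connect (adj T) x y = connect (adj T) y x.
Proof. by apply: sym_connect_sym; exact: adj_sym. Qed.

Lemma adj_mem T (e : edge n) x y : val e = [set x; y]%SET -> adj T x y = (e \in T).
Proof.
move=> E; apply/existsP/idP => [[f /andP[fT /eqP vf]]|eT].
  by have <- : f = e by apply: val_inj; rewrite /= vf.
by exists e; rewrite eT E eqxx.
Qed.

Lemma edge_ends (e : edge n) : exists x y, x != y /\ val e = [set x; y]%SET.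
Proof. by have /cards2P[x [y [xy E]]] := valP e; exists x, y. Qed.

Lemma insub_edge x y : x != y ->
  exists2 e : edge n, val e = [set x; y]%SET & insub [set x; y]%SET = Some e.
Proof.
move=> xy; have c2 : #|[set x; y]%SET| == 2 by rewrite cards2 xy.
by exists (exist (fun e : {set 'I_n} => #|e| == 2) _ c2); rewrite // insubT.
Qed.

Lemma adj_sub T T' : T \subset T' -> subrel (adj T) (adj T').
Proof.
move=> /fintype.subsetP s x y /existsP[e /andP[/s eT H]]; apply/existsP; exists e.
by rewrite eT.
Qed.

Definition parent_edges B p : {set edge n} :=
  [set e : edge n | [exists v, (v \notin B) && (val e == [set v; p v]%SET)]]%SET.

Lemma parent_edgesP B p (e : edge n) :
  reflect (exists2 v, v \notin B & val e = [set v; p v]%SET) (e \in parent_edges B p).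
Proof.
rewrite inE; apply: (iffP existsP) => [[v /andP[vB /eqP E]]|[v vB E]]; exists v => //.
by rewrite vB E eqxx.
Qed.

Lemma adj_parent_edges B p x y : parent_map B p ->
  adj (parent_edges B p) x y =
  ((x \notin B) && (p x == y)) || ((y \notin B) && (p y == x)).
Proof.
move=> pm; apply/idP/idP.
  case/existsP=> e /andP[/parent_edgesP[v vB ->]].
  rewrite eq_set2 => /orP[/andP[/eqP <- /eqP <-]|/andP[/eqP <- /eqP <-]].
    by rewrite vB eqxx.
  by rewrite vB eqxx orbT.
have edg v : v \notin B -> exists2 e : edge n, e \in parent_edges B p & val e = [set v; p v]%SET.
  move=> vB; have [|e E _] := @insub_edge v (p v).
    by rewrite eq_sym (parent_map_neq pm vB).
  by exists e => //; apply/parent_edgesP; exists v.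
case/orP=> /andP[vB /eqP <-].
  by have [e eT E] := edg x vB; rewrite (adj_mem _ E).
by have [e eT E] := edg y vB; rewrite adj_sym (adj_mem _ E).
Qed.

Lemma connect_parent_edges B p v : parent_map B p ->
  exists2 b, b \in B & connect (adj (parent_edges B p)) v b.
Proof.
move=> pm; move: v; apply: (parent_map_ind pm) => [v vB|v vB [b bB c]]; first by exists v.
exists b => //; apply: connect_trans c; apply: connect1.
by rewrite adj_parent_edges // vB eqxx.
Qed.

(** If p and q differ at v, the edge {v, q v} can only be oriented by p from q v to v,
    so they also differ at q v; the set of disagreement would be stable under q. *)
Lemma parent_edges_inj B p q : parent_map B p -> parent_map B q ->
  parent_edges B p = parent_edges B q -> p = q.
Proof.
move=> pp pq E; apply/ffunP => v; apply/eqP; rewrite -[_ == _]negbK.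
have key x : p x != q x -> [/\ x \notin B, q x \notin B & p (q x) = x].
  move=> ne; have xB : x \notin B.
    apply: contra ne => xB; by rewrite (parent_map_fix pp) ?(parent_map_fix pq).
  have := adj_parent_edges x (q x) pq; rewrite xB eqxx /= -E adj_parent_edges //.
  by rewrite xB (negbTE ne) /= => /andP[-> /eqP].
apply: (parent_map_escape (Q := fun v => p v != q v) pq) => [x|x] /key [] //.
move=> xB qB ->; apply/negP => /eqP E2.
by have := parent_map_neq2 pq xB qB; rewrite -E2 eqxx.
Qed.

(** At a point of maximal depth of a cycle, both neighbours would have to be its
    parent. *)
Lemma parent_edges_acyclic B p : parent_map B p -> acyclic_graph (parent_edges B p).
Proof.
move=> pm c sc /andP[cy uc].
have [d dP] := parent_map_depth pm.
have [v0 v0c] : exists v0, v0 \in c by case: c sc {cy uc} => // v0 c' _; exists v0; rewrite mem_head.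
case: (arg_maxnP d v0c) => v vc vmax.
have [i c' E] := rot_to vc.
have /andP[cy' uc'] : path.cycle (adj (parent_edges B p)) (v :: c') && uniq (v :: c').
  by rewrite -E rot_cycle cy rot_uniq.
have sc' : (1 < size c')%N by rewrite -ltnS -[(size c').+1]/(size (v :: c')) -E size_rot.
have par x : x \in c -> adj (parent_edges B p) v x -> x = p v.
  move=> xc; rewrite adj_parent_edges // => /orP[/andP[_ /eqP] //|/andP[xB /eqP pv]].
  by have := vmax x xc; rewrite /geq /= leqNgt -pv dP.
have sub x : x \in c' -> x \in c by move=> xc; rewrite -(mem_rot i) E inE xc orbT.
case: c' E cy' uc' sc' sub => [|a c'] // E /= /andP[va pa] /andP[_ /andP[ac' _]] sc' sub.
move: pa; rewrite rcons_path => /andP[_ lv].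
have ea := par a (sub a (mem_head _ _)) va.
have l_in : last a c' \in c' by case: c' sc' {ac' sub E lv} => //= b c' _; rewrite mem_last.
have el : last a c' = p v.
  apply: par; last by rewrite adj_sym.
  by apply: sub; rewrite inE l_in orbT.
by move: ac'; rewrite ea -el l_in.
Qed.

Lemma parent_edges_tree r p : parent_map [set r]%SET p ->
  spanning_tree (parent_edges [set r]%SET p).
Proof.
move=> pm; split; last exact: parent_edges_acyclic.
have H v : connect (adj (parent_edges [set r]%SET p)) v r.
  by have [b] := connect_parent_edges v pm; rewrite inE => /eqP ->.
by move=> x y; apply: connect_trans (H x) _; rewrite connect_adjC.
Qed.

(** Orient a tree towards r. The oriented edges already connect everything, so a further
    edge would close a cycle. *)
Lemma tree_parent_edges r T : spanning_tree T ->
  exists2 p, parent_map [set r]%SET p & T = parent_edges [set r]%SET p.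
Proof.
case=> con acy.
have [|p pm pe] := @exists_parent_map n (adj T) [set r]%SET.
  by move=> v; exists r; [rewrite inE|exact: con].
exists p => //; have sub : parent_edges [set r]%SET p \subset T.
  apply/fintype.subsetP => e /parent_edgesP[v vB E].
  by rewrite -(adj_mem _ E); exact: pe.
apply/eqP; rewrite finset.eqEsubset sub andbT; apply/fintype.subsetP => f fT.
have [//|fN] := boolP (f \in parent_edges [set r]%SET p).
have [x [y [xy E]]] := edge_ends f.
have /connectP[q0 pq0 lq0] : connect (adj (parent_edges [set r]%SET p)) x y.
  by have [c _] := parent_edges_tree pm; exact: c.
case: (shortenP pq0) lq0 => q pq uq _ lq.
case: q pq uq lq => [|a q] pq uq lq; first by rewrite lq eqxx in xy.
case: q pq uq lq => [|b q] pq uq lq.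
  by move: pq fN; rewrite -(adj_mem _ E) lq /= andbT => ->.
case: (acy [:: x, a, b & q]) => //; apply/andP; split => //.
have := sub_path (adj_sub sub) pq; rewrite /= rcons_path => /and3P[-> -> ->] /=.
by rewrite /= in lq; rewrite -lq adj_sym (adj_mem _ E).
Qed.

Section Weights.
Variable R : realFieldType.
Implicit Types w : edge n -> R.

(** The weight of a pair of vertices as a total function; it vanishes on the diagonal,
    where there is no edge. *)
Definition pair_weight w x y : R :=
  if insub [set x; y]%SET is Some e then w e else 0.

Lemma pair_weightC w x y : pair_weight w x y = pair_weight w y x.
Proof. by rewrite /pair_weight finset.setUC. Qed.

Lemma pair_weightE w (e : edge n) x y : val e = [set x; y]%SET -> pair_weight w x y = w e.
Proof. by move=> E; rewrite /pair_weight -E valK. Qed.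

Lemma pair_weightxx w x : pair_weight w x x = 0.
Proof. by rewrite /pair_weight insubF // finset.setUid cards1. Qed.

Lemma pair_weight_ge0 w x y : (forall e, 0 <= w e) -> 0 <= pair_weight w x y.
Proof. by move=> w0; rewrite /pair_weight; case: insub. Qed.

Lemma parent_edge_inj B p : parent_map B p ->
  {in ~: B &, injective (fun v => insub [set v; p v]%SET : option (edge n))}.
Proof.
move=> pm v x; rewrite !inE => vB xB.
have ne u : u \notin B -> u != p u by move=> uB; rewrite eq_sym (parent_map_neq pm uB).
have [e E ->] := insub_edge (ne v vB); have [f F ->] := insub_edge (ne x xB).
case=> ef; move: E; rewrite ef F => /eqP; rewrite eq_sym.
rewrite eq_set2 => /orP[/andP[/eqP //]|/andP[/eqP E1 /eqP E2]].
have := parent_map_neq2 pm vB; rewrite E2 => /(_ xB).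
by rewrite E1 eqxx.
Qed.

Lemma parent_edges_image B p : parent_map B p ->
  [set Some e | e in parent_edges B p]%SET =
  [set (insub [set v; p v]%SET : option (edge n)) | v in ~: B]%SET.
Proof.
move=> pm; apply/finset.setP => o; apply/imsetP/imsetP => [[e /parent_edgesP[v vB E] ->]|[v]].
  by exists v; rewrite ?inE // -E valK.
rewrite inE => vB ->.
have [|e E ->] := @insub_edge v (p v); first by rewrite eq_sym (parent_map_neq pm vB).
by exists e => //; apply/parent_edgesP; exists v.
Qed.

Lemma prod_parent_edges (g : edge n -> R) B p : parent_map B p ->
  \prod_(e in parent_edges B p) g e = \prod_(v | v \notin B) pair_weight g v (p v).
Proof.
move=> pm; pose h (o : option (edge n)) := if o is Some e then g e else 0.
transitivity (\prod_(o in [set Some e | e in parent_edges B p]%SET) h o).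
  by rewrite big_imset //= => ? ? _ _ [].
rewrite parent_edges_image // big_imset /=; last exact: parent_edge_inj.
by apply: eq_bigl => v; rewrite inE.
Qed.

Lemma card_parent_edges B p : parent_map B p -> #|parent_edges B p| = #|~: B|.
Proof.
move=> pm; rewrite -(card_imset (parent_edges B p) (@Some_inj _)) parent_edges_image //.
by rewrite card_in_imset //; exact: parent_edge_inj.
Qed.

Definition tree_sum w : R := \sum_(T : {set edge n} | `[< spanning_tree T >]) \prod_(e in T) w e.

Lemma sum_trees r (F : {set edge n} -> R) :
  \sum_(T : {set edge n} | `[< spanning_tree T >]) F T =
  \sum_(p | parent_map [set r]%SET p) F (parent_edges [set r]%SET p).
Proof.
transitivity (\sum_(T in [set parent_edges [set r]%SET p | p in [pred p | parent_map [set r]%SET p]]%SET) F T).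
  apply: eq_bigl => T; apply/asboolP/imsetP => [/(tree_parent_edges r)[p pm ->]|[p pm ->]].
    by exists p.
  exact: parent_edges_tree.
by rewrite big_imset //= => p q pp pq; exact: parent_edges_inj.
Qed.

Theorem matrix_tree r w :
  tree_sum w = \det (rooted_laplacian [set r]%SET (pair_weight w)).
Proof.
rewrite /tree_sum (sum_trees r) -matrix_forest; apply: eq_bigr => p pm.
exact: prod_parent_edges.
Qed.

Lemma card_spanning_tree T : (0 < n)%N -> spanning_tree T -> #|T| = n.-1.
Proof.
move=> n0 /(tree_parent_edges (Ordinal n0))[p pm ->].
by rewrite card_parent_edges // cardsC1 card_ord.
Qed.

End Weights.
End TreeParent.

(** * Effective resistances: Dirichlet's and Rayleigh's principles *)

Section Electric.
Variables (n : nat) (R : realFieldType).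
Let V := 'I_n.
Implicit Types (w : edge n -> R) (e : edge n) (u r x y v : V) (f g : V -> R).

Definition without w e : edge n -> R := fun h => if h == e then 0 else w h.

(** By [matrix_forest], the total weight of the forests with two components, one
    containing u and the other r. The ratio of [forest_sum] to [tree_sum] is the
    effective resistance between u and r. *)
Definition forest_sum u r w : R :=
  \det (rooted_laplacian [set r; u]%SET (pair_weight w)).

(** The sum runs over ordered pairs, so this is twice the usual Dirichlet energy. *)
Definition energy w f : R := \sum_x \sum_y pair_weight w x y * (f x - f y) ^+ 2.

Definition strength w x : R := \sum_y pair_weight w x y.

Lemma forest_sum_ge0 u r w : (forall e, 0 <= w e) -> 0 <= forest_sum u r w.
Proof.
move=> w0; rewrite /forest_sum -matrix_forest; apply: sumr_ge0 => p _.
by apply: prodr_ge0 => v _; exact: pair_weight_ge0.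
Qed.

Lemma pair_weight_without w e u r x y : val e = [set u; r]%SET ->
  pair_weight (without w e) x y =
  pair_weight w x y - (((x == u) && (y == r)) || ((x == r) && (y == u)))%:R * w e.
Proof.
move=> E; rewrite -eq_set2 -E /pair_weight.
have [->|xy] := eqVneq x y.
  rewrite insubF ?finset.setUid ?cards1 //.
  suff -> : [set y]%SET == val e = false by rewrite mul0r subr0.
  by apply/eqP => F; have := valP e; rewrite -F cards1.
have [h F ->] := insub_edge xy; rewrite -F /without (inj_eq val_inj).
by case: eqP => [->|]; rewrite ?mul1r ?subrr ?mul0r ?subr0.
Qed.

Lemma forest_sum_without u r w e : val e = [set u; r]%SET ->
  forest_sum u r (without w e) = forest_sum u r w.
Proof.
move=> E; congr (\det _); apply/matrixP => v x; rewrite !mxE.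
case: ifP => //; rewrite !inE => /norP[vr vu].
have P y : pair_weight (without w e) v y = pair_weight w v y.
  by rewrite (pair_weight_without _ _ _ E) (negbTE vu) (negbTE vr) mul0r subr0.
by rewrite P; congr (_ * _ - _); apply: eq_bigr => y _; exact: P.
Qed.

(** The weight of e enters the determinant only through the row of u, and affinely. The
    slope is the determinant with that row replaced by the difference of the rows of u
    and r of the identity; the part with the row of r vanishes because the row of r is
    already there. *)
Lemma tree_sum_split u r w e : u != r -> val e = [set u; r]%SET ->
  tree_sum w = tree_sum (without w e) + w e * forest_sum u r w.
Proof.
move=> ur E; rewrite !(matrix_tree r).
pose C : 'M[R]_n := \matrix_(v, x) if v == u then (x == u)%:R - (x == r)%:R
                      else rooted_laplacian [set r]%SET (pair_weight w) v x.
have -> : forest_sum u r w = \det C.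
  pose C' : 'M[R]_n := \matrix_(v, x) if v == u then (x == r)%:R
                      else rooted_laplacian [set r]%SET (pair_weight w) v x.
  rewrite (@determinant_multilinear _ _ C (rooted_laplacian [set r; u]%SET (pair_weight w)) C' u 1 (-1)).
  - suff -> : \det C' = 0 by rewrite mulr0 addr0 mul1r.
    apply: (determinant_alternate (i1 := u) (i2 := r)) => // x.
    by rewrite !mxE eqxx [r == u]eq_sym (negbTE ur) inE eqxx eq_sym.
  - apply/rowP => x; rewrite !mxE eqxx !inE eqxx orbT mul1r mulN1r.
    by rewrite ![u == _]eq_sym.
  - apply/matrixP => i j; rewrite !mxE !inE [lift u i == u]eq_sym (negbTE (neq_lift _ _)).
    by rewrite orbF.
  - apply/matrixP => i j; rewrite !mxE [lift u i == u]eq_sym.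
    by rewrite (negbTE (neq_lift _ _)).
have c0 v y : v != u -> v != r -> pair_weight (without w e) v y = pair_weight w v y.
  by move=> vu vr; rewrite (pair_weight_without _ _ _ E) (negbTE vu) (negbTE vr) mul0r subr0.
have c1 y : pair_weight w u y = pair_weight (without w e) u y + (y == r)%:R * w e.
  by rewrite (pair_weight_without _ _ _ E) eqxx (negbTE ur) /= orbF subrK.
rewrite (@determinant_multilinear _ _ _
  (rooted_laplacian [set r]%SET (pair_weight (without w e))) C u 1 (w e)) ?mul1r //.
- apply/rowP => x; rewrite !mxE !inE eqxx (negbTE ur) mul1r.
  under eq_bigr do rewrite c1.
  rewrite big_split /= c1 -mulr_suml.
  have -> : \sum_(i < n) (i == r)%:R = 1 :> R.
    by rewrite (bigD1 r) //= eqxx big1 ?addr0 // => i /negbTE ->.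
  by rewrite [x == u]eq_sym; ring.
- apply/matrixP => i j; rewrite !mxE !inE.
  have lu : lift u i != u by rewrite eq_sym neq_lift.
  have [//|lr] := eqVneq (lift u i) r.
  by rewrite c0 //; congr (_ * _ - _); apply: eq_bigr => y _; rewrite c0.
- apply/matrixP => i j; rewrite !mxE [lift u i == u]eq_sym.
  by rewrite (negbTE (neq_lift _ _)).
Qed.

(** The column of u in the inverse of the Laplacian is the potential of a unit current
    from u to r, its value at u being a quotient of minors. The identity for all g is
    Kirchhoff's node law summed by parts. *)
Lemma potential u r w : u != r -> 0 < tree_sum w ->
  exists2 f, f u - f r = forest_sum u r w / tree_sum w &
   forall g, \sum_x \sum_y pair_weight w x y * ((f x - f y) * (g x - g y)) =
     2 * (g u - g r).
Proof.
move=> ur Z0; pose c := pair_weight w; pose M := rooted_laplacian [set r]%SET c.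
have dM : \det M = tree_sum w by rewrite (matrix_tree r).
have UM : M \in unitmx by rewrite unitmxE unitfE dM gt_eqF.
pose f x := invmx M x u.
have Mf v : \sum_x M v x * f x = (v == u)%:R.
  have := mulmxV UM => /matrixP /(_ v u); rewrite !mxE => <-.
  by apply: eq_bigr.
have fr : f r = 0.
  have := Mf r; rewrite (bigD1 r) //= big1; last first.
    by move=> i ir; rewrite !mxE inE eqxx eq_sym (negbTE ir) mul0r.
  by rewrite !mxE inE !eqxx eq_sym (negbTE ur) mul1r addr0.
pose L v := \sum_x c v x * (f v - f x).
have LdE v : L v = \sum_x c v x * (f v - f x) by [].
clearbody L.
have Lv v : v != r -> L v = (v == u)%:R.
  move=> vr; rewrite -Mf LdE.
  under eq_bigr do rewrite mulrBr.
  under [RHS]eq_bigr do rewrite !mxE inE (negbTE vr) mulrBl.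
  rewrite !big_split /= !sumrN; congr (_ - _).
  rewrite -mulr_suml [RHS](bigD1 v) //= eqxx mulr1 [X in _ = _ + X]big1 ?addr0 //.
  by move=> i iv; rewrite eq_sym (negbTE iv) mulr0 mul0r.
have L0 : \sum_v L v = 0.
  have : \sum_v L v = - \sum_v L v.
    under eq_bigr do rewrite LdE.
    rewrite [LHS]exchange_big /= -sumrN; apply: eq_bigr => v _.
    rewrite -sumrN; apply: eq_bigr => x _.
    by rewrite /c pair_weightC -mulrN opprB.
  by move=> /eqP; rewrite -addr_eq0 -mulr2n mulrn_eq0 /= => /eqP.
have LE v : L v = (v == u)%:R - (v == r)%:R.
  have [->|vr] := eqVneq v r; last by rewrite Lv // subr0.
  rewrite eq_sym (negbTE ur) sub0r; move/eqP: L0; rewrite (bigD1 r) //=.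
  rewrite (bigD1 u) //= (Lv u ur) eqxx big1 ?addr0 ?addr_eq0 => [/eqP //|i /andP[ir iu]].
  by rewrite Lv // (negbTE iu).
exists f => [|g].
  rewrite fr subr0 /f /invmx UM mxE dM mxE mulrC; congr (_ / _).
  rewrite /forest_sum (expand_det_row _ u) (bigD1 u) //= big1 ?addr0.
    rewrite mxE !inE eqxx orbT mul1r /cofactor; congr (_ * \det _).
    apply/matrixP => i j; rewrite !mxE !inE [lift u i == u]eq_sym.
    by rewrite (negbTE (neq_lift _ _)) orbF.
  by move=> i iu; rewrite mxE !inE eqxx orbT eq_sym (negbTE iu) mul0r.
have S1 : \sum_x \sum_y c x y * (f x - f y) * g x = g u - g r.
  transitivity (\sum_x ((x == u)%:R - (x == r)%:R) * g x).
    by apply: eq_bigr => x _; rewrite -mulr_suml -LdE LE.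
  under eq_bigr do rewrite mulrBl.
  rewrite big_split sumrN /=; congr (_ - _).
    by rewrite (bigD1 u) //= eqxx mul1r big1 ?addr0 // => i /negbTE ->; rewrite mul0r.
  by rewrite (bigD1 r) //= eqxx mul1r big1 ?addr0 // => i /negbTE ->; rewrite mul0r.
transitivity (\sum_x \sum_y c x y * (f x - f y) * g x
              + \sum_x \sum_y c x y * (f y - f x) * g y).
  rewrite -big_split; apply: eq_bigr => x _; rewrite -big_split; apply: eq_bigr => y _ /=.
  by rewrite /c; ring.
rewrite [X in _ + X]exchange_big /=.
under [X in _ + X]eq_bigr do under eq_bigr do rewrite /c pair_weightC.
by rewrite S1; ring.
Qed.

(** If the resistance vanished, the unit current would dissipate nothing; moving its
    potential by a small multiple of the indicator of u would then make an energy
    negative. *)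
Lemma forest_sum_gt0 u r w : u != r -> (forall e, 0 <= w e) -> 0 < tree_sum w ->
  0 < forest_sum u r w.
Proof.
move=> ur w0 Z0; rewrite lt_neqAle forest_sum_ge0 // andbT; apply/eqP => N0.
have [f fu fE] := potential ur Z0.
pose D := energy w (fun x => (x == u)%:R).
have D0 : 0 <= D by do 2 (apply: sumr_ge0 => ? _); rewrite mulr_ge0 ?sqr_ge0 ?pair_weight_ge0.
(* A step t with t D < 4 makes the second order term smaller than the gain. *)
pose t := (1 + D)^-1.
have t0 : 0 < t by rewrite invr_gt0 ltr_pwDl.
have : 0 <= \sum_x \sum_y pair_weight w x y * ((f x - f y) - t * ((x == u)%:R - (y == u)%:R)) ^+ 2.
  by do 2 (apply: sumr_ge0 => ? _); rewrite mulr_ge0 ?sqr_ge0 ?pair_weight_ge0.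
have -> : \sum_x \sum_y pair_weight w x y * ((f x - f y) - t * ((x == u)%:R - (y == u)%:R)) ^+ 2
  = \sum_x \sum_y pair_weight w x y * ((f x - f y) * (f x - f y))
   - 2 * t * (\sum_x \sum_y pair_weight w x y * ((f x - f y) * ((x == u)%:R - (y == u)%:R)))
   + t ^+ 2 * D.
  rewrite /D /energy !mulr_sumr -sumrN -!big_split; apply: eq_bigr => x _ /=.
  by rewrite !mulr_sumr -sumrN -!big_split; apply: eq_bigr => y _ /=; ring.
rewrite (fE f) (fE (fun x => (x == u)%:R)) fu -N0 mul0r mulr0 eqxx eq_sym (negbTE ur).
rewrite subr0 mulr1 sub0r.
have -> : - (2 * t * 2) + t ^+ 2 * D = t * (t * D - 4) by ring.
rewrite pmulr_rge0 // subr_ge0 => le.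
have : t * D <= 1 by rewrite /t mulrC ler_pdivrMr ?mul1r ?lerDr ?ltr_pwDl // ler_wpDl.
by move=> le1; have := le_trans le le1; rewrite -[1]/(1%:R) ler_nat.
Qed.

(** The potential of the unit current, rescaled to a unit drop. *)
Lemma dirichlet_attained u r w : u != r -> (forall e, 0 <= w e) -> 0 < tree_sum w ->
  exists2 g, g u - g r = 1 & forest_sum u r w * energy w g = 2 * tree_sum w.
Proof.
move=> ur w0 Z0; have N0 := forest_sum_gt0 ur w0 Z0.
have [f fu fE] := potential ur Z0.
set N := forest_sum u r w in N0 fu *; set Z := tree_sum w in Z0 fu *.
have nN : N != 0 by rewrite gt_eqF. have nZ : Z != 0 by rewrite gt_eqF.
exists (fun x => Z / N * f x); first by rewrite -mulrBr fu; field; rewrite nN nZ.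
have -> : energy w (fun x => Z / N * f x) = (Z / N) ^+ 2 *
   \sum_x \sum_y pair_weight w x y * ((f x - f y) * (f x - f y)).
  rewrite /energy mulr_sumr; apply: eq_bigr => x _; rewrite mulr_sumr.
  by apply: eq_bigr => y _; ring.
by rewrite fE fu; field; rewrite nN nZ.
Qed.

(** Expand the energy, which is nonnegative, of the difference between g and the
    multiple of the potential with the same drop. *)
Theorem dirichlet_principle u r w g : u != r -> (forall e, 0 <= w e) -> 0 < tree_sum w ->
  2 * tree_sum w * (g u - g r) ^+ 2 <= forest_sum u r w * energy w g.
Proof.
move=> ur w0 Z0; have N0 := forest_sum_gt0 ur w0 Z0.
have [f fu fE] := potential ur Z0.
set N := forest_sum u r w in N0 fu *; set Z := tree_sum w in Z0 fu *.
set d := g u - g r.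
have nN : N != 0 by rewrite gt_eqF. have nZ : Z != 0 by rewrite gt_eqF.
(* The multiple of the potential with the same drop as g. *)
pose s := d * Z / N.
have : 0 <= \sum_x \sum_y pair_weight w x y * ((g x - g y) - s * (f x - f y)) ^+ 2.
  by do 2 (apply: sumr_ge0 => ? _); rewrite mulr_ge0 ?sqr_ge0 ?pair_weight_ge0.
have -> : \sum_x \sum_y pair_weight w x y * ((g x - g y) - s * (f x - f y)) ^+ 2
  = energy w g
   - 2 * s * (\sum_x \sum_y pair_weight w x y * ((f x - f y) * (g x - g y)))
   + s ^+ 2 * (\sum_x \sum_y pair_weight w x y * ((f x - f y) * (f x - f y))).
  rewrite /energy !mulr_sumr -sumrN -!big_split; apply: eq_bigr => x _ /=.
  by rewrite !mulr_sumr -sumrN -!big_split; apply: eq_bigr => y _ /=; ring.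
rewrite !fE fu -/d => le.
have : 0 <= N * (energy w g - 2 * s * (2 * d) + s ^+ 2 * (2 * (N / Z))).
  by rewrite mulr_ge0 // ltW.
suff -> : N * (energy w g - 2 * s * (2 * d) + s ^+ 2 * (2 * (N / Z))) =
          N * energy w g - 2 * Z * d ^+ 2 by rewrite subr_ge0.
by rewrite /s; field; rewrite nN nZ.
Qed.

Lemma le_pair_weight w w' x y : (forall e, w e <= w' e) ->
  pair_weight w x y <= pair_weight w' x y.
Proof. by move=> H; rewrite /pair_weight; case: insub. Qed.

Lemma le_energy w w' g : (forall e, w e <= w' e) -> energy w g <= energy w' g.
Proof.
move=> H; do 2 (apply: ler_sum => ? _).
by rewrite ler_wpM2r ?sqr_ge0 // le_pair_weight.
Qed.

Lemma energy_ge0 w g : (forall e, 0 <= w e) -> 0 <= energy w g.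
Proof.
move=> w0; do 2 (apply: sumr_ge0 => ? _).
by rewrite mulr_ge0 ?sqr_ge0 ?pair_weight_ge0.
Qed.

Lemma energy_sum (I : finType) (G : pred I) (ws : I -> edge n -> R) g :
  energy (fun e => \sum_(i | G i) ws i e) g = \sum_(i | G i) energy (ws i) g.
Proof.
rewrite /energy [RHS]exchange_big /=; apply: eq_bigr => x _.
rewrite [RHS]exchange_big /=; apply: eq_bigr => y _; rewrite -mulr_suml; congr (_ * _).
by rewrite /pair_weight; case: insub => //=; rewrite big1.
Qed.

(** Raising weights lowers resistances, since the minimiser for the larger weights
    competes for the smaller ones. *)
Lemma rayleigh u r w w' : u != r -> (forall e, 0 <= w e) -> (forall e, w e <= w' e) ->
  0 < tree_sum w -> 0 < tree_sum w' ->
  forest_sum u r w' * tree_sum w <= forest_sum u r w * tree_sum w'.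
Proof.
move=> ur w0 ww' Z0 Z0'; have w0' e : 0 <= w' e := le_trans (w0 e) (ww' e).
have [g gd gE] := dirichlet_attained ur w0' Z0'.
have := dirichlet_principle g ur w0 Z0; rewrite gd expr1n mulr1 => le.
rewrite -(ler_pM2l (ltr0Sn R 1)) mulrCA.
have -> : 2 * (forest_sum u r w * tree_sum w') = forest_sum u r w * (2 * tree_sum w') by ring.
rewrite -gE; apply: le_trans (_ : forest_sum u r w' * (forest_sum u r w * energy w g) <= _).
  by rewrite ler_wpM2l ?forest_sum_ge0.
by rewrite mulrCA !ler_wpM2l ?forest_sum_ge0 // le_energy.
Qed.

(** Conductances in parallel add up: the minimiser for w competes in every layer, and
    energies add. So if each of #|G| layers has resistance at most c, then w has
    resistance at most c / #|G|. *)
Lemma parallel_layers u r w (I : finType) (G : pred I) (ws : I -> edge n -> R) (c : R) :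
  u != r -> 0 < c -> 0 < tree_sum w -> (forall e, 0 <= w e) ->
  (forall i e, G i -> 0 <= ws i e) -> (forall e, \sum_(i | G i) ws i e <= w e) ->
  (forall i, G i -> 0 < tree_sum (ws i)) ->
  (forall i, G i -> forest_sum u r (ws i) <= c * tree_sum (ws i)) ->
  forest_sum u r w * #|G|%:R <= c * tree_sum w.
Proof.
move=> ur c0 Z0 w0 ws0 wsw Zs Ns.
have [g gd gE] := dirichlet_attained ur w0 Z0.
rewrite -(ler_pM2l (ltr0Sn R 1)) [X in _ <= X]mulrCA -gE mulrCA [X in _ <= X]mulrCA.
rewrite ler_wpM2l ?forest_sum_ge0 //.
apply: le_trans (_ : c * energy (fun e => \sum_(i | G i) ws i e) g <= _); last first.
  by rewrite ler_wpM2l ?(ltW c0) // le_energy.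
rewrite energy_sum mulr_sumr -sum1_card natr_sum mulr_sumr; apply: ler_sum => i Gi.
have := dirichlet_principle g ur (fun e => ws0 i e Gi) (Zs i Gi).
rewrite gd expr1n mulr1 => le.
have := le_trans le (ler_wpM2r (energy_ge0 g (fun e => ws0 i e Gi)) (Ns i Gi)).
have -> : c * tree_sum (ws i) * energy (ws i) g = tree_sum (ws i) * (c * energy (ws i) g) by ring.
by rewrite mulr1 [2 * tree_sum _]mulrC ler_pM2l ?Zs.
Qed.

(** The test function for Dirichlet's principle is 1/2 at u, -1/2 at r and 0 elsewhere,
    so that only the edges at u and r count. *)
Lemma forest_sum_lower u r w e : u != r -> val e = [set u; r]%SET ->
  (forall e, 0 <= w e) -> 0 < tree_sum w ->
  4 * tree_sum w <= forest_sum u r w * (strength w u + strength w r + 2 * w e).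
Proof.
move=> ur E w0 Z0.
have bT : true%:R = 1 :> R by []. have bF : false%:R = 0 :> R by [].
pose g x : R := (x == u)%:R / 2 - (x == r)%:R / 2.
have := dirichlet_principle g ur w0 Z0.
rewrite /g !eqxx [r == u]eq_sym (negbTE ur) => le.
have {le} : 2 * tree_sum w <= forest_sum u r w * energy w g.
  move: le; set a := (X in _ * X <= _); suff -> : a = 1 by rewrite mulr1.
  by rewrite /a !bT !bF; field.
suff -> : energy w g = (strength w u + strength w r + 2 * w e) / 2.
  set S := (_ + 2 * _) => le.
  by have := ler_wpM2l (ler0n R 2) le; congr (_ <= _); field.
have S1 v : \sum_x \sum_y pair_weight w x y * (x == v)%:R = strength w v.
  rewrite (bigD1 v) //= [X in _ + X]big1 ?addr0; last first.
    by move=> x xv; rewrite big1 // => y _; rewrite (negbTE xv) mulr0.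
  by apply: eq_bigr => y _; rewrite eqxx mulr1.
have S2 v : \sum_x \sum_y pair_weight w x y * (y == v)%:R = strength w v.
  rewrite exchange_big /= -S1; apply: eq_bigr => x _; apply: eq_bigr => y _.
  by rewrite pair_weightC.
have S3 v v' : \sum_x \sum_y pair_weight w x y * ((x == v) && (y == v'))%:R = pair_weight w v v'.
  rewrite (bigD1 v) //= [X in _ + X]big1 ?addr0; last first.
    by move=> x xv; rewrite big1 // => y _; rewrite (negbTE xv) mulr0.
  rewrite (bigD1 v') //= !eqxx mulr1 big1 ?addr0 // => y yv.
  by rewrite (negbTE yv) andbF mulr0.
transitivity (4^-1 * (\sum_x \sum_y pair_weight w x y * (x == u)%:R
  + \sum_x \sum_y pair_weight w x y * (y == u)%:R
  + \sum_x \sum_y pair_weight w x y * (x == r)%:R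
  + \sum_x \sum_y pair_weight w x y * (y == r)%:R)
  + 2^-1 * (\sum_x \sum_y pair_weight w x y * ((x == u) && (y == r))%:R
  + \sum_x \sum_y pair_weight w x y * ((x == r) && (y == u))%:R)); last first.
  rewrite !S1 !S2 !S3 (pair_weightE _ E) pair_weightC (pair_weightE _ E).
  by field.
rewrite /energy -!big_split /= !mulr_sumr -big_split /=; apply: eq_bigr => x _.
rewrite -!big_split /= !mulr_sumr -big_split /=; apply: eq_bigr => y _.
have [->|xy] := eqVneq x y; first by rewrite pair_weightxx !mul0r !addr0 !mulr0 addr0.
rewrite /g; move: xy; have [->|_] := eqVneq x u; have [->|_] := eqVneq y u;
 rewrite ?(negbTE ur) ?eqxx //= => xy.
- by have [_|_] := eqVneq y r; rewrite ?bT ?bF; field.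
- by have [_|_] := eqVneq x r; rewrite ?bT ?bF; field.
- move: xy; have [->|_] := eqVneq x r; have [->|_] := eqVneq y r; rewrite ?eqxx //= => _;
  by rewrite ?bT ?bF; field.
Qed.

End Electric.

(** * Averages over finite product spaces and negative association *)

Section Average.
Variable R : realFieldType.

Definition avg (T : finType) (g : T -> R) : R := (\sum_x g x) / #|T|%:R.

Section General.
Variable T : finType.
Implicit Types g h : T -> R.

Lemma eq_avg g h : g =1 h -> avg g = avg h.
Proof. by move=> gh; congr (_ / _); apply: eq_bigr => x _; rewrite gh. Qed.

Lemma le_avg g h : (forall x, g x <= h x) -> avg g <= avg h.
Proof. by move=> gh; rewrite ler_wpM2r ?invr_ge0 // ler_sum. Qed.

Lemma avg_ge0 g : (forall x, 0 <= g x) -> 0 <= avg g.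
Proof. by move=> g0; rewrite divr_ge0 ?sumr_ge0. Qed.

Lemma avgD g h : avg (fun x => g x + h x) = avg g + avg h.
Proof. by rewrite /avg big_split mulrDl. Qed.

Lemma avgN g : avg (fun x => - g x) = - avg g.
Proof. by rewrite /avg sumrN mulNr. Qed.

Lemma avgB g h : avg (fun x => g x - h x) = avg g - avg h.
Proof. by rewrite avgD avgN. Qed.

Lemma avgZ c g : avg (fun x => c * g x) = c * avg g.
Proof. by rewrite /avg -mulr_sumr mulrA. Qed.

Lemma avg_sum (I : finType) (P : pred I) (g : I -> T -> R) :
  avg (fun x => \sum_(i | P i) g i x) = \sum_(i | P i) avg (g i).
Proof. by rewrite /avg exchange_big /= mulr_suml. Qed.

Lemma avg_cst c : (0 < #|T|)%N -> avg (fun _ : T => c) = c.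
Proof.
move=> T0; rewrite /avg sumr_const -[c *+ _]mulr_natr mulfK //.
by rewrite pnatr_eq0 -lt0n.
Qed.

Lemma avg_le_cst c g : (0 < #|T|)%N -> (forall x, g x <= c) -> avg g <= c.
Proof. by move=> T0 gc; rewrite -(avg_cst c T0) le_avg. Qed.

(** Average the hypothesis over two independent copies. *)
Lemma chebyshev_sum g h : (forall x y, (g x - g y) * (h x - h y) <= 0) ->
  avg (fun x => g x * h x) <= avg g * avg h.
Proof.
move=> gh; case: (posnP #|T|) => [T0|T0].
  by rewrite /avg T0 invr0 !mulr0.
have c0 : (0 : R) < #|T|%:R by rewrite ltr0n.
suff H : #|T|%:R * (\sum_x g x * h x) <= (\sum_x g x) * (\sum_x h x).
  rewrite /avg mulrACA -invfM ler_pdivlMr ?mulr_gt0 //.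
  by rewrite -mulrA mulKf ?gt_eqF // mulrC.
have : \sum_x \sum_y (g x - g y) * (h x - h y) <= 0.
  by apply: sumr_le0 => x _; apply: sumr_le0.
have -> : \sum_x \sum_y (g x - g y) * (h x - h y) =
  2 * (#|T|%:R * (\sum_x g x * h x) - (\sum_x g x) * (\sum_x h x)).
  transitivity (\sum_x \sum_(y : T) g x * h x + \sum_(x : T) \sum_y g y * h y
     - \sum_x \sum_y g x * h y - \sum_x \sum_y g y * h x).
    rewrite -!sumrN -!big_split; apply: eq_bigr => x _.
    by rewrite /= -!sumrN -!big_split; apply: eq_bigr => y _ /=; ring.
  rewrite [\sum_x \sum_y g y * h x]exchange_big /=.
  have -> : \sum_x \sum_(y : T) g x * h x = #|T|%:R * \sum_x g x * h x.
    by rewrite mulr_sumr; apply: eq_bigr => x _; rewrite sumr_const mulr_natl.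
  have -> : \sum_(x : T) \sum_y g y * h y = #|T|%:R * \sum_x g x * h x.
    by rewrite sumr_const mulr_natl.
  have -> : \sum_x \sum_y g x * h y = (\sum_x g x) * (\sum_x h x).
    by rewrite mulr_suml; apply: eq_bigr => x _; rewrite mulr_sumr.
  by ring.
by rewrite pmulr_rle0 // subr_le0.
Qed.

End General.

Section Product.
Variables F L : finType.
Implicit Types (g h : {ffun F -> L} -> R) (a : {ffun F -> L}) (f : F) (x y : L).
Hypothesis L0 : (0 < #|L|)%N.

Lemma card_env_gt0 : (0 < #|{ffun F -> L}|)%N.
Proof. by rewrite card_ffun expn_gt0 L0. Qed.

Lemma avg_prod (u : F -> L -> R) :
  avg (fun a : {ffun F -> L} => \prod_f u f (a f)) = \prod_f avg (u f).
Proof.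
rewrite /avg -bigA_distr_bigA /= big_split /=; congr (_ * _).
by rewrite card_ffun natrX prodr_const exprVn.
Qed.

Definition upd a f x : {ffun F -> L} := [ffun h => if h == f then x else a h].

Lemma updE a f x : upd a f x f = x. Proof. by rewrite ffunE eqxx. Qed.
Lemma upd_neq a f x (h : F) : h != f -> upd a f x h = a h.
Proof. by move=> hf; rewrite ffunE (negbTE hf). Qed.
Lemma upd_id a f : upd a f (a f) = a.
Proof. by apply/ffunP => h; rewrite ffunE; case: eqP => [->|]. Qed.
Lemma updd a f x y : upd (upd a f x) f y = upd a f y.
Proof. by apply/ffunP => h; rewrite !ffunE; case: eqP. Qed.
Lemma updC a f f' x y : f != f' -> upd (upd a f x) f' y = upd (upd a f' y) f x.
Proof.
move=> ff; apply/ffunP => h; rewrite !ffunE.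
by case: (eqVneq h f') => // ->; rewrite eq_sym (negbTE ff).
Qed.

Lemma upd_le (c : L -> R) a f x y (h : F) : c y <= c x ->
  c (upd a f y h) <= c (upd a f x h).
Proof.
by move=> xy; have [->|hf] := eqVneq h f; rewrite ?updE // !upd_neq.
Qed.

(** The conditional mean given all coordinates except f. *)
Definition resample f g a : R := avg (fun x => g (upd a f x)).

Lemma avg_resample f g : avg (resample f g) = avg g.
Proof.
rewrite /avg /resample /avg -mulr_suml.
have -> : \sum_a \sum_x g (upd a f x) = (\sum_a g a) * #|L|%:R.
  rewrite pair_big /=.
  have inv : involutive (fun ax : {ffun F -> L} * L => (upd ax.1 f ax.2, ax.1 f)).
    by case=> a x /=; rewrite updE updd upd_id.
  rewrite (reindex_inj (inv_inj inv)) /=.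
  under eq_bigr do rewrite updd upd_id.
  rewrite -(pair_big predT predT (fun a (_ : L) => g a)) /=.
  under eq_bigr do rewrite sumr_const.
  by rewrite sumrMnl mulr_natr.
by rewrite mulfK // pnatr_eq0 -lt0n.
Qed.

Lemma avg_coord f (u : L -> R) : avg (fun a : {ffun F -> L} => u (a f)) = avg u.
Proof.
rewrite -(avg_resample f) -[RHS](avg_cst _ card_env_gt0).
by apply: eq_avg => a; apply: eq_avg => x; rewrite updE.
Qed.

Lemma avg_coord2 f f' (u v : L -> R) : f != f' ->
  avg (fun a : {ffun F -> L} => u (a f) * v (a f')) = avg u * avg v.
Proof.
move=> ff; rewrite -(avg_resample f) /resample.
under eq_avg => a.
  under eq_avg => x do rewrite updE upd_neq 1?eq_sym // mulrC.
  rewrite avgZ mulrC.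
  over.
by rewrite avgZ avg_coord.
Qed.

(** Distinct coordinates are uncorrelated, so variances add. *)
Lemma avg_variance (A : {set F}) (u : L -> R) :
  avg (fun a : {ffun F -> L} => (\sum_(f in A) (u (a f) - avg u)) ^+ 2) <=
  #|A|%:R * avg (fun x => u x ^+ 2).
Proof.
have E a : (\sum_(f in A) (u (a f) - avg u)) ^+ 2 =
  \sum_(f in A) \sum_(f' in A) (u (a f) - avg u) * (u (a f') - avg u).
  by rewrite expr2 mulr_suml; apply: eq_bigr => f _; rewrite mulr_sumr.
rewrite (eq_avg E) avg_sum -sum1_card natr_sum mulr_suml.
apply: ler_sum => f fA; rewrite avg_sum (bigD1 f) //= [X in _ + X]big1 ?addr0.
  rewrite (avg_coord f (fun x => (u x - avg u) * (u x - avg u))).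
  have -> : avg (fun x => (u x - avg u) * (u x - avg u)) =
     avg (fun x => u x ^+ 2) - (avg u) ^+ 2.
    transitivity (avg (fun x => u x ^+ 2 - (2 * avg u) * u x + avg u ^+ 2)).
      by apply: eq_avg => x; ring.
    by rewrite avgD avgB avgZ avg_cst //; ring.
  by rewrite mul1r lerBlDr lerDl sqr_ge0.
move=> f' /andP[_ ff].
rewrite (avg_coord2 (fun x => u x - avg u) (fun x => u x - avg u)) 1?eq_sym //.
by rewrite avgB avg_cst // subrr mul0r.
Qed.

Lemma avg_relabel (s : F -> F) g : bijective s ->
  avg (fun a => g [ffun f => a (s f)]) = avg g.
Proof.
case=> t st ts; congr (_ / _).
rewrite [RHS](reindex (fun a : {ffun F -> L} => [ffun f => a (s f)])) //=.
exists (fun a : {ffun F -> L} => [ffun f => a (t f)]) => a _; apply/ffunP => f.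
  by rewrite !ffunE ts.
by rewrite !ffunE st.
Qed.

Section NegativeAssociation.
Variable J : pred L.

(** The penalty of one layer: J is the set of values in that layer, and only membership
    in J matters. *)
Definition antitone_on g := forall a f x y,
  [/\ J x -> J y -> g (upd a f x) = g (upd a f y),
      ~~ J x -> ~~ J y -> g (upd a f x) = g (upd a f y)
    & J x -> ~~ J y -> g (upd a f x) <= g (upd a f y)].

(** For the penalties of the other layers, a value in J is the worst, since it lies in
    none of those layers. *)
Definition maximal_on h := forall a f x y, J y -> h (upd a f x) <= h (upd a f y).

Lemma antitone_resample f g : antitone_on g -> antitone_on (resample f g).
Proof.
move=> P a f' x y; rewrite /resample; have [->|ff] := eqVneq f' f.
  by split=> *; [| |apply: le_avg => z]; rewrite ?(eq_avg (fun z => _)) //; do ?[apply: eq_avg => z]; rewrite !updd.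
split=> Jx Jy; [apply: eq_avg|apply: eq_avg|apply: le_avg] => z; rewrite !(updC _ _ _ ff);
 by have [] := P (upd a f z) f' x y; auto.
Qed.

Lemma maximal_resample f h : maximal_on h -> maximal_on (resample f h).
Proof.
move=> P a f' x y Jy; rewrite /resample; apply: le_avg => z.
have [->|ff] := eqVneq f' f; first by rewrite !updd.
by rewrite !(updC _ _ _ ff); apply: P.
Qed.

(** As functions of the coordinate f, the factors are oppositely ordered. *)
Lemma avg_mul_resample f g h : antitone_on g -> maximal_on h ->
  avg (fun a => g a * h a) <= avg (fun a => resample f g a * resample f h a).
Proof.
move=> Pg Ph; rewrite -(avg_resample f); apply: le_avg => a.
apply: (chebyshev_sum (g := fun x => g (upd a f x)) (h := fun x => h (upd a f x))) => x y.
have [g1 g2 g3] := Pg a f x y; have [_ _ g3'] := Pg a f y x.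
have [Jx|Jx] := boolP (J x); have [Jy|Jy] := boolP (J y).
- by rewrite g1 // subrr mul0r.
- by rewrite mulr_le0_ge0 // ?subr_le0 ?subr_ge0 ?g3 ?Ph.
- by rewrite mulr_ge0_le0 // ?subr_le0 ?subr_ge0 ?g3' ?Ph.
- by rewrite g2 // subrr mul0r.
Qed.

Lemma resample_const (s : seq F) g a (b : {ffun F -> L}) : (forall f, f \notin s -> a f = b f) ->
  foldr resample g s a = foldr resample g s b.
Proof.
elim: s a b => [|f s IH] a b ab /=.
  by congr g; apply/ffunP => f; apply: ab.
apply: eq_avg => x; apply: IH => f' fs; rewrite !ffunE; case: eqP => // /eqP ff.
by apply: ab; rewrite inE negb_or ff.
Qed.

(** Resample the coordinates one at a time. Each step can only raise the mean of the
    product and keeps both means; at the end both factors are constant. *)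
Theorem negative_association g h : antitone_on g -> maximal_on h ->
  avg (fun a => g a * h a) <= avg g * avg h.
Proof.
move=> Pg Ph.
have H (s : seq F) : [/\ antitone_on (foldr resample g s), maximal_on (foldr resample h s),
   avg (foldr resample g s) = avg g, avg (foldr resample h s) = avg h &
   avg (fun a => g a * h a) <=
   avg (fun a => foldr resample g s a * foldr resample h s a)].
  elim: s => [|f s [P1 P2 E1 E2 le]] //=; split.
  - exact: antitone_resample.
  - exact: maximal_resample.
  - by rewrite avg_resample.
  - by rewrite avg_resample.
  - by apply: le_trans le _; exact: avg_mul_resample.
have [_ _ Eg Eh le] := H (enum F); apply: le_trans le _.
have /card_gt0P[a0 _] := card_env_gt0.
have c u a : foldr resample u (enum F) a = foldr resample u (enum F) a0.
  by apply: resample_const => f; rewrite mem_enum.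
rewrite -Eg -Eh; rewrite (eq_avg (c g)) (eq_avg (c h)).
under eq_avg do rewrite (c g) (c h).
by rewrite !avg_cst ?card_env_gt0.
Qed.

End NegativeAssociation.

(** A coordinate lies in one layer at most, so helping the last layer hurts the others:
    the last penalty and the product of the previous ones are oppositely ordered in each
    coordinate. *)
Lemma negative_association_layers (J : nat -> pred L) (g : nat -> {ffun F -> L} -> R) m :
  (forall k a, 0 <= g k a) -> (forall k, antitone_on (J k) (g k)) ->
  (forall i j x, J i x -> J j x -> i = j) ->
  avg (fun a => \prod_(k < m) g k a) <= \prod_(k < m) avg (g k).
Proof.
move=> g0 Pg dJ; elim: m => [|m IH].
  by rewrite big_ord0; under eq_avg do rewrite big_ord0; rewrite avg_cst ?card_env_gt0.
rewrite big_ord_recr /=.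
under eq_avg do rewrite big_ord_recr /= mulrC.
apply: le_trans (_ : avg (g m) * avg (fun a => \prod_(k < m) g k a) <= _); last first.
  by rewrite mulrC ler_wpM2r ?avg_ge0.
apply: (negative_association (Pg m)) => a f x y Jy; apply: ler_prod => k _; rewrite g0 /=.
have Ny : ~~ J k y by apply/negP => Jk; have := ltn_ord k; rewrite (dJ _ _ _ Jk Jy) ltnn.
have [_ g2 g3] := Pg k a f x y.
by have [Jx|Jx] := boolP (J k x); [exact: g3|rewrite g2].
Qed.

End Product.
End Average.

(** * Inclusion probabilities of edges *)

Section Inclusion.
Variables (n : nat) (R : realFieldType).
Let V := 'I_n.
Implicit Types (w : edge n -> R) (e f : edge n) (u r x y v z : V).

(** The probability that the weighted random tree contains e. *)
Definition inclusion w e : R := 1 - tree_sum (without w e) / tree_sum w.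

(** The effective resistance between the ends of e when e is deleted, see [resistanceE].
    In this form it is clear that it does not depend on the weight of e. *)
Definition resistance w e : R :=
  tree_sum (fun h => if h == e then 1 else w h) / tree_sum (without w e) - 1.

Lemma tree_sum_gt0 w z : (forall e, 0 <= w e) ->
  (forall e, z \in val e -> 0 < w e) -> 0 < tree_sum w.
Proof.
move=> w0 wz; rewrite /tree_sum (sum_trees z).
pose p : {ffun V -> V} := [ffun _ => z].
have pm : parent_map [set z]%SET p.
  apply: parent_mapP => [v|v]; first by rewrite inE ffunE => /eqP.
  exists z; rewrite ?inE //; apply: connect1; by rewrite /= ffunE.
rewrite (bigD1 p) //= ltr_pwDl //; last first.
  by apply: sumr_ge0 => q _; apply: prodr_ge0.
apply: prodr_gt0 => e /parent_edgesP[v _ E]; apply: wz.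
by rewrite E ffunE finset.set22.
Qed.

Lemma tree_sum_gt0_all w : (0 < n)%N -> (forall e, 0 < w e) -> 0 < tree_sum w.
Proof. by move=> n0 w0; apply: (@tree_sum_gt0 _ (Ordinal n0)) => // e; exact: ltW. Qed.

Lemma exists_third u r : (2 < n)%N -> exists z, (z != u) && (z != r).
Proof.
move=> n2; have : (0 < #|~: [set u; r]%SET|)%N.
  rewrite cardsCs finset.setCK card_ord subn_gt0 cards2.
  by apply: leq_trans n2; case: (u != r).
by case/card_gt0P => z; rewrite !inE negb_or => H; exists z.
Qed.

Lemma without_ge0 w e : (forall e, 0 < w e) -> forall f, 0 <= without w e f.
Proof. by move=> w0 f; rewrite /without; case: eqP => // _; exact: ltW. Qed.

Lemma tree_sum_without_gt0 w e : (2 < n)%N -> (forall e, 0 < w e) ->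
  0 < tree_sum (without w e).
Proof.
move=> n2 w0; have [u [r [ur E]]] := edge_ends e.
have [z /andP[zu zr]] := exists_third u r n2.
apply: (@tree_sum_gt0 _ z); first exact: without_ge0.
move=> f zf; rewrite /without; case: eqP => // fe.
by move: zf; rewrite fe E !inE (negbTE zu) (negbTE zr).
Qed.

Lemma eq_tree_sum w w' : w =1 w' -> tree_sum w = tree_sum w'.
Proof. by move=> ww; apply: eq_bigr => T _; apply: eq_bigr => e _; rewrite ww. Qed.

Lemma eq_inclusion w w' e : w =1 w' -> inclusion w e = inclusion w' e.
Proof.
move=> ww; rewrite /inclusion (eq_tree_sum ww); congr (1 - _ / _).
by apply: eq_tree_sum => f; rewrite /without ww.
Qed.

Lemma eq_resistance w w' e : (forall f, f != e -> w f = w' f) ->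
  resistance w e = resistance w' e.
Proof.
move=> ww; rewrite /resistance; congr (_ / _ - _); apply: eq_tree_sum => f;
  by rewrite /without; case: eqP => // /eqP /ww.
Qed.

Lemma resistanceE w e u r : u != r -> val e = [set u; r]%SET ->
  tree_sum (without w e) != 0 ->
  resistance w e = forest_sum u r w / tree_sum (without w e).
Proof.
move=> ur E Z0; rewrite /resistance (tree_sum_split _ ur E) eqxx mul1r.
set w1 := (fun h => _).
have -> : tree_sum (without w1 e) = tree_sum (without w e).
  by apply: eq_tree_sum => f; rewrite /w1 /without; case: eqP.
have -> : forest_sum u r w1 = forest_sum u r w.
  rewrite -(forest_sum_without w E) -(forest_sum_without w1 E).
  congr (\det (rooted_laplacian _ _)); apply: funext => x; apply: funext => y.
  by rewrite /pair_weight; case: insub => // f; rewrite /w1 /without; case: eqP.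
by rewrite mulrDl divff // addrAC subrr add0r.
Qed.

Lemma resistance_ge0 w e : (2 < n)%N -> (forall e, 0 < w e) -> 0 <= resistance w e.
Proof.
move=> n2 w0; have [u [r [ur E]]] := edge_ends e.
have Z0 := tree_sum_without_gt0 e n2 w0.
rewrite (resistanceE ur E) ?gt_eqF // divr_ge0 ?(ltW Z0) ?forest_sum_ge0 // => f.
exact: ltW.
Qed.

(** This separates the dependence on the weight of e from that on all other weights,
    which are independent of it under a product law. *)
Lemma inclusion_resistance w e : (2 < n)%N -> (forall e, 0 < w e) ->
  inclusion w e = w e * resistance w e / (1 + w e * resistance w e).
Proof.
move=> n2 w0; have [u [r [ur E]]] := edge_ends e.
have Z0 := tree_sum_without_gt0 e n2 w0.
have C0 := resistance_ge0 e n2 w0.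
have Zs := tree_sum_split w ur E.
have CE : forest_sum u r w = resistance w e * tree_sum (without w e).
  by rewrite (resistanceE ur E) ?gt_eqF // divfK // gt_eqF.
have D0 : 1 + w e * resistance w e != 0.
  by rewrite gt_eqF // ltr_pwDl // mulr_ge0 // ltW.
rewrite /inclusion Zs CE; set C := resistance w e in C0 D0 *.
have -> : tree_sum (without w e) + w e * (C * tree_sum (without w e)) =
  tree_sum (without w e) * (1 + w e * C) by ring.
by field; rewrite D0 gt_eqF.
Qed.

Lemma inclusion_forest w e u r : u != r -> val e = [set u; r]%SET ->
  0 < tree_sum w -> inclusion w e = w e * forest_sum u r w / tree_sum w.
Proof.
move=> ur E Z0; rewrite /inclusion.
have -> : tree_sum (without w e) = tree_sum w - w e * forest_sum u r w.
  by rewrite (tree_sum_split w ur E) addrK.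
by field; rewrite gt_eqF.
Qed.

Lemma sum_trees_with w e :
  \sum_(T : {set edge n} | `[< spanning_tree T >]) (e \in T)%:R * \prod_(f in T) w f =
  tree_sum w - tree_sum (without w e).
Proof.
rewrite /tree_sum -sumrB; apply: eq_bigr => T _.
have [eT|eT] := boolP (e \in T).
  by rewrite mul1r [X in _ - X](bigD1 e) //= /without eqxx mul0r subr0.
rewrite mul0r; apply/esym/eqP; rewrite subr_eq0; apply/eqP; apply: eq_bigr => f fT.
by rewrite /without; case: eqP => // fe; rewrite -fe fT in eT.
Qed.

Lemma sum_inclusion w (c : edge n -> R) : tree_sum w != 0 ->
  \sum_(T : {set edge n} | `[< spanning_tree T >])
     (\prod_(f in T) w f / tree_sum w) * (\sum_(e in T) c e) =
  \sum_e c e * inclusion w e.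
Proof.
move=> Z0.
transitivity (\sum_(T : {set edge n} | `[< spanning_tree T >])
  \sum_e c e / tree_sum w * ((e \in T)%:R * \prod_(f in T) w f)).
  apply: eq_bigr => T _; rewrite mulr_sumr big_mkcond /=; apply: eq_bigr => e _.
  by case: (e \in T); rewrite ?mul1r ?mul0r ?mulr0 //; ring.
rewrite exchange_big /=; apply: eq_bigr => e _.
rewrite -mulr_sumr sum_trees_with /inclusion; field.
by rewrite Z0.
Qed.

(** Foster's theorem: a spanning tree has n - 1 edges. *)
Lemma foster w : (0 < n)%N -> tree_sum w != 0 -> \sum_e inclusion w e = n.-1%:R.
Proof.
move=> n0 Z0; have := sum_inclusion (fun=> 1) Z0.
under [X in _ = X -> _]eq_bigr do rewrite mul1r.
move=> <-; under eq_bigr => T /asboolP /(card_spanning_tree n0) cT do rewrite sumr_const cT.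
by rewrite -mulr_suml -mulr_suml -/(tree_sum w) divff // mul1r.
Qed.

(** Rayleigh's principle after deletion of e. *)
Lemma resistance_antitone w w' e : (2 < n)%N -> (forall e, 0 < w e) ->
  (forall e, w e <= w' e) -> resistance w' e <= resistance w e.
Proof.
move=> n2 w0 ww; have w0' f : 0 < w' f := lt_le_trans (w0 f) (ww f).
have [u [r [ur E]]] := edge_ends e.
have Z0 := tree_sum_without_gt0 e n2 w0; have Z0' := tree_sum_without_gt0 e n2 w0'.
rewrite !(resistanceE ur E) ?gt_eqF // ler_pdivrMr // mulrAC ler_pdivlMr //.
rewrite -(forest_sum_without w E) -(forest_sum_without w' E).
apply: rayleigh => //; first exact: without_ge0.
by move=> f; rewrite /without; case: eqP.
Qed.

Section Symmetry.
Implicit Types s : {perm V}.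

Lemma edge_perm_proof s (e : edge n) : #|[set s x | x in val e]%SET| == 2.
Proof. by rewrite card_imset ?(eqP (valP e)) //; exact: perm_inj. Qed.

Definition edge_perm s (e : edge n) : edge n :=
  exist (fun e : {set 'I_n} => #|e| == 2) _ (edge_perm_proof s e).

Lemma edge_perm_inj s : injective (edge_perm s).
Proof.
move=> e f [] H; apply: val_inj => /=; exact: (imset_inj (@perm_inj _ s)).
Qed.

Lemma edge_permE s (e : edge n) x y : val e = [set x; y]%SET ->
  val (edge_perm s e) = [set s x; s y]%SET.
Proof. by move=> /= ->; rewrite imsetU1 imset_set1. Qed.

Lemma tree_sum_perm s w : (0 < n)%N -> tree_sum (fun e => w (edge_perm s e)) = tree_sum w.
Proof.
move=> n0; pose r : V := Ordinal n0.
rewrite (matrix_tree r) (matrix_tree (s r)).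
have pw x y : pair_weight (fun e => w (edge_perm s e)) x y = pair_weight w (s x) (s y).
  have [->|xy] := eqVneq x y; first by rewrite !pair_weightxx.
  have [e E _] := insub_edge xy.
  by rewrite (pair_weightE _ E) (pair_weightE w (edge_permE s E)).
set A := rooted_laplacian [set s r]%SET _.
have -> : rooted_laplacian [set r]%SET (pair_weight (fun e => w (edge_perm s e))) =
   row_perm s (col_perm s A).
  apply/matrixP => x y; rewrite !mxE !inE !(inj_eq perm_inj) pw.
  case: ifP => // _; congr (_ * _ - _).
  rewrite [RHS](reindex_inj (@perm_inj _ s)) /=; apply: eq_bigr => z _; exact: pw.
rewrite row_permE col_permE !det_mulmx !det_perm odd_permV mulrCA -expr2 -signr_odd.
by rewrite sqrr_sign mulr1.
Qed.

Lemma inclusion_perm s w e : (0 < n)%N ->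
  inclusion (fun f => w (edge_perm s f)) e = inclusion w (edge_perm s e).
Proof.
move=> n0; rewrite /inclusion tree_sum_perm // -(tree_sum_perm s (without w (edge_perm s e))) //.
congr (1 - _ / _); apply: eq_tree_sum => f.
by rewrite /without (inj_eq (@edge_perm_inj s)).
Qed.

Lemma edge_transitive (e f : edge n) : exists s, edge_perm s e = f.
Proof.
have [x [y [xy E]]] := edge_ends e; have [u [v [uv F]]] := edge_ends f.
pose y1 := tperm x u y.
exists (tperm x u * tperm y1 v)%g; apply: val_inj; rewrite (edge_permE _ E) F !permM.
have uy1 : u != y1 by rewrite /y1 -{1}(tpermL x u) (inj_eq perm_inj).
by rewrite tpermL -/y1 tpermL tpermD // eq_sym.
Qed.

(** Under a product law the edges are exchangeable, because permutations of the vertices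
    act transitively on them; so the total in [foster] is shared equally. *)
Lemma avg_inclusion (L : finType) (c : L -> R) e : (0 < #|L|)%N -> (1 < n)%N ->
  (forall l : L, 0 < c l) ->
  avg (fun a : {ffun edge n -> L} => inclusion (fun f => c (a f)) e) * #|{: edge n}|%:R
  = n.-1%:R.
Proof.
move=> L0 n1 c0; have n0 : (0 < n)%N := ltnW n1.
transitivity (\sum_f avg (fun a : {ffun edge n -> L} => inclusion (fun f => c (a f)) f)).
  rewrite mulr_natr -sumr_const; apply: eq_bigr => f _.
  have [s <-] := edge_transitive e f.
  have bij : bijective (edge_perm s) := injF_bij (@edge_perm_inj s).
  rewrite -(avg_relabel _ bij); apply: eq_avg => a.
  rewrite -inclusion_perm //; apply: eq_inclusion => h; by rewrite ffunE.
rewrite -avg_sum -[RHS](avg_cst _ (card_env_gt0 (edge n) L0)); apply: eq_avg => a.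
by rewrite foster // gt_eqF // tree_sum_gt0_all.
Qed.

End Symmetry.
End Inclusion.

Lemma card_edge n : (#|{: edge n}| * 2 = n * n.-1)%N.
Proof.
have -> : #|{: edge n}| = #|[set A : {set 'I_n} | #|A| == 2]%SET|.
  by rewrite card_sig; apply: eq_card => A; rewrite !inE.
by rewrite card_draws card_ord bin2 muln2 -{2}(odd_double_half (n * n.-1)) oddM; case: n => // n /=; rewrite andNb.
Qed.

(** * Low disorder: upper bound for the mean length, tails of resistances *)

Section ResistanceTail.
Variables (n : nat) (R : realFieldType).
Hypothesis n2 : (2 < n)%N.

(** Let C be the resistance of e, which is independent of a e. If C <= eps, the
    inclusion probability u C / (1 + u C) lies between u C / (1 + eps) and u C, so
    averaging over a e multiplies the length by the ratio of the means of l u and u, up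
    to 1 + eps; summing over the edges, [foster] appears. The edges with C > eps
    contribute at most 1 each. *)
Lemma avg_length_upper (L : finType) (l u : L -> R) (eps : R) :
  (0 < #|L|)%N -> (forall x, 0 <= l x <= 1) -> (forall x, 0 < u x <= 1) -> 0 < eps ->
  avg (fun a : {ffun edge n -> L} =>
    \sum_e l (a e) * inclusion (fun f => u (a f)) e) <=
  avg (fun x => l x * u x) / avg u * (1 + eps) * n.-1%:R +
  \sum_e avg (fun a : {ffun edge n -> L} =>
                (eps < resistance (fun f => u (a f)) e)%R%:R).
Proof.
move=> L0 l01 u01 eps0.
have u0 x : 0 < u x by case/andP: (u01 x).
have n0 : (0 < n)%N by apply: leq_trans n2.
have mu0 : 0 < avg u.
  have /card_gt0P[x0 _] := L0.
  rewrite divr_gt0 ?ltr0n // (bigD1 x0) //= ltr_pwDl // sumr_ge0 // => x _; exact: ltW.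
set kap := avg _ / avg u * (1 + eps).
have kap0 : 0 <= kap.
  rewrite mulr_ge0 ?addr_ge0 ?(ltW eps0) // divr_ge0 ?(ltW mu0) //.
  by apply: avg_ge0 => x; rewrite mulr_ge0 ?(ltW (u0 _)) //; case/andP: (l01 x).
have -> : kap * n.-1%:R =
    \sum_e kap * avg (fun a : {ffun edge n -> L} => inclusion (fun f => u (a f)) e).
  rewrite -mulr_sumr -avg_sum; congr (_ * _).
  rewrite -[LHS](avg_cst _ (card_env_gt0 (edge n) L0)); apply: eq_avg => a.
  by rewrite foster // gt_eqF // tree_sum_gt0_all.
rewrite avg_sum -big_split /=; apply: ler_sum => e _.
rewrite -avgZ -avgD -(avg_resample L0 e) -[X in _ <= X](avg_resample L0 e).
apply: le_avg => a; rewrite /resample.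
set C := resistance (fun f => u (a f)) e.
have C0 : 0 <= C by apply: resistance_ge0.
have CE x : resistance (fun f => u (upd a e x f)) e = C.
  by apply: eq_resistance => f fe; rewrite upd_neq.
have IE x : inclusion (fun f => u (upd a e x f)) e = u x * C / (1 + u x * C).
  by rewrite inclusion_resistance // CE updE.
have uC x : 0 <= u x * C by rewrite mulr_ge0 ?(ltW (u0 _)).
have D0 x : 0 < 1 + u x * C by rewrite ltr_pwDl.
under eq_avg do rewrite updE IE.
under [X in _ <= X]eq_avg do rewrite IE CE.
rewrite avgD avg_cst //; case: ltP => [Ceps|Ceps] /=.
  apply: ler_wpDl.
    by apply: avg_ge0 => x; rewrite mulr_ge0 // divr_ge0 ?(ltW (D0 _)).
  apply: avg_le_cst => // x; case/andP: (l01 x) => l0 l1.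
  by rewrite -[1%:R]mul1r ler_pM // ?divr_ge0 ?(ltW (D0 _)) // ler_pdivrMr // mul1r lerDr.
rewrite addr0 avgZ.
apply: le_trans (_ : C * avg (fun x => l x * u x) <= _).
  rewrite -avgZ; apply: le_avg => x; case/andP: (l01 x) => l0 l1.
  have -> : C * (l x * u x) = l x * (u x * C) by ring.
  rewrite ler_wpM2l //.
  by rewrite ler_pdivrMr // ler_peMr // lerDl.
apply: le_trans (_ : kap * (C / (1 + eps) * avg u) <= _).
  rewrite le_eqVlt; apply/orP; left; apply/eqP; rewrite /kap; field.
  by apply/andP; split; rewrite gt_eqF // ltr_pwDl // ltW.
rewrite ler_wpM2l // -avgZ; apply: le_avg => x; case/andP: (u01 x) => _ u1.
rewrite ler_pdivlMr //.
have e1 : 0 < 1 + eps by rewrite ltr_pwDl // ltW.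
have -> : C / (1 + eps) * u x * (1 + u x * C) = (u x * C) * ((1 + u x * C) / (1 + eps)).
  by field; rewrite gt_eqF.
rewrite ler_piMr // ler_pdivrMr // mul1r lerD2l.
by apply: le_trans Ceps; rewrite ler_piMl.
Qed.

Section Layers.
Variables (N s m c : nat) (d : R).
Hypotheses (N0 : (0 < N)%N) (s0 : (0 < s)%N) (m0 : (0 < m)%N).
Hypotheses (msN : (m * s <= N)%N) (Nns : (c * N <= n * s)%N) (c100 : c = 100%N).
Hypotheses (d0 : 0 < d) (d1 : d <= 4^-1).

Local Notation L := 'I_N.
Let cL : #|L| = N. Proof. by rewrite card_ord. Qed.
Let L0 : (0 < #|L|)%N. Proof. by rewrite cL. Qed.

Definition in_layer (k : nat) (x : L) : bool := (x %/ s == k)%N.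

(** A network using only the edges whose value lies in the k-th interval of length s.
    The small conductance d elsewhere keeps all weights positive, hence all the tree
    sums nonzero. *)
Definition layer (k : nat) (x : L) : R := if in_layer k x then 4^-1 else d.

Lemma layer_gt0 k x : 0 < layer k x.
Proof. by rewrite /layer; case: ifP => // _; rewrite invr_gt0. Qed.

Definition layer_resistance k e (a : {ffun edge n -> L}) : R :=
  resistance (fun f => layer k (a f)) e.

Lemma sum_in_layer k : (k < m)%N -> s%:R <= \sum_x (in_layer k x)%:R :> R.
Proof.
move=> km; have ksN : (k.+1 * s <= N)%N by apply: leq_trans msN; rewrite leq_mul2r km orbT.
rewrite -natr_sum ler_nat -(big_mkord xpredT (fun x => nat_of_bool (x %/ s == k)%N)).
rewrite (big_cat_nat _ (n := k * s)) //=; last by apply: leq_trans ksN; rewrite leq_mul2r leqnSn orbT.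
rewrite (big_cat_nat _ (m := k * s) (n := k.+1 * s)) //=; last by rewrite leq_mul2r leqnSn orbT.
have -> : (\sum_(k * s <= i < k.+1 * s) nat_of_bool (i %/ s == k) = s)%N.
  transitivity (\sum_(k * s <= i < k.+1 * s) 1)%N; last first.
    by rewrite sum_nat_const_nat muln1 mulSn addnK.
  rewrite big_nat_cond [RHS]big_nat_cond; apply: eq_bigr => i; rewrite andbT => /andP[h1 h2].
  suff -> : (i %/ s = k)%N by rewrite eqxx.
  by apply/eqP; rewrite eqn_leq -ltnS ltn_divLR // h2 leq_divRL.
by rewrite addnCA leq_addr.
Qed.

Lemma in_layer_inj i j x : in_layer i x -> in_layer j x -> i = j.
Proof. by move=> /eqP <- /eqP <-. Qed.

(** By symmetry e belongs to the tree of a layer with probability 2 / n. But if the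
    resistance of e in the layer is above 4, then e belongs to the tree with probability
    at least 1/2 as soon as a e falls in the layer, an independent event of probability
    at least 100 / n. *)
Lemma avg_bad_layer k e : (k < m)%N ->
  avg (fun a : {ffun edge n -> L} => (4 < layer_resistance k e a)%R%:R)
    <= (25 : R)^-1.
Proof.
move=> km.
have n0 : (0 < n)%N by apply: leq_trans n2.
pose I := avg (fun a : {ffun edge n -> L} => inclusion (fun f => layer k (a f)) e).
have IE : I = 2 / n%:R.
  have := avg_inclusion e L0 (ltnW n2) (layer_gt0 k); rewrite -/I => H.
  have cE : #|{: edge n}|%:R * 2 = n%:R * n.-1%:R :> R by rewrite -!natrM card_edge.
  have nn : n%:R != 0 :> R by rewrite pnatr_eq0 -lt0n.
  have nn1 : n.-1%:R != 0 :> R by rewrite pnatr_eq0 -lt0n -ltnS prednK // ltnW.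
  have nE : #|{: edge n}|%:R * 2 != 0 :> R by rewrite cE mulf_neq0.
  by apply: (mulIf nE); rewrite mulrA H cE; field.
set B := avg _.
have : s%:R / N%:R * B <= 2 * I.
  rewrite /B /I -!avgZ -(avg_resample L0 e) -[X in _ <= X](avg_resample L0 e).
  apply: le_avg => a; rewrite /resample /layer_resistance.
  set C := resistance (fun f => layer k (a f)) e.
  have C0 : 0 <= C by apply: resistance_ge0 => // f; exact: layer_gt0.
  have CE x : resistance (fun f => layer k (upd a e x f)) e = C.
    by apply: eq_resistance => f fe; rewrite upd_neq.
  have InE x : inclusion (fun f => layer k (upd a e x f)) e =
               layer k x * C / (1 + layer k x * C).
    by rewrite inclusion_resistance ?CE ?updE // => f; exact: layer_gt0.
  under eq_avg do rewrite CE.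
  under [X in _ <= X]eq_avg do rewrite InE.
  rewrite avg_cst //.
  have p0 : 0 < 1 + C / 4 by rewrite ltr_pwDl // divr_ge0.
  apply: le_trans (_ : s%:R / N%:R * (2 * ((C / 4) / (1 + C / 4))) <= _).
    rewrite ler_wpM2l ?divr_ge0 // ; case: ltP => C4 /=; last by rewrite mulr_ge0 // divr_ge0 ?(ltW p0) ?divr_ge0.
    rewrite mulrA ler_pdivlMr // mul1r; lra.
  apply: le_trans (_ : avg (fun x : L => (in_layer k x)%:R) * (2 * ((C / 4) / (1 + C / 4))) <= _).
    rewrite ler_wpM2r //.
      by rewrite mulr_ge0 // divr_ge0 ?(ltW p0) // divr_ge0.
    by rewrite /avg cL ler_wpM2r ?invr_ge0 // sum_in_layer.
  rewrite mulrC -avgZ; apply: le_avg => x; rewrite /layer; case: ifP => _ /=.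
    by rewrite mulr1 [4^-1 * C]mulrC.
  by rewrite mulr0 mulr_ge0 // divr_ge0 ?addr_ge0 ?mulr_ge0 // ltW.
have sN : 0 < s%:R / N%:R :> R by rewrite divr_gt0 ?ltr0n.
rewrite IE mulrC -ler_pdivlMr // => /le_trans; apply.
rewrite ler_pdivrMr //.
have : (c * N)%:R <= (n * s)%:R :> R by rewrite ler_nat.
rewrite !natrM c100 => H.
have nr : 0 < n%:R :> R by rewrite ltr0n.
have Nr : 0 < N%:R :> R by rewrite ltr0n.
rewrite mulrA ler_pdivrMr // -(ler_pM2r Nr).
have -> : 25^-1 * (s%:R / N%:R) * n%:R * N%:R = (n%:R * s%:R) / 25 :> R.
  by field; rewrite gt_eqF.
lra.
Qed.

Lemma le_layer k x y : (in_layer k y -> in_layer k x) -> layer k y <= layer k x.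
Proof.
rewrite /layer; case: (in_layer k y) => [/(_ isT) ->|_] //.
by case: ifP.
Qed.

Lemma layer_resistance_le k e a f x y : (in_layer k y -> in_layer k x) ->
  layer_resistance k e (upd a f x) <= layer_resistance k e (upd a f y).
Proof.
move=> xy; apply: (resistance_antitone e n2) => h; first exact: layer_gt0.
exact: (upd_le (c := layer k) a f h (le_layer xy)).
Qed.

(** The penalty 25 is the inverse of the bound in [avg_bad_layer], so that its mean is
    at most 2. *)
Lemma antitone_bad_layer k e :
  antitone_on (in_layer k) (fun a : {ffun edge n -> L} =>
    if 4 < layer_resistance k e a then 25 else 1 : R).
Proof.
move=> a f x y.
have E x' y' : in_layer k x' = in_layer k y' ->
    layer_resistance k e (upd a f x') = layer_resistance k e (upd a f y').
  move=> xy; apply/le_anti/andP; split; apply: layer_resistance_le; by rewrite xy.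
have M (P Q : R) : P <= Q -> (if 4 < P then 25 else 1 : R) <= (if 4 < Q then 25 else 1).
  move=> PQ; case: ifP => [P4|_]; first by rewrite (lt_le_trans P4 PQ).
  by case: ifP => // _; rewrite ler1n.
split=> Jx Jy.
- exact: (congr1 (fun r => if 4 < r then _ else _) (E x y (etrans Jx (esym Jy)))).
- exact: (congr1 (fun r => if 4 < r then _ else _)
           (E x y (etrans (negbTE Jx) (esym (negbTE Jy))))).
- exact: (M _ _ (layer_resistance_le e a f (fun _ => Jx))).
Qed.

(** If the resistance exceeds 8 / m, then by [parallel_layers] at least half of the
    layers are bad, and the product of the m penalties is at least 5 ^ m. By negative
    association its mean is at most 2 ^ m, and Markov's inequality concludes. *)
Lemma resistance_tail (u : L -> R) e : (forall x, 0 < u x) ->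
  (forall x, \sum_(k < m) layer k x <= u x) ->
  avg (fun a : {ffun edge n -> L} =>
     (8 / m%:R < resistance (fun f => u (a f)) e)%R%:R) <= (2 / 5 : R) ^+ m.
Proof.
move=> u0 lay.
pose bad k (a : {ffun edge n -> L}) := 4 < layer_resistance k e a.
pose g k (a : {ffun edge n -> L}) : R := if bad k a then 25 else 1.
have g0 k a : 0 <= g k a by rewrite /g; case: ifP.
have NA : avg (fun a => \prod_(k < m) g k a) <= \prod_(k < m) avg (g k).
  exact: (@negative_association_layers R _ _ L0 in_layer g m g0
            (fun k => antitone_bad_layer k e) in_layer_inj).
have g2 (k : 'I_m) : avg (g k) <= 2.
  have -> : avg (g k) = 1 + 24 * avg (fun a => (bad k a)%:R).
    rewrite -(avg_cst 1 (card_env_gt0 (edge n) L0)) -avgZ -avgD.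
    apply: eq_avg => a; rewrite /g avg_cst ?card_env_gt0 //; case: (bad k a) => /=; ring.
  have := avg_bad_layer e (ltn_ord k); rewrite -/(bad k _) => H.
  by lra.
have {}NA : avg (fun a => \prod_(k < m) g k a) <= 2 ^+ m.
  apply: le_trans NA _; rewrite -[m in 2 ^+ m]card_ord -prodr_const.
  by apply: ler_prod => k _; rewrite avg_ge0 ?g2.
have p5 : 0 < 5 ^+ m :> R by rewrite exprn_gt0.
rewrite expr_div_n ler_pdivlMr // mulrC -avgZ; apply: le_trans NA.
apply: le_avg => a; case: ltP => [res|_]; last by rewrite mulr0; apply: prodr_ge0.
rewrite mulr1.
pose G := [pred k : 'I_m | ~~ bad k a].
(* If half of the layers were good, the resistance would be at most 4 / (m / 2). *)
have cG : (#|G| * 2 < m)%N.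
  rewrite ltnNge; apply/negP => mG.
  have G0 : (0 < #|G|)%N by move: mG; case: #|G| => //; rewrite mul0n leqNgt m0.
  have [v [r [vr E]]] := edge_ends e.
  have Z0 := tree_sum_without_gt0 e n2 (fun f => u0 (a f)).
  have Zk k := tree_sum_without_gt0 e n2 (fun f => layer_gt0 k (a f)).
  move: res; rewrite (resistanceE vr E) ?gt_eqF // ltNge => /negP; apply.
  rewrite ler_pdivrMr // -(forest_sum_without _ E).
  have := @parallel_layers n R v r (without (fun f => u (a f)) e) _ G
     (fun (k : 'I_m) => without (fun f => layer k (a f)) e) 4 vr.
  rewrite ltr0n => /(_ isT Z0 (without_ge0 _ (fun f => u0 (a f)))) H.
  have {H} : forest_sum v r (without (fun f => u (a f)) e) * #|G|%:R <=
      4 * tree_sum (without (fun f => u (a f)) e).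
    apply: H => [k f _|f|k _|k Gk].
    - by apply: without_ge0 => h; exact: layer_gt0.
    - rewrite /without; case: eqP => _; first by rewrite big1.
      apply: le_trans (lay (a f)); rewrite [X in _ <= X](bigID G) /= lerDl.
      by apply: sumr_ge0 => k _; rewrite ltW ?layer_gt0.
    - exact: Zk.
    - have : ~~ bad k a by [].
      rewrite /bad -leNgt /layer_resistance (resistanceE vr E) ?gt_eqF ?Zk // ler_pdivrMr ?Zk //.
      by rewrite forest_sum_without.
  rewrite -ler_pdivlMr ?ltr0n // => /le_trans; apply.
  rewrite mulrAC ler_wpM2r ?(ltW Z0) // ler_pdivrMr ?ltr0n // mulrAC ler_pdivlMr ?ltr0n //.
  have : m%:R <= (#|G| * 2)%:R :> R by rewrite ler_nat.
  by rewrite natrM; lra.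
have -> : \prod_(k < m) g k a = 25 ^+ #|[pred k : 'I_m | bad k a]|.
  rewrite -prodr_const [RHS]big_mkcond; apply: eq_bigr => k _.
  by rewrite /g inE.
(* Since more than half of the layers are bad, 25 to their number is at least 5 ^ m. *)
have -> : 25 = 5 ^+ 2 :> R by ring.
rewrite -exprM ler_eXn2l ?ltr1n //.
have cm : (#|G| + #|[pred k : 'I_m | bad k a]| = m)%N.
  by rewrite addnC -[RHS](card_ord m) -(cardC [pred k : 'I_m | bad k a]).
lia.
Qed.

End Layers.
End ResistanceTail.

(** * Low disorder: lower bound for the mean length *)

Lemma sqr_avg_le (R : realFieldType) (T : finType) (g : T -> R) : (0 < #|T|)%N -> avg g ^+ 2 <= avg (fun x => g x ^+ 2).
Proof.
move=> T0; have : 0 <= avg (fun x => (g x - avg g) ^+ 2) by apply: avg_ge0 => x; exact: sqr_ge0.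
have -> : avg (fun x => (g x - avg g) ^+ 2) = avg (fun x => g x ^+ 2) - avg g ^+ 2.
  transitivity (avg (fun x => g x ^+ 2 - (2 * avg g) * g x + avg g ^+ 2)).
    by apply: eq_avg => x; ring.
  by rewrite avgD avgB avgZ avg_cst //; ring.
by rewrite subr_ge0.
Qed.

Section LengthLower.
Variables (n : nat) (R : realFieldType).
Hypothesis n0 : (0 < n)%N.
Let V := 'I_n.
Implicit Types (w : edge n -> R) (x y : V).

Lemma incident_image x :
  [set Some e | e : edge n & x \in val e]%SET =
  [set (insub [set x; y]%SET : option (edge n)) | y in ~: [set x]%SET]%SET.
Proof.
apply/finset.setP => o; apply/imsetP/imsetP => [[e]|[y]].
  rewrite inE => xe ->; have [p [q [pq E]]] := edge_ends e.
  have ex : exists2 y, y != x & val e = [set x; y]%SET.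
    move: xe; rewrite E !inE => /orP[] /eqP ->; [exists q|exists p] => //.
      by rewrite eq_sym.
    by rewrite finset.setUC.
  by case: ex => y yx E'; exists y; rewrite ?inE // -E' valK.
rewrite !inE eq_sym => xy ->; have [e E ->] := insub_edge xy.
by exists e => //; rewrite inE E finset.set21.
Qed.

Lemma incident_edge_inj x :
  {in ~: [set x]%SET &, injective (fun y => insub [set x; y]%SET : option (edge n))}.
Proof.
move=> y z; rewrite !inE => yx zx.
have [|e E ->] := @insub_edge _ x y; first by rewrite eq_sym.
have [|f F ->] := @insub_edge _ x z; first by rewrite eq_sym.
case=> ef; move: E; rewrite ef F => /eqP; rewrite eq_set2 eqxx /=.
case/orP => [/eqP //|/andP[/eqP E _]]; by rewrite E eqxx in yx.
Qed.

Lemma strengthE w x : strength w x = \sum_(e : edge n | x \in val e) w e.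
Proof.
pose h (o : option (edge n)) := if o is Some e then w e else 0.
transitivity (\sum_(o in [set Some e | e : edge n & x \in val e]%SET) h o).
  rewrite incident_image big_imset /=; last exact: incident_edge_inj.
  rewrite /strength (bigD1 x) //= pair_weightxx add0r.
  by apply: eq_bigl => y; rewrite !inE.
rewrite big_imset /=; last by move=> ? ? _ _ [].
by apply: eq_bigl => e; rewrite inE.
Qed.

Lemma card_incident x : #|[set e : edge n | x \in val e]%SET| = n.-1.
Proof.
rewrite -(card_imset _ (@Some_inj _)).
have -> : [set Some e | e in [set e : edge n | x \in val e]]%SET =
   [set Some e | e : edge n & x \in val e]%SET.
  by apply/finset.setP => o; apply/imsetP/imsetP => -[e]; rewrite ?inE => H ->; exists e; rewrite ?inE.
rewrite incident_image card_in_imset; last exact: incident_edge_inj.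
by rewrite cardsC1 card_ord.
Qed.

Lemma sum_incident (c : V -> R) (g : edge n -> R) :
  \sum_x c x * (\sum_(e : edge n | x \in val e) g e) = \sum_e g e * \sum_(x in val e) c x.
Proof.
under eq_bigr do rewrite mulr_sumr big_mkcond.
rewrite exchange_big /=; apply: eq_bigr => e _; rewrite mulr_sumr [RHS]big_mkcond /=.
by apply: eq_bigr => x _; case: ifP => // _; rewrite mulrC.
Qed.

Lemma sum_edge_ends (c : V -> R) (e : edge n) p r : p != r -> val e = [set p; r]%SET ->
  \sum_(x in val e) c x = c p + c r.
Proof. by move=> pr ->; rewrite big_setU1 ?inE // big_set1. Qed.

(** The lower bound 4 / D for the resistance, D being the strength at both ends plus 2,
    is replaced by its tangent at D = 2 M, which is affine in D. Sums over edges then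
    become sums of local quantities over vertices. *)
Lemma inclusion_lower w e (M : R) : (forall e, 0 < w e <= 1) -> 0 < M ->
  w e * (4 * M - \sum_(x in val e) strength w x - 2) <= M ^+ 2 * inclusion w e.
Proof.
move=> w01 M0; have w0 f : 0 < w f by case/andP: (w01 f).
have [p [r [pr E]]] := edge_ends e.
have Z0 := tree_sum_gt0_all n0 w0.
rewrite (sum_edge_ends _ pr E) (inclusion_forest pr E Z0).
have low := forest_sum_lower pr E (fun f => ltW (w0 f)) Z0.
have s0 x : 0 <= strength w x.
  by apply: sumr_ge0 => y _; apply: pair_weight_ge0 => f; exact: ltW.
set F := forest_sum p r w in low *; set Z := tree_sum w in Z0 low *.
have F0 : 0 <= F by apply: forest_sum_ge0 => f; exact: ltW.
set D := strength w p + strength w r + 2.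
have D0 : 0 < D by rewrite ltr_wpDl // addr_ge0.
have FD : 4 / D <= F / Z.
  rewrite ler_pdivrMr // mulrAC ler_pdivlMr //; apply: le_trans low _.
  rewrite ler_wpM2l // lerD2l ler_piMr //; by case/andP: (w01 e).
rewrite -[X in _ <= _ * X]mulrA mulrCA ler_wpM2l ?(ltW (w0 e)) //.
apply: le_trans (_ : M ^+ 2 * (4 / D) <= _); last by rewrite ler_wpM2l ?sqr_ge0.
have -> : 4 * M - (strength w p + strength w r) - 2 = 4 * M - D by rewrite /D; ring.
rewrite mulrA ler_pdivlMr // -subr_ge0.
have -> : M ^+ 2 * 4 - (4 * M - D) * D = (D - 2 * M) ^+ 2 by ring.
exact: sqr_ge0.
Qed.

Section Env.
Variables (L : finType) (l u : L -> R).
Hypotheses (L0 : (0 < #|L|)%N) (l0 : forall x : L, 0 <= l x)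
  (u01 : forall x : L, 0 < u x <= 1).
Let env := {ffun edge n -> L}.
Implicit Types a : env.

Lemma incident_mean (g : L -> R) (x : V) :
  avg (fun a : env => \sum_(e : edge n | x \in val e) g (a e)) = n.-1%:R * avg g.
Proof.
rewrite avg_sum; transitivity (\sum_(e in [set e : edge n | x \in val e]%SET) avg g).
  by apply: eq_big => [e|e _]; [rewrite inE | rewrite (avg_coord L0)].
by rewrite sumr_const card_incident mulr_natl.
Qed.

(** A vertex has n - 1 incident edges rather than n; the missing one costs the square of
    one mean. *)
Lemma incident_deviation (g : L -> R) (x : V) :
  avg (fun a : env => (\sum_(e : edge n | x \in val e) g (a e) - n%:R * avg g) ^+ 2) <=
  2 * n%:R * avg (fun y : L => g y ^+ 2).
Proof.
pose A := [set e : edge n | x \in val e]%SET.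
have nE : n%:R = n.-1%:R + 1 :> R by rewrite natr1 prednK.
apply: le_trans (_ : avg (fun a : env => 2 * (\sum_(e in A) (g (a e) - avg g)) ^+ 2 + 2 * avg g ^+ 2) <= _).
  apply: le_avg => a.
  have -> : \sum_(e : edge n | x \in val e) g (a e) - n%:R * avg g =
     \sum_(e in A) (g (a e) - avg g) - avg g.
    have -> : \sum_(e in A) (g (a e) - avg g) = \sum_(e : edge n | x \in val e) g (a e) - n.-1%:R * avg g.
      rewrite sumrB sumr_const (card_incident x) mulr_natl; congr (_ - _).
      by apply: eq_bigl => e; rewrite inE.
    by rewrite nE; ring.
  set p := \sum_(_ in _) _; set q := avg g; rewrite -subr_ge0.
  have -> : 2 * p ^+ 2 + 2 * q ^+ 2 - (p - q) ^+ 2 = (p + q) ^+ 2 by ring.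
  exact: sqr_ge0.
rewrite avgD avgZ avg_cst ?card_env_gt0 // nE.
have V1 := avg_variance L0 A g; have V2 := sqr_avg_le g L0.
rewrite (card_incident x) in V1.
have -> : 2 * (n.-1%:R + 1) * avg (fun y : L => g y ^+ 2) =
  2 * (n.-1%:R * avg (fun y : L => g y ^+ 2)) + 2 * avg (fun y : L => g y ^+ 2) by ring.
by rewrite lerD // ler_wpM2l.
Qed.

Let s (x : L) := l x * u x.
Let mu := avg u.
Let mu2 := avg s.
Hypotheses (mu0 : 0 < mu) (mu20 : 0 < mu2).
Let f0 := n%:R * mu2 / mu.
Let len a := \sum_e l (a e) * inclusion (fun f => u (a f)) e.

(** By [inclusion_lower] the length is at least a sum over the vertices x of S (2 M - W
    - 1) / M ^ 2, where S and W are the sums of l u and u over the edges at x. Their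
    relative deviations al and be from the means M2 and M have variance of order 1 / n;
    the linear and the product terms are split into squares, with eps as parameter. *)
Lemma avg_length_lower (eps : R) : 0 < eps ->
  avg (fun a => Num.max 0 (f0 - len a)) <=
  f0 * (eps / 2 + (2 * avg (fun y : L => s y ^+ 2) / (n%:R * mu2 ^+ 2)) / (2 * eps)
        + eps * (1 + 2 * avg (fun y : L => s y ^+ 2) / (n%:R * mu2 ^+ 2))
        + (2 * avg (fun y : L => u y ^+ 2) / (n%:R * mu ^+ 2)) / (2 * eps) + (n%:R * mu)^-1).
Proof.
move=> eps0.
have nr : 0 < n%:R :> R by rewrite ltr0n.
pose M := n%:R * mu; pose M2 := n%:R * mu2.
have M0 : 0 < M by rewrite mulr_gt0. have M20 : 0 < M2 by rewrite mulr_gt0.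
have nM : M != 0 by rewrite gt_eqF. have nM2 : M2 != 0 by rewrite gt_eqF.
have ne : eps != 0 by rewrite gt_eqF.
pose W a (x : V) := \sum_(e : edge n | x \in val e) u (a e).
pose S a (x : V) := \sum_(e : edge n | x \in val e) s (a e).
pose al a x := (S a x - M2) / M2. pose be a x := (W a x - M) / M.
pose K a x := eps / 2 + al a x ^+ 2 / (2 * eps) + eps * (1 + al a x ^+ 2) + be a x ^+ 2 / (2 * eps).
have S0 a x : 0 <= S a x by apply: sumr_ge0 => e _; rewrite mulr_ge0 //; case/andP: (u01 (a e)) => /ltW.
have eL := ltW eps0.
have q0 t : 0 <= t ^+ 2 / (2 * eps) by rewrite divr_ge0 ?sqr_ge0 // mulr_ge0.
have q1 t : 0 <= eps * t ^+ 2 by rewrite mulr_ge0 ?sqr_ge0.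
have K0 a x : 0 <= K a x.
  rewrite /K addr_ge0 //; apply: addr_ge0; last by rewrite mulrDr mulr1 addr_ge0.
  by rewrite addr_ge0 // divr_ge0.
have len_low a : \sum_x S a x * (2 * M - W a x - 1) <= M ^+ 2 * len a.
  have -> : \sum_x S a x * (2 * M - W a x - 1) =
     \sum_e s (a e) * (4 * M - \sum_(x in val e) W a x - 2).
    under eq_bigr do rewrite mulrC.
    rewrite sum_incident; apply: eq_bigr => e _; congr (_ * _).
    have [p [r [pr E]]] := edge_ends e.
    by rewrite !(sum_edge_ends _ pr E); ring.
  rewrite /len mulr_sumr; apply: ler_sum => e _; rewrite /s -mulrA [X in _ <= X]mulrCA.
  rewrite ler_wpM2l //.
  have := @inclusion_lower (fun f => u (a f)) e M (fun f => u01 (a f)) M0.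
  by under eq_bigr do rewrite strengthE.
have pt a : Num.max 0 (f0 - len a) <= (M ^+ 2)^-1 * \sum_x (M * M2 * K a x + S a x).
  rewrite ge_max; apply/andP; split.
    rewrite mulr_ge0 ?invr_ge0 ?sqr_ge0 // sumr_ge0 // => x _.
    by rewrite addr_ge0 // mulr_ge0 // mulr_ge0 // ltW.
  rewrite mulrC ler_pdivlMr ?exprn_gt0 // mulrC.
  have -> : M ^+ 2 * (f0 - len a) = \sum_(x < n) (M * M2) - M ^+ 2 * len a.
    rewrite sumr_const card_ord -[(_ * _) *+ n]mulr_natl mulrBr; congr (_ - _).
    by rewrite /f0 /M /M2; field; rewrite gt_eqF.
  apply: le_trans (_ : \sum_(x < n) (M * M2) - \sum_x S a x * (2 * M - W a x - 1) <= _).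
    by rewrite lerD2l lerN2.
  rewrite -sumrB; apply: ler_sum => x _.
  have -> : S a x = M2 * (1 + al a x) by rewrite /al; field.
  have -> : W a x = M * (1 + be a x) by rewrite /be; field.
  rewrite /K; set A := al a x; set B := be a x.
  rewrite -subr_ge0.
  have -> : M * M2 * (eps / 2 + A ^+ 2 / (2 * eps) + eps * (1 + A ^+ 2) + B ^+ 2 / (2 * eps)) +
    M2 * (1 + A) - (M * M2 - M2 * (1 + A) * (2 * M - M * (1 + B) - 1)) =
    M * M2 * ((A + eps) ^+ 2 / (2 * eps) + (eps * (1 + A) - B) ^+ 2 / (2 * eps) + eps * (1 - A) ^+ 2 / 2).
    by field.
  have MM : 0 <= M * M2 := ltW (mulr_gt0 M0 M20).
  apply: (mulr_ge0 MM); apply: addr_ge0; first by apply: addr_ge0; exact: q0.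
  exact: divr_ge0.
apply: le_trans (le_avg pt) _.
rewrite avgZ avg_sum.
set t1 := 2 * avg (fun y : L => s y ^+ 2) / (n%:R * mu2 ^+ 2).
set t2 := 2 * avg (fun y : L => u y ^+ 2) / (n%:R * mu ^+ 2).
have Eal x : avg (fun a => al a x ^+ 2) <= t1.
  have -> : avg (fun a => al a x ^+ 2) = (M2 ^+ 2)^-1 * avg (fun a => (S a x - M2) ^+ 2).
    by rewrite -avgZ; apply: eq_avg => a; rewrite /al; field.
  rewrite mulrC ler_pdivrMr ?exprn_gt0 //; apply: le_trans (incident_deviation s x) _.
  by rewrite le_eqVlt /t1 /M2; apply/orP; left; apply/eqP; field; rewrite !gt_eqF.
have Ebe x : avg (fun a => be a x ^+ 2) <= t2.
  have -> : avg (fun a => be a x ^+ 2) = (M ^+ 2)^-1 * avg (fun a => (W a x - M) ^+ 2).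
    by rewrite -avgZ; apply: eq_avg => a; rewrite /be; field.
  rewrite mulrC ler_pdivrMr ?exprn_gt0 //; apply: le_trans (incident_deviation u x) _.
  by rewrite le_eqVlt /t2 /M; apply/orP; left; apply/eqP; field; rewrite !gt_eqF.
have ES x : avg (fun a => S a x) <= M2.
  by rewrite incident_mean /M2 ler_wpM2r ?(ltW mu20) // ler_nat leq_pred.
apply: le_trans (_ : (M ^+ 2)^-1 * \sum_(x < n) (M * M2 * (eps / 2 + t1 / (2 * eps) + eps * (1 + t1) + t2 / (2 * eps)) + M2) <= _).
  rewrite ler_wpM2l ?invr_ge0 ?sqr_ge0 //; apply: ler_sum => x _.
  rewrite avgD lerD // avgZ ler_wpM2l //; first exact: ltW (mulr_gt0 M0 M20).
  have -> : avg (fun a => K a x) = eps / 2 + avg (fun a => al a x ^+ 2) / (2 * eps)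
      + eps * (1 + avg (fun a => al a x ^+ 2)) + avg (fun a => be a x ^+ 2) / (2 * eps).
    transitivity (avg (fun a => (eps / 2 + eps) + ((2 * eps)^-1 + eps) * al a x ^+ 2
        + (2 * eps)^-1 * be a x ^+ 2)).
      by apply: eq_avg => a; rewrite /K; field.
    by rewrite !avgD !avgZ !avg_cst ?card_env_gt0 //; field.
  have e2 : 0 <= (2 * eps)^-1 by rewrite invr_ge0 mulr_ge0 // ltW.
  by rewrite !lerD // ?ler_wpM2r // ler_wpM2l ?(ltW eps0) // lerD2l.
rewrite sumr_const card_ord -[_ *+ n]mulr_natl le_eqVlt; apply/orP; left; apply/eqP.
rewrite /f0 /M /M2; field.
by rewrite ne !gt_eqF.
Qed.

End Env.
End LengthLower.

(** Lets an upper bound for the mean of g and a bound for its negative part control g in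
    mean absolute value; the two bounds have unrelated proofs below. *)
Lemma avg_abs (R : realFieldType) (T : finType) (g : T -> R) :
  avg (fun a => `|g a|) = avg g + 2 * avg (fun a => Num.max 0 (- g a)).
Proof.
rewrite -avgZ -avgD; apply: eq_avg => a.
case: (lerP 0 (g a)) => g0; first by rewrite ger0_norm // max_l ?mulr0 ?addr0 // oppr_le0.
by rewrite ltr0_norm // max_r; [ring | rewrite oppr_ge0 ltW].
Qed.

(** * Reduction to environments on a finite grid *)

Section Continuity.
Variables (R : realType) (n : nat).
Hypothesis n0 : (0 < n)%N.
Implicit Types w : edge n -> R.

Lemma partition_function_gt0 b w : 0 < partition_function b w.
Proof. by apply: tree_sum_gt0_all => // e; exact: expR_gt0. Qed.

(** Linearity of expectation over the edges of the tree. *)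
Lemma mean_length_inclusion b w :
  mean_length b w = \sum_e w e * inclusion (fun f => expR (- b * w f)) e.
Proof.
have Z0 := partition_function_gt0 b w.
rewrite -(sum_inclusion (w := fun f => expR (- b * w f))) ?gt_eqF //.
rewrite /mean_length /quenched_expectation [RHS]big_mkcond; apply: eq_bigr => T _.
by rewrite /quenched_law; case: ifP => // _; rewrite mul0r.
Qed.

(** Raising each w e by at most h changes every tree weight, hence every tree
    probability, by a factor at most exp (b K h), where K is the number of edges. *)
Lemma mean_length_close b (h : R) w w' : 0 <= b -> 0 <= h ->
  (forall e, 0 <= w e <= 1) -> (forall e, 0 <= w' e <= 1) ->
  (forall e, w e <= w' e <= w e + h) ->
  `|mean_length b w - mean_length b w'| <=
  (expR (b * (#|{: edge n}|%:R * h)) - 1) * #|{: edge n}|%:R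
  + expR (b * (#|{: edge n}|%:R * h)) * (#|{: edge n}|%:R * h).
Proof.
move=> b0 h0 w01 w01' ww'.
set K := #|{: edge n}|%:R; set rho := expR _.
have K0 : 0 <= K by [].
have rho1 : 1 <= rho by rewrite /rho -expR0 ler_expR !mulr_ge0.
have rho0 : 0 < rho by exact: expR_gt0.
have wt T : tree_weight b w' T <= tree_weight b w T.
  apply: ler_prod => e _; rewrite expR_ge0 ler_expR !mulNr lerN2 ler_wpM2l //.
  by case/andP: (ww' e).
have wt' T : tree_weight b w T <= rho * tree_weight b w' T.
  rewrite /tree_weight -!expR_sum -expRD ler_expR -!mulr_sumr !mulNr lerNl opprD opprK.
  rewrite addrC lerBlDr -mulrDr ler_wpM2l //.
  apply: le_trans (_ : \sum_(e in T) (w e + h) <= _).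
    by apply: ler_sum => e _; case/andP: (ww' e).
  rewrite big_split /= lerD2l sumr_const -[h *+ _]mulr_natl ler_wpM2r // ler_nat.
  exact: max_card.
have LT T : tree_length w T <= tree_length w' T.
  by apply: ler_sum => e _; case/andP: (ww' e).
have LT' T : tree_length w' T <= tree_length w T + K * h.
  apply: le_trans (_ : \sum_(e in T) (w e + h) <= _).
    by apply: ler_sum => e _; case/andP: (ww' e).
  rewrite big_split /= lerD2l sumr_const -[h *+ _]mulr_natl ler_wpM2r // ler_nat.
  exact: max_card.
have LT0 T : 0 <= tree_length w T by apply: sumr_ge0 => e _; case/andP: (w01 e).
have Z0 := partition_function_gt0 b w; have Z0' := partition_function_gt0 b w'.
have ZZ : partition_function b w' <= partition_function b w by apply: ler_sum.
have ZZ' : partition_function b w <= rho * partition_function b w'.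
  by rewrite mulr_sumr; apply: ler_sum.
have wt0 (u : edge n -> R) T : 0 <= tree_weight b u T by apply: prodr_ge0 => e _; exact: expR_ge0.
have q0 (u : edge n -> R) T : 0 <= quenched_law b u T.
  rewrite /quenched_law; case: ifP => // _; rewrite divr_ge0 //.
  by rewrite ltW ?partition_function_gt0.
have q1 (u : edge n -> R) : \sum_T quenched_law b u T = 1.
  rewrite /quenched_law -big_mkcond /= -mulr_suml divff // gt_eqF //.
  exact: partition_function_gt0.
have qq T : quenched_law b w' T <= rho * quenched_law b w T.
  rewrite /quenched_law; case: ifP => _; last by rewrite mulr0.
  rewrite ler_pdivrMr // mulrA mulrAC ler_pdivlMr //.
  rewrite [rho * _]mulrC -[X in _ <= X]mulrA.
  by apply: ler_pM => //; exact: ltW.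
have qq' T : quenched_law b w T <= rho * quenched_law b w' T.
  rewrite /quenched_law; case: ifP => _; last by rewrite mulr0.
  rewrite ler_pdivrMr // mulrA mulrAC ler_pdivlMr //.
  by apply: ler_pM => //; exact: ltW.
have X0 (u : edge n -> R) : (forall e, 0 <= u e <= 1) -> 0 <= mean_length b u <= K.
  move=> u01; apply/andP; split.
    apply: sumr_ge0 => T _; rewrite mulr_ge0 //.
    by apply: sumr_ge0 => e _; case/andP: (u01 e).
  rewrite -[K]mul1r -(q1 u) mulr_suml; apply: ler_sum => T _; rewrite ler_wpM2l //.
  apply: le_trans (_ : \sum_(e in T) (1 : R) <= _).
    by apply: ler_sum => e _; case/andP: (u01 e).
  by rewrite sumr_const ler_nat max_card.
have /andP[X00 XK] := X0 w w01; have /andP[X00' XK'] := X0 w' w01'.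
have Xup : mean_length b w' <= rho * mean_length b w + rho * (K * h).
  have -> : rho * (K * h) = \sum_T quenched_law b w T * (rho * (K * h)).
    by rewrite -mulr_suml q1 mul1r.
  rewrite /mean_length /quenched_expectation mulr_sumr -big_split /=.
  apply: ler_sum => T _.
  have -> : rho * (quenched_law b w T * tree_length w T) + quenched_law b w T * (rho * (K * h))
    = (rho * quenched_law b w T) * (tree_length w T + K * h) by ring.
  by apply: ler_pM => //; exact: le_trans (LT0 T) (LT T).
have Xlow : mean_length b w <= rho * mean_length b w'.
  rewrite /mean_length /quenched_expectation mulr_sumr; apply: ler_sum => T _.
  by rewrite mulrA; apply: ler_pM.
rewrite ler_norml; apply/andP; split.
  rewrite lerNl opprB lerBlDr; apply: le_trans Xup _.
  have : (rho - 1) * mean_length b w <= (rho - 1) * K by rewrite ler_wpM2l // subr_ge0.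
  lra.
have H : (rho - 1) * mean_length b w' <= (rho - 1) * K by rewrite ler_wpM2l // subr_ge0.
have H2 : 0 <= rho * (K * h) by rewrite !mulr_ge0 // ltW.
lra.
Qed.

Lemma expR_sub1_le (x : R) : 0 <= x -> x <= 2^-1 -> expR x - 1 <= 2 * x.
Proof.
move=> x0 x2; have := expR_ge1Dx (- x); rewrite expRN => H.
have e0 := expR_gt0 x.
have : expR x * (1 - x) <= 1.
  by rewrite mulrC -ler_pdivlMr // div1r.
nra.
Qed.

End Continuity.

Section GridApproximation.
Context d (Om : measurableType d) (R : realType) (P : probability Om R) (n : nat)
  (omega : edge n -> {RV P >-> R}).
Hypothesis omega_iid : iid_uniform01 omega.
Hypothesis n0 : (0 < n)%N.

Definition grid N (a : {ffun edge n -> 'I_N}) : edge n -> R := fun e => (a e)%:R / N%:R.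

Lemma measurable_sum_cond (I : finType) (Q : pred I) (h : I -> Om -> R) :
  (forall i, Q i -> measurable_fun [set: Om] (h i)) ->
  measurable_fun [set: Om] (fun t => \sum_(i | Q i) h i t).
Proof.
move=> mh.
have -> : (fun t => \sum_(i | Q i) h i t) = (fun t => \sum_i if Q i then h i t else 0).
  by apply/funext => t; rewrite big_mkcond.
apply: (@measurable_sum _ _ R setT _ (index_enum I) (fun i t => if Q i then h i t else 0)) => i.
by have [/mh|] := boolP (Q i).
Qed.

Lemma measurable_mean_length b :
  measurable_fun [set: Om] (fun t => mean_length b (fun e => omega e t)).
Proof.
have mw T : measurable_fun [set: Om] (fun t => tree_weight b (fun e => omega e t) T).
  rewrite /tree_weight.
  under eq_fun do rewrite -big_enum.
  apply: (@measurable_prod _ _ R setT _ (enum T) (fun e t => expR (- b * omega e t))) => e _.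
  apply: (measurableT_comp (@measurable_expR R)).
  by apply: measurable_funM.
have mZ : measurable_fun [set: Om] (fun t => partition_function b (fun e => omega e t)).
  by apply: measurable_sum_cond.
apply: (measurable_sum_cond (Q := xpredT)) => T _; apply: measurable_funM; last first.
  by apply: measurable_sum_cond.
rewrite /quenched_law; case: (`[< spanning_tree T >]) => //; apply: measurable_funM => //.
under eq_fun do rewrite -powR_inv1 ?(ltW (partition_function_gt0 n0 _ _)) //.
exact: (measurableT_comp (measurable_powR (-1)) mZ).
Qed.

Lemma uniform_prob_itv (x y : R) : 0 <= x -> x <= y -> y <= 1 ->
  uniform_prob (@ltr01 R) `[x, y[%classic = (y - x)%:E.
Proof.
move=> x0 xy y1; rewrite /uniform_prob.
rewrite (eq_integral (cst 1%E)) => [|z]; last first.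
  rewrite inE /= in_itv /= => /andP[xz zy]; rewrite /uniform_pdf.
  by rewrite (le_trans x0 xz) (le_trans (ltW zy) y1) subr0 invr1.
rewrite integral_cst //= mul1e lebesgue_measure_itv /= lte_fin.
by case: ltgtP xy => // -> _; rewrite subrr.
Qed.

Definition cell N (i : nat) : set R := `[i%:R / N%:R, i.+1%:R / N%:R[%classic.

Definition env_cell N (a : {ffun edge n -> 'I_N}) : set Om :=
  (\bigcap_(e in [set e | e \in [set: edge n]%SET]) (omega e @^-1` cell N (a e)))%classic.

Lemma measurable_env_cell N a : measurable (@env_cell N a).
Proof.
apply: fin_bigcap_measurable => // e _.
rewrite -[X in measurable X]setTI; apply: measurable_funP => //; exact: measurable_itv.
Qed.

(** Independence and uniformity make the cells equally likely. *)
Lemma prob_env_cell N (a : {ffun edge n -> 'I_N}) : (0 < N)%N ->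
  P (env_cell a) = (#|{ffun edge n -> 'I_N}|%:R^-1)%:E.
Proof.
move=> N0; have [ind unif] := omega_iid.
rewrite (ind _ (fun e => cell N (a e))) => [|e]; last exact: measurable_itv.
have Nr : 0 < N%:R :> R by rewrite ltr0n.
transitivity (\prod_(e in [set: edge n]%SET) (N%:R^-1)%:E : \bar R)%E.
  apply: eq_bigr => e _.
  have := unif e (cell N (a e)) (measurable_itv _); rewrite /distribution /= /pushforward => ->.
  rewrite uniform_prob_itv ?divr_ge0 //; last 2 first.
  - by rewrite ler_pM2r ?invr_gt0 // ler_nat.
  - by rewrite ler_pdivrMr // mul1r ler_nat ltn_ord.
  by congr (_%:E); rewrite -(@natr1 R (a e)); field; rewrite gt_eqF.
rewrite prodEFin prodr_const cardsT card_ffun card_ord natrX exprVn //.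
Qed.

(** Almost surely the environment lies in one of the cells of mesh 1 / N, and on a cell
    the mean length is close to its value at the lower corner. This replaces all
    probability on the environment by averages over a finite product. *)
Lemma grid_approx b c (delta : R) : 0 <= b -> 0 < delta ->
  exists N0, forall N, (N0 <= N)%N -> (0 < N)%N ->
   (\int[P]_t `|mean_length b (fun e => omega e t) - c|%:E <=
    (avg (fun a : {ffun edge n -> 'I_N} => `|mean_length b (grid a) - c|) + delta)%:E)%E.
Proof.
move=> b0 d0; set K := #|{: edge n}|%:R : R.
pose C := 2 * b * K * K + 2 * K.
exists (Num.truncn (2 * b * K + C / delta)).+1 => N N0N N0.
have K0 : 0 <= K by []. have C0 : 0 <= C by rewrite /C !(addr_ge0, mulr_ge0).
have Nr : 0 < N%:R :> R by rewrite ltr0n.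
have big : 2 * b * K + C / delta <= N%:R.
  have H : 0 <= 2 * b * K + C / delta by rewrite !(addr_ge0, mulr_ge0) // invr_ge0 ltW.
  have /andP[_ /ltW h2] := truncn_itv H.
  by apply: le_trans h2 _; rewrite ler_nat.
have close (w : edge n -> R) (a : {ffun edge n -> 'I_N}) :
    (forall e, cell N (a e) (w e)) -> `|mean_length b w - c| <= `|mean_length b (grid a) - c| + delta.
  move=> wa; rewrite -lerBlDl; apply: le_trans (lerB_dist _ _) _.
  rewrite opprB addrA subrK distrC.
  have H1 e : grid a e <= w e < (a e).+1%:R / N%:R by have := wa e; rewrite /cell /= in_itv.
  have H2 e : grid a e + N%:R^-1 = (a e).+1%:R / N%:R 
    by rewrite /grid -(@natr1 R (a e)) mulrDl mul1r.
  have H3 e : (a e).+1%:R / N%:R <= 1 :> R by rewrite ler_pdivrMr // mul1r ler_nat ltn_ord.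
  have H4 e : 0 <= grid a e by rewrite divr_ge0.
  have Ni : 0 <= N%:R^-1 :> R by rewrite invr_ge0.
  apply: le_trans (@mean_length_close R n n0 b N%:R^-1 (grid a) w b0 Ni _ _ _) _ => [e|e|e|].
  - case/andP: (H1 e) => g1 /ltW g2; by rewrite H4 (le_trans g1) // (le_trans g2).
  - case/andP: (H1 e) => g1 /ltW g2; by rewrite (le_trans (H4 e) g1) (le_trans g2).
  - case/andP: (H1 e) => g1 /ltW g2; by rewrite g1 H2.
  rewrite -/K; set x := b * (K * N%:R^-1).
  have CN : C / N%:R <= delta.
    rewrite ler_pdivrMr // mulrC -ler_pdivrMr //; apply: le_trans big.
    by rewrite lerDr !mulr_ge0.
  have x0 : 0 <= x by rewrite !mulr_ge0.
  have x2 : x <= 2^-1.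
    rewrite /x mulrA ler_pdivrMr // -ler_pdivrMl ?invr_gt0 // invrK.
    by apply: le_trans big; rewrite mulrA lerDl divr_ge0 // ltW.
  have ex := expR_sub1_le x0 x2.
  apply: le_trans CN; rewrite /C.
  have e2 : expR x <= 2 by lra.
  have -> : (2 * b * K * K + 2 * K) / N%:R = 2 * x * K + 2 * (K / N%:R) by rewrite /x; ring.
  by apply: lerD; [rewrite ler_wpM2r | rewrite ler_wpM2r ?mulr_ge0].
have mX : measurable_fun [set: Om] (fun t => `|mean_length b (fun e => omega e t) - c|).
  apply: measurableT_comp; first exact: normr_measurable.
  by apply: measurable_funB => //; exact: measurable_mean_length.
have m1 (r : R) (a : {ffun edge n -> 'I_N}) :
    measurable_fun [set: Om] (fun t => (r%:E * (\1_(env_cell a) t)%:E)%E).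
  have : measurable_fun [set: Om] (fun t => r * \1_(env_cell a) t).
    apply: measurable_funM => //; apply: measurable_indic; exact: measurable_env_cell.
  by move/measurable_EFinP.
pose v (a : {ffun edge n -> 'I_N}) : R := `|mean_length b (grid a) - c| + delta.
have v0 a : 0 <= v a by rewrite addr_ge0 // ltW.
apply: le_trans (_ : (\int[P]_t (\sum_a (v a)%:E * (\1_(env_cell a) t)%:E) <= _)%E).
  apply: ae_ge0_le_integral => //.
  - by have /measurable_EFinP := mX.
  - by move=> t _; apply: sume_ge0 => a _; rewrite mule_ge0 ?lee_fin.
  - exact: (@emeasurable_sum _ _ R setT _ (index_enum _)
              (fun a t => ((v a)%:E * (\1_(env_cell a) t)%:E)%E) (fun a => m1 (v a) a)).
  have H e : \forall t \ae P, `[0, 1[%classic (omega e t).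
    have [_ unif] := omega_iid.
    have mE : measurable (omega e @^-1` (`[0, 1[ : set R))%classic.
      by rewrite -[X in measurable X]setTI; apply: measurable_funP => //; exact: measurable_itv.
    exists (~` (omega e @^-1` `[0, 1[))%classic; split => //; first exact: measurableC.
    rewrite probability_setC //.
    have := unif e `[0, 1[%classic (measurable_itv _).
    rewrite /distribution /= /pushforward => ->.
    by rewrite uniform_prob_itv // subr0 subee.
  have := @filter_forall _ _ _ _ (ae_filter_ringOfSetsType P) H.
  apply: filterS => t tH _.
  have [a ta] : exists a : {ffun edge n -> 'I_N}, forall e, cell N (a e) (omega e t).
    have /fin_all_exists[f fP] : forall e, exists i : 'I_N, cell N i (omega e t).
      move=> e; have := tH e; rewrite /= in_itv /= => /andP[t0 t1].
      have x0 : 0 <= omega e t * N%:R by rewrite mulr_ge0.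
      have /andP[l1 l2] := truncn_itv x0.
      have lN : (Num.truncn (omega e t * N%:R) < N)%N.
        by rewrite -(ltr_nat R) (le_lt_trans l1) // gtr_pMl.
      exists (Ordinal lN); rewrite /cell /= in_itv /=.
      by rewrite ler_pdivrMr // ltr_pdivlMr // l1 l2.
    by exists [ffun e => f e] => e; rewrite ffunE.
  have ca : env_cell a t by move=> e _; exact: ta.
  apply: le_trans (_ : ((v a)%:E <= _)%E).
    by rewrite lee_fin; apply: close.
  rewrite (bigD1 a) //= indicE mem_set // mule1 leeDl //.
  by apply: sume_ge0 => a' _; rewrite mule_ge0 ?lee_fin.
rewrite ge0_integral_sum //; last first.
  by move=> a t _; rewrite mule_ge0 ?lee_fin.
rewrite (eq_bigr (fun a => (v a / #|{ffun edge n -> 'I_N}|%:R)%:E)); last first.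
  move=> a _; rewrite ge0_integralZl_EFin //; last first.
    by apply/measurable_EFinP; apply: measurable_indic; exact: measurable_env_cell.
  rewrite integral_indic ?setIT //; last exact: measurable_env_cell.
  rewrite EFinM; congr (_ * _)%E; exact: prob_env_cell.
rewrite sumEFin lee_fin -mulr_suml -/(avg v) avgD avg_cst //.
by rewrite card_ffun expn_gt0 card_ord N0.
Qed.

End GridApproximation.

(** * Low disorder on a grid *)

Lemma low_error_sum (R : realFieldType) (eps A A' B C D D' : R) :
  0 < eps -> A <= A' -> C <= A' -> B <= eps * 2 -> D <= D' ->
  eps / 2 + A + B + C + D <= 3 * eps + (A' + A') + D'.
Proof. by move=> *; lra. Qed.

Section LowGrid.
Variables (R : realType) (n : nat) (b : R).
Hypotheses (n2 : (2 < n)%N) (b0 : 0 < b).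

(** The constant is (2/3) ^ 3, a lower bound for exp (-1) obtained from 1 - 1/3 <= exp
    (-1/3). *)
Lemma expRN_ge (x : R) : x <= 1 -> 8 / 27 <= expR (- x).
Proof.
move=> x1; apply: le_trans (_ : expR (- 1) <= _); last by rewrite ler_expR lerN2.
have -> : - 1 = 3%:R * - (3^-1) :> R by field.
rewrite expRM_natl; have := expR_ge1Dx (- (3^-1) : R).
set y := expR _ => H; have y0 : 2 / 3 <= y by lra.
have -> : 8 / 27 = (2 / 3) ^+ 3 :> R by field.
by rewrite lerXn2r // nnegrE ?(le_trans _ y0).
Qed.

Lemma card_edge_le : (#|{: edge n}| <= n ^ 2)%N.
Proof.
have := card_edge n; have : (n * n.-1 <= n * n)%N by rewrite leq_mul2l leq_pred orbT.
by rewrite -mulnn; lia.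
Qed.

Section Grid.
Variables (k m : nat) (eps : R).
Hypotheses (k0 : (0 < k)%N) (m0 : (0 < m)%N) (mn : 100 * m%:R * (1 + b) <= n%:R).
Let N := (n * k)%N.
Let l (x : 'I_N) : R := x%:R / N%:R.
Let u (x : 'I_N) : R := expR (- b * l x).
Let s (x : 'I_N) : R := l x * u x.
Let mu := avg u.
Let mu2 := avg s.
Hypotheses (mu_ge : 1 / (2 * (1 + b)) <= mu) (mu2_ge : 1 / (8 * (1 + b) ^+ 2) <= mu2).
Hypothesis (eps0 : 0 < eps).

Let n0 : (0 < n)%N. Proof. exact: ltnW (ltnW n2). Qed.
Let N0 : (0 < N)%N. Proof. by rewrite muln_gt0 n0. Qed.
Let L0 : (0 < #|'I_N|)%N. Proof. by rewrite card_ord. Qed.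
Let Nr : 0 < N%:R :> R. Proof. by rewrite ltr0n. Qed.

Lemma grid_l01 x : 0 <= l x <= 1.
Proof. by rewrite divr_ge0 //= ler_pdivrMr // mul1r ler_nat ltnW. Qed.

Lemma grid_u01 x : 0 < u x <= 1.
Proof.
rewrite expR_gt0 -expR0 ler_expR mulNr oppr_le0 mulr_ge0 ?(ltW b0) //.
by case/andP: (grid_l01 x).
Qed.

(** The m layers lie among the values x with x (1 + b) <= 1, where the weight exp (- b
    x) is at least 8/27, which is more than 1/4 + 1/24; elsewhere the m copies of d add
    up to less than exp (- b). *)
Lemma grid_layers x : \sum_(i < m) layer (100 * k) (expR (- b) / (24 * m%:R)) i x <= u x.
Proof.
set d := _ / _.
have mr : 0 < m%:R :> R by rewrite ltr0n.
have b1 : 0 < 1 + b by rewrite addr_gt0.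
have d0 : 0 < d by rewrite divr_gt0 ?expR_gt0 ?mulr_gt0.
have eb : expR (- b) <= 1 by rewrite -expR0 ler_expR oppr_le0 ltW.
have md : m%:R * d = expR (- b) / 24 by rewrite /d; field; rewrite gt_eqF.
have [xm|xm] := ltnP x (m * (100 * k)).
  apply: le_trans (_ : 4^-1 + m%:R * d <= _); last first.
    apply: le_trans (_ : 8 / 27 <= _); first by rewrite md; lra.
    rewrite /u mulNr; apply: expRN_ge.
    have : l x <= (1 + b)^-1.
      rewrite /l ler_pdivrMr // mulrC ler_pdivlMr //.
      apply: le_trans (_ : (m * (100 * k))%:R * (1 + b) <= _).
        by rewrite ler_wpM2r ?(ltW b1) // ler_nat ltnW.
      rewrite /N !natrM.
      have -> : m%:R * (100%:R * k%:R) * (1 + b) = 100 * m%:R * (1 + b) * k%:R :> R by ring.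
      by rewrite ler_wpM2r.
    move=> lx; apply: le_trans (_ : b * (1 + b)^-1 <= _); first by rewrite ler_wpM2l // ltW.
    by rewrite ler_pdivrMr // mul1r lerDr.
  have x_in : (x %/ (100 * k) < m)%N by rewrite ltn_divLR // muln_gt0.
  rewrite (bigD1 (Ordinal x_in)) //= {1}/layer {1}/in_layer eqxx lerD2l.
  apply: le_trans (_ : \sum_(i < m) d <= _); last by rewrite sumr_const card_ord mulr_natl.
  rewrite [X in _ <= X](bigD1 (Ordinal x_in)) //= ler_wpDl ?(ltW d0) //.
  apply: ler_sum => i ix; rewrite /layer /in_layer; case: eqP => // xi.
  by case/eqP: ix; apply: val_inj.
apply: le_trans (_ : \sum_(i < m) d <= _).
  apply: ler_sum => i _; rewrite /layer /in_layer; case: eqP => // xi.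
  have := ltn_ord i; rewrite -xi ltn_divLR ?muln_gt0 ?k0 //.
  by rewrite ltnNge xm.
rewrite sumr_const card_ord -[d *+ m]mulr_natl md.
apply: le_trans (_ : expR (- b) <= _).
  by rewrite ler_pdivrMr // ler_peMr ?expR_ge0 // ler1n.
by rewrite ler_expR mulNr lerN2 ler_piMr ?(ltW b0) //; case/andP: (grid_l01 x).
Qed.

Let f0 := n%:R * mu2 / mu.

(** Upper bound with eps = 8 / m in [avg_length_upper], the exceptional edges being
    controlled by [resistance_tail], and lower bound by [avg_length_lower]; they are
    combined by [avg_abs]. *)
Lemma low_grid :
  avg (fun a : {ffun edge n -> 'I_N} => `|mean_length b (grid R a) - f0|) <=
  f0 * (8 / m%:R + 6 * eps + 2 / (eps * m%:R) + 2 / m%:R) + (n ^ 2)%:R * (2 / 5) ^+ m.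
Proof.
have mr : 0 < m%:R :> R by rewrite ltr0n.
have m1 : 1 <= m%:R :> R by rewrite ler1n.
have nr : 0 < n%:R :> R by rewrite ltr0n.
have b1 : 0 < 1 + b by rewrite addr_gt0.
have mu0 : 0 < mu by apply: lt_le_trans mu_ge; rewrite divr_gt0 ?mulr_gt0.
have mu20 : 0 < mu2 by apply: lt_le_trans mu2_ge; rewrite divr_gt0 ?mulr_gt0 ?exprn_gt0.
have nmu : 0 < n%:R * mu := mulr_gt0 nr mu0.
have nmu2 : 0 < n%:R * mu ^+ 2 := mulr_gt0 nr (exprn_gt0 2 mu0).
have nmu22 : 0 < n%:R * mu2 ^+ 2 := mulr_gt0 nr (exprn_gt0 2 mu20).
have f00 : 0 < f0 := divr_gt0 (mulr_gt0 nr mu20) mu0.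
have u0 x : 0 < u x by case/andP: (grid_u01 x).
have XE (a : {ffun edge n -> 'I_N}) : mean_length b (grid R a) = \sum_e l (a e) * inclusion (fun f => u (a f)) e.
  by rewrite mean_length_inclusion.
under eq_avg do rewrite XE.
rewrite avg_abs avgB avg_cst ?card_env_gt0 //.
have up : avg (fun a : {ffun edge n -> 'I_N} =>
    \sum_e l (a e) * inclusion (fun f => u (a f)) e) <=
    f0 * (1 + 8 / m%:R) + (n ^ 2)%:R * (2 / 5) ^+ m.
  have e8 : 0 < 8 / m%:R :> R by rewrite divr_gt0.
  apply: le_trans (avg_length_upper n2 L0 grid_l01 grid_u01 e8) _; apply: lerD.
    rewrite -/mu -/mu2 mulrAC ler_wpM2r ?addr_ge0 ?(ltW e8) //.
    rewrite /f0 [n%:R * mu2]mulrC -[X in _ <= X]mulrA [n%:R / mu]mulrC mulrA ler_wpM2l //.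
      exact: ltW (divr_gt0 mu20 mu0).
    by rewrite ler_nat leq_pred.
  apply: le_trans (_ : \sum_(e : edge n) (2 / 5 : R) ^+ m <= _).
    apply: ler_sum => e _.
    apply: (@resistance_tail n R n2 N (100 * k) m 100 (expR (- b) / (24 * m%:R))) => //.
    - by rewrite muln_gt0 k0.
    - rewrite -(ler_nat R) !natrM; apply: le_trans (_ : 100 * m%:R * (1 + b) * k%:R <= _).
        have -> : m%:R * (100%:R * k%:R) = 100 * m%:R * k%:R :> R by ring.
        by rewrite ler_wpM2r // ler_peMr // ?mulr_ge0 // lerDl ltW.
      by rewrite ler_wpM2r.
    - by rewrite /N mulnCA mulnA leqnn.
    - by rewrite divr_gt0 ?expR_gt0 ?mulr_gt0.
    - rewrite ler_pdivrMr ?mulr_gt0 //.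
      have : expR (- b) <= 1 by rewrite -expR0 ler_expR oppr_le0 ltW.
      lra.
    - exact: grid_layers.
  rewrite sumr_const -[_ *+ _]mulr_natl ler_wpM2r ?exprn_ge0 ?divr_ge0 //.
  by rewrite ler_nat card_edge_le.
(* All relative variances are of order (1 + b) / n, which is small compared with 1 /
   m. *)
have tau : (1 + b) / n%:R <= (100 * m%:R)^-1.
  by rewrite ler_pdivrMr // mulrC ler_pdivlMr ?mulr_gt0 // mulrC.
have inv_mu : (n%:R * mu)^-1 <= 2 * ((1 + b) / n%:R).
  rewrite invfM; have -> : 2 * ((1 + b) / n%:R) = n%:R^-1 * (2 * (1 + b)) by ring.
  have b2 : 0 < 2 * (1 + b) by rewrite mulr_gt0.
  rewrite ler_wpM2l ?invr_ge0 // -[X in _ <= X]invrK lef_pV2 ?posrE ?invr_gt0 //.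
  by rewrite -div1r.
have s_le x : s x <= 2 / (1 + b).
  rewrite ler_pdivlMr // mulrDr mulr1.
  have h1 : s x <= 1.
    rewrite /s -[1]mul1r; case/andP: (grid_l01 x) => l0 l1; case/andP: (grid_u01 x) => _ u1.
    by apply: ler_pM => //; exact: ltW.
  have h2 : s x * b <= 1.
    have := expR_ge1Dx (b * l x); rewrite /s /u mulNr expRN => H.
    have e0 := expR_gt0 (b * l x).
    rewrite mulrAC ler_pdivrMr // mul1r; apply: le_trans H.
    by rewrite mulrC lerDr.
  by rewrite -natr1 lerD.
have t1E : 2 * avg (fun x => s x ^+ 2) / (n%:R * mu2 ^+ 2) <= 32 * ((1 + b) / n%:R).
  have sq : avg (fun x => s x ^+ 2) <= 2 / (1 + b) * mu2.
    rewrite /mu2 -avgZ; apply: le_avg => x; rewrite expr2 ler_wpM2r //.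
    by rewrite mulr_ge0 ?(ltW (u0 _)) //; case/andP: (grid_l01 x).
  rewrite ler_pdivrMr //.
  apply: le_trans (_ : 2 * (2 / (1 + b) * mu2) <= _); first by rewrite ler_wpM2l.
  have t32 : 0 < 32 :> R by [].
  have H := ler_wpM2l (ltW (mulr_gt0 (mulr_gt0 t32 mu20) b1)) mu2_ge.
  have -> : 32 * ((1 + b) / n%:R) * (n%:R * mu2 ^+ 2) = 32 * mu2 * (1 + b) * mu2.
    by field; rewrite gt_eqF.
  apply: le_trans H.
  rewrite le_eqVlt; apply/orP; left; apply/eqP; field; by rewrite gt_eqF.
have t2E : 2 * avg (fun x => u x ^+ 2) / (n%:R * mu ^+ 2) <= 4 * ((1 + b) / n%:R).
  have sq : avg (fun x => u x ^+ 2) <= mu.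
    apply: le_avg => x; rewrite expr2 ler_piMl ?(ltW (u0 _)) //.
    by case/andP: (grid_u01 x).
  apply: le_trans (_ : 2 * (n%:R * mu)^-1 <= _).
    rewrite ler_pdivrMr //.
    have -> : 2 / (n%:R * mu) * (n%:R * mu ^+ 2) = 2 * mu by field; rewrite !gt_eqF.
    by rewrite ler_wpM2l.
  by lra.
have low := @avg_length_lower n R n0 'I_N l u L0 (fun x => proj1 (andP (grid_l01 x)))
   grid_u01 mu0 mu20 eps eps0.
rewrite -/s -/mu2 -/mu -/f0 in low.
set t1 := 2 * avg (fun x => s x ^+ 2) / (n%:R * mu2 ^+ 2) in t1E low.
set t2 := 2 * avg (fun x => u x ^+ 2) / (n%:R * mu ^+ 2) in t2E low.
set T := (1 + b) / n%:R in tau inv_mu t1E t2E.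
have tau' : T * 100 <= m%:R^-1.
  have -> : m%:R^-1 = (100 * m%:R)^-1 * 100 :> R by field; rewrite gt_eqF.
  by rewrite ler_pM2r.
have mi : m%:R^-1 <= 1 :> R by rewrite invf_le1.
have T0 : 0 <= T by rewrite divr_ge0 // ltW.
have {}low : avg (fun a : {ffun edge n -> 'I_N} => Num.max 0
    (- (\sum_e l (a e) * inclusion (fun f => u (a f)) e - f0))) <=
    f0 * (3 * eps + 1 / (eps * m%:R) + 1 / m%:R).
  under eq_avg do rewrite opprB.
  apply: le_trans low _; rewrite ler_wpM2l ?(ltW f00) //.
  have ie : 0 < (2 * eps)^-1 by rewrite invr_gt0 mulr_gt0.
  have a1 : t1 / (2 * eps) <= m%:R^-1 / (2 * eps) by rewrite ler_wpM2r ?(ltW ie) //; lra.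
  have a2 : t2 / (2 * eps) <= m%:R^-1 / (2 * eps) by rewrite ler_wpM2r ?(ltW ie) //; lra.
  have a3 : eps * (1 + t1) <= eps * 2 by rewrite ler_wpM2l ?(ltW eps0) //; lra.
  have -> : 1 / (eps * m%:R) = m%:R^-1 / (2 * eps) + m%:R^-1 / (2 * eps).
    by field; rewrite !gt_eqF.
  have a4 : (n%:R * mu)^-1 <= m%:R^-1 by lra.
  by rewrite div1r; apply: low_error_sum.
have -> : 2 / (eps * m%:R) = 2 * (1 / (eps * m%:R)) by rewrite mulrA mulr1.
have -> : 2 / m%:R = 2 * (1 / m%:R) :> R by rewrite mulrA mulr1.
move: up low; set A := avg _; set B := avg _; set Y := 1 / _; set Y' := 1 / _.
set Q := _ * _ ^+ m; set W := 8 / _.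
move=> up low; have : f0 * (W + 6 * eps + 2 * Y + 2 * Y') + Q =
   (f0 * (1 + W) + Q) - f0 + 2 * (f0 * (3 * eps + Y + Y')) by ring.
by move=> ->; lra.
Qed.

End Grid.
End LowGrid.

(** * Riemann sums and the Laplace moments of the uniform law *)

Section Riemann.
Local Open Scope classical_set_scope.
Variable R : realType.
Implicit Types (f df F : R -> R).

Lemma derive_continuous f df : (forall x : R, is_derive x (1 : R) f (df x)) ->
  forall a b : R, {within `[a, b], continuous f}.
Proof.
move=> fd a b; apply: continuous_subspaceT => x.
by apply: differentiable_continuous; apply/derivable1_diffP; have [] := fd x.
Qed.

Lemma lipschitz_of_derive f df C : (forall x : R, is_derive x (1 : R) f (df x)) ->
  (forall x, 0 <= x <= 1 -> `|df x| <= C) ->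
  forall x y, 0 <= x <= 1 -> 0 <= y <= 1 -> `|f x - f y| <= C * `|x - y|.
Proof.
move=> fd dC.
have H x y : 0 <= x <= 1 -> 0 <= y <= 1 -> x <= y -> `|f y - f x| <= C * `|y - x|.
  move=> /andP[x0 x1] /andP[y0 y1] xy.
  have [c cxy ->] := MVT_segment xy (fun z _ => fd z) (@derive_continuous f df fd x y).
  rewrite normrM ler_wpM2r // dC //; move: cxy; rewrite in_itv /= => /andP[xc cy].
  by rewrite (le_trans x0 xc) (le_trans cy y1).
move=> x y xI yI; have [xy|/ltW yx] := leP x y; last exact: H.
by rewrite distrC [X in C * X]distrC; exact: H.
Qed.

(** The mean value theorem on each cell, for F and then for f. *)
Lemma riemann_sum F f df C (xi : nat -> R) N : (0 < N)%N ->
  (forall x : R, is_derive x (1 : R) F (f x)) -> (forall x : R, is_derive x (1 : R) f (df x)) ->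
  (forall x, 0 <= x <= 1 -> `|df x| <= C) ->
  (forall j, (j < N)%N -> j%:R / N%:R <= xi j <= j.+1%:R / N%:R) ->
  `|(\sum_(j < N) f (xi j)) / N%:R - (F 1 - F 0)| <= C / N%:R.
Proof.
move=> N0 dF df' dC xiP; have Nr : 0 < N%:R :> R by rewrite ltr0n.
have C0 : 0 <= C.
  by apply: le_trans (dC 0 _); [exact: normr_ge0 | rewrite lexx ler01].
have -> : F 1 - F 0 = \sum_(j < N) (F (j.+1%:R / N%:R) - F (j%:R / N%:R)).
  rewrite -(big_mkord xpredT (fun j => F (j.+1%:R / N%:R) - F (j%:R / N%:R))).
  by rewrite telescope_sumr // mul0r divff // gt_eqF.
rewrite mulr_suml -sumrB; apply: le_trans (ler_norm_sum _ _ _) _.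
have -> : C / N%:R = \sum_(j < N) (C / N%:R) / N%:R.
  rewrite sumr_const card_ord -[RHS]mulr_natl; field; by rewrite gt_eqF.
apply: ler_sum => j _.
have jN : j%:R / N%:R <= j.+1%:R / N%:R :> R by rewrite ler_wpM2r ?invr_ge0 // ler_nat.
have dj : j.+1%:R / N%:R - j%:R / N%:R = N%:R^-1 :> R.
  by rewrite -mulrBl -natrB // subSnn mul1r.
have [c cj ->] := MVT_segment jN (fun z _ => dF z) (@derive_continuous F f dF _ _).
rewrite dj -mulrBl normrM [`|N%:R^-1|]ger0_norm ?invr_ge0 // ler_wpM2r ?invr_ge0 //.
move: cj; rewrite in_itv /= => /andP[c1 c2].
have /andP[x1 x2] := xiP j (ltn_ord j).
have j0 : 0 <= j%:R / N%:R :> R by rewrite divr_ge0.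
have j1 : j.+1%:R / N%:R <= 1 :> R by rewrite ler_pdivrMr // mul1r ler_nat.
apply: le_trans (lipschitz_of_derive df' dC _ _) _.
- by rewrite (le_trans j0 x1) (le_trans x2 j1).
- by rewrite (le_trans j0 c1) (le_trans c2 j1).
rewrite ler_wpM2l // -dj ler_norml; apply/andP; split; lra.
Qed.

Lemma cvg_of_rate (g : nat -> R) (a C : R) :
  (forall k, (0 < k)%N -> `|g k - a| <= C / k%:R) -> g k @[k --> \oo] --> a.
Proof.
move=> H; apply/cvgrPdist_le => e e0.
exists (Num.truncn (`|C| / e)).+1 => // k /= kN.
have k0 : (0 < k)%N by apply: leq_trans kN.
rewrite distrC; apply: le_trans (H k k0) _.
have kr : 0 < k%:R :> R by rewrite ltr0n.
rewrite ler_pdivrMr // mulrC -ler_pdivrMr //.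
have x0 : 0 <= `|C| / e by rewrite divr_ge0 // ltW.
have /andP[_ /ltW h] := truncn_itv x0.
apply: le_trans (_ : `|C| / e <= _); first by rewrite ler_wpM2r ?invr_ge0 ?(ltW e0) // ler_norm.
by apply: le_trans h _; rewrite ler_nat.
Qed.

End Riemann.

Section LaplaceMoments.
Local Open Scope classical_set_scope.
Variables (R : realType) (b : R).
Hypothesis b0 : 0 < b.

(** The integral of exp (- b x) over [0, 1]. *)
Definition laplace0 : R := (1 - expR (- b)) / b.
(** The integral of x exp (- b x) over [0, 1]. *)
Definition laplace1 : R := (1 - b * expR (- b) - expR (- b)) / b ^+ 2.

Lemma expRN_le1 (x : R) : 0 <= x <= 1 -> 0 <= expR (- b * x) <= 1.
Proof.
by move=> /andP[x0 _]; rewrite expR_ge0 -expR0 ler_expR mulNr oppr_le0 mulr_ge0 // ltW.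
Qed.

Lemma is_derive_expNb (x : R) : is_derive x 1 (fun y => expR (- b * y)) (- b * expR (- b * x)).
Proof.
have H : is_derive x 1 (fun y => - b * y) (- b).
  by apply: is_derive_eq; rewrite scaler1.
by apply: is_derive_eq; rewrite mulrC.
Qed.

Lemma cvg_laplace0 n : (0 < n)%N ->
  avg (fun x : 'I_(n * k) => expR (- b * (x%:R / (n * k)%:R))) @[k --> \oo] --> laplace0.
Proof.
move=> n0; apply: (@cvg_of_rate _ _ _ b) => k k0.
pose f (x : R) : R := expR (- b * x).
pose F (x : R) : R := - (b^-1) * expR (- b * x).
have dF (x : R) : is_derive x (1 : R) F (f x).
  have H := is_derive_expNb x.
  by apply: is_derive_eq; rewrite /f /GRing.scale /=; field; rewrite gt_eqF.
have dC x : 0 <= x <= 1 -> `|- b * expR (- b * x)| <= b.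
  move=> xI; have /andP[e0 e1] := expRN_le1 xI.
  by rewrite normrM normrN !ger0_norm ?(ltW b0) // ler_piMr // ltW.
have nk : (0 < n * k)%N by rewrite muln_gt0 n0.
have := @riemann_sum R F f (fun x => - b * expR (- b * x)) b (fun j => j%:R / (n * k)%:R)
   (n * k) nk dF is_derive_expNb dC.
rewrite /avg card_ord => H; apply: le_trans (_ : b / (n * k)%:R <= _).
  apply: le_trans (H _); last first.
    by move=> j _; rewrite lexx /= ler_wpM2r ?invr_ge0 // ler_nat.
  rewrite le_eqVlt; apply/orP; left; apply/eqP; congr `|_ - _|.
  by rewrite /F /laplace0 mulr1 mulr0 expR0; field; rewrite gt_eqF.
rewrite ler_wpM2l ?(ltW b0) // lef_pV2 ?posrE ?ltr0n // ler_nat.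
by rewrite leq_pmull.
Qed.

Lemma cvg_laplace1 n : (0 < n)%N ->
  avg (fun x : 'I_(n * k) => x%:R / (n * k)%:R * expR (- b * (x%:R / (n * k)%:R)))
    @[k --> \oo] --> laplace1.
Proof.
move=> n0; apply: (@cvg_of_rate _ _ _ (1 + b)) => k k0.
pose f (x : R) : R := x * expR (- b * x).
pose df (x : R) : R := expR (- b * x) - b * x * expR (- b * x).
pose F (x : R) : R := (- (b^-1)) * (x * expR (- b * x)) + (- (b^-2)) * expR (- b * x).
have nb : b != 0 by rewrite gt_eqF.
have ddf (x : R) : is_derive x (1 : R) f (df x).
  have H := is_derive_expNb x.
  by apply: is_derive_eq; rewrite /df /GRing.scale /=; ring.
have dF (x : R) : is_derive x (1 : R) F (f x).
  have H := is_derive_expNb x; have H' := ddf x.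
  rewrite /F -/f; apply: is_derive_eq; rewrite /f /df /GRing.scale /=; field.
  exact: nb.
have dC x : 0 <= x <= 1 -> `|df x| <= 1 + b.
  move=> xI; have /andP[e0 e1] := expRN_le1 xI; case/andP: xI => x0 x1.
  apply: le_trans (ler_normB _ _) _; apply: lerD; first by rewrite ger0_norm.
  rewrite ger0_norm ?mulr_ge0 // ?(ltW b0) //.
  rewrite -[X in _ <= X]mulr1 -mulrA ler_wpM2l ?(ltW b0) //.
  by rewrite -[1]mul1r ler_pM.
have nk : (0 < n * k)%N by rewrite muln_gt0 n0.
have := @riemann_sum R F f df (1 + b) (fun j => j%:R / (n * k)%:R) (n * k) nk dF ddf dC.
rewrite /avg card_ord => H; apply: le_trans (_ : (1 + b) / (n * k)%:R <= _).
  apply: le_trans (H _); last first.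
    by move=> j _; rewrite lexx /= ler_wpM2r ?invr_ge0 // ler_nat.
  rewrite le_eqVlt; apply/orP; left; apply/eqP; congr `|_ - _|.
  by rewrite /F /laplace1 !mulr1 !mulr0 mul0r expR0; field.
rewrite ler_wpM2l ?addr_ge0 ?(ltW b0) // lef_pV2 ?posrE ?ltr0n // ler_nat.
by rewrite leq_pmull.
Qed.

Lemma laplace0_ge : 1 / (1 + b) <= laplace0.
Proof.
have b1 : 0 < 1 + b by rewrite addr_gt0.
rewrite /laplace0 ler_pdivlMr // mulrC mulrA mulr1.
have := expR_ge1Dx b; rewrite expRN => H; have e0 := expR_gt0 b.
have : (expR b)^-1 <= (1 + b)^-1 by rewrite lef_pV2.
suff -> : b / (1 + b) = 1 - (1 + b)^-1 by rewrite lerD2l lerN2.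
by field; rewrite gt_eqF.
Qed.

Lemma laplace0_le : laplace0 <= 2 / (1 + b).
Proof.
have b1 : 0 < 1 + b by rewrite addr_gt0.
rewrite /laplace0 ler_pdivrMr // mulrAC ler_pdivlMr //.
have h1 : 1 - expR (- b) <= b by have := expR_ge1Dx (- b); lra.
have h2 : (1 - expR (- b)) * b <= b by rewrite ler_piMl ?(ltW b0) // lerBlDr lerDl expR_ge0.
lra.
Qed.

Lemma laplace1_ge : 1 / (4 * (1 + b) ^+ 2) <= laplace1.
Proof.
have b1 : 0 < 1 + b by rewrite addr_gt0.
have b2 : 0 < b ^+ 2 by rewrite exprn_gt0.
rewrite /laplace1 ler_pdivlMr //.
have e2 : 1 + b + b ^+ 2 / 4 <= expR b.
  have -> : b = 2%:R * (b / 2) by field.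
  rewrite expRM_natl; have := expR_ge1Dx (b / 2) => H.
  have h0 : 0 <= 1 + b / 2 by rewrite addr_ge0 // divr_ge0 // ltW.
  have : (1 + b / 2) ^+ 2 <= expR (b / 2) ^+ 2 by rewrite lerXn2r // nnegrE ?expR_ge0.
  apply: le_trans; rewrite le_eqVlt; apply/orP; left; apply/eqP; by field.
set E := 1 + b + b ^+ 2 / 4 in e2.
have E0 : 0 < E by rewrite /E; lra.
have iE : expR (- b) <= E^-1 by rewrite expRN lef_pV2 ?posrE ?expR_gt0.
apply: le_trans (_ : 1 - (1 + b) * E^-1 <= _); last first.
  have := ler_wpM2l (ltW b1) iE; lra.
have -> : 1 - (1 + b) * E^-1 = (b ^+ 2 / 4) / E by rewrite /E; field; rewrite gt_eqF //; lra.
rewrite ler_pdivlMr //.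
have EE : E <= (1 + b) ^+ 2.
  rewrite -subr_ge0; have -> : (1 + b) ^+ 2 - E = b + 3 / 4 * b ^+ 2 by rewrite /E; field.
  by rewrite addr_ge0 ?(ltW b0) // mulr_ge0 // ltW.
have -> : 1 / (4 * (1 + b) ^+ 2) * b ^+ 2 * E = (b ^+ 2 / 4) * (E / (1 + b) ^+ 2).
  by field; rewrite gt_eqF.
by rewrite ler_piMr ?divr_ge0 ?(ltW b2) // ler_pdivrMr ?exprn_gt0 // mul1r.
Qed.

Lemma laplace0_gt0 : 0 < laplace0.
Proof. by apply: lt_le_trans laplace0_ge; rewrite divr_gt0 // addr_gt0. Qed.

Lemma laplace1_gt0 : 0 < laplace1.
Proof.
by apply: lt_le_trans laplace1_ge; rewrite divr_gt0 // mulr_gt0 // exprn_gt0 // addr_gt0.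
Qed.

Lemma laplace_ratio n :
  n%:R / b * ((1 - b * expR (- b) - expR (- b)) / (1 - expR (- b))) =
  n%:R * laplace1 / laplace0.
Proof.
have e1 : 1 - expR (- b) != 0 by rewrite gt_eqF // subr_gt0 -expR0 ltr_expR oppr_lt0.
by rewrite /laplace1 /laplace0; field; rewrite e1 gt_eqF.
Qed.

End LaplaceMoments.

(** * From mean error to asymptotics; the low disorder regime *)

Section Assembly.
Local Open Scope classical_set_scope.
Variables (R : realType) (d : nat -> measure_display) (Om : forall n, measurableType (d n))
  (P : forall n, probability (Om n) R).

Lemma markov_L1 n (Y : Om n -> R) (c r : R) : measurable_fun [set: Om n] Y -> 0 < c ->
  (\int[P n]_t `|Y t|%:E <= r%:E)%E -> (P n [set t | (c <= `|Y t|)%R] <= (r / c)%:E)%E.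
Proof.
move=> mY c0 Yr.
have mN : measurable_fun [set: Om n] (fun t => `|Y t|).
  by apply: measurableT_comp; first exact: normr_measurable.
set A := [set t | _].
have mA : measurable A.
  have -> : A = [set: Om n] `&` (fun t => `|Y t|) @^-1` `[c, +oo[.
    by rewrite setTI; apply/seteqP; split => t /=; rewrite in_itv /= andbT.
  by apply: mN => //; exact: measurable_itv.
rewrite mulrC EFinM lee_pdivlMl //; apply: le_trans Yr.
have -> : (c%:E * P n A = \int[P n]_t (c%:E * (\1_A t)%:E))%E.
  rewrite ge0_integralZl_EFin ?(ltW c0) //; last 1 first.
    by apply/measurable_EFinP; apply: measurable_indic.
  by rewrite integral_indic // setIT.
apply: ge0_le_integral => //.
- by move=> t _; rewrite mule_ge0 ?lee_fin // ltW.
- apply: measurable_funeM; by apply/measurable_EFinP; apply: measurable_indic.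
- by move/measurable_EFinP: mN.
- move=> t _; rewrite -EFinM lee_fin indicE; have [/set_mem tA|_] := boolP (t \in A).
    by rewrite mulr1.
  by rewrite mulr0.
Qed.

Lemma expectation_L1 n (Y : Om n -> R) (c : R) : measurable_fun [set: Om n] Y ->
  (\int[P n]_t `|Y t|%:E < +oo)%E ->
  (`| 'E_(P n)[Y] - c%:E | <= \int[P n]_t `|Y t - c|%:E)%E.
Proof.
move=> mY Yf.
have iY : (P n).-integrable [set: Om n] (EFin \o Y).
  by apply/integrableP; split; [exact/measurable_EFinP|].
have ic : (P n).-integrable [set: Om n] (cst c%:E) by exact: finite_measure_integrable_cst.
have -> : ('E_(P n)[Y] - c%:E = \int[P n]_t (Y t - c)%:E)%E.
  under [RHS]eq_integral do rewrite EFinB.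
  rewrite (integralB _ iY ic) // unlock integral_cst //.
  by rewrite [X in (_ * X)%E]probability_setT mule1.
apply: le_abse_integral => //; apply/measurable_EFinP; exact: measurable_funB.
Qed.

(** The relative mean error serves as h for the expectation; by Markov's inequality its
    square root serves, up to 1 / n, for both functions in the other statement. As it
    only depends on n and b, no sequence beta is involved in their definition. *)
Lemma asymp_of_L1 (growth : (nat -> R) -> Prop) (dom : R -> Prop)
  (X : forall n, R -> Om n -> R) (f : nat -> R -> R) :
  (forall beta, growth beta -> forall n, dom (beta n)) ->
  (forall n b, (0 < n)%N -> measurable_fun [set: Om n] (X n b)) ->
  (forall n b c, (0 < n)%N -> dom b -> (\int[P n]_t `|X n b t - c|%:E < +oo)%E) ->
  (forall n b, (0 < n)%N -> dom b -> 0 < f n b) ->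
  (forall beta, growth beta -> forall e, 0 < e -> \forall n \near \oo,
     (\int[P n]_t `|X n (beta n) t - f n (beta n)|%:E <= (e * f n (beta n))%:E)%E) ->
  asymp_whp growth P X f /\ asymp_expectation growth P X f.
Proof.
move=> gd mX Xf f0 L1.
pose I b n := (\int[P n]_t `|X n b t - f n b|%:E)%E.
pose h b n : R := `|fine (I b n) / f n b|.
have I0 b n : (0 <= I b n)%E by apply: integral_ge0 => t _; rewrite lee_fin.
have IE b n : (0 < n)%N -> dom b -> I b n = (h b n * f n b)%:E.
  move=> n0 db; have fb := f0 n b n0 db.
  rewrite /h ger0_norm ?divr_ge0 ?fine_ge0 ?(ltW fb) // divfK ?gt_eqF // fineK //.
  by rewrite ge0_fin_numE //; exact: Xf.
have h0 b n : 0 <= h b n by exact: normr_ge0.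
have hv : vanishing growth h.
  split => // beta gb; apply/cvgrPdist_le => e e0.
  near=> n.
  have n0 : (0 < n)%N by near: n; exact: nbhs_infty_gt.
  have db := gd beta gb n; have fb := f0 n _ n0 db.
  rewrite sub0r normrN ger0_norm // -(ler_pM2r fb) -lee_fin -IE //.
  by near: n; exact: L1.
split; last first.
  exists h; split => // beta gb n n0; have db := gd beta gb n; rewrite -IE //.
  apply: expectation_L1; first exact: mX.
  have := Xf n (beta n) 0 n0 db; congr (_ < _)%E.
  by apply: eq_integral => t _; rewrite subr0.
(* The term 1 / n makes the threshold positive when the error vanishes. *)
exists (fun b n => Num.sqrt (h b n) + n%:R^-1), (fun b n => Num.sqrt (h b n)).
have sv : vanishing growth (fun b n => Num.sqrt (h b n)).
  split=> [b n|beta gb]; first exact: sqrtr_ge0.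
  apply/cvgrPdist_le => e e0; near=> n.
  rewrite sub0r normrN ger0_norm ?sqrtr_ge0 // -(ger0_norm (ltW e0)) -sqrtr_sqr.
  rewrite ler_wsqrtr //.
  have : `|0 - h (beta n) n| <= e ^+ 2.
    near: n; have [_ /(_ beta gb)] := hv; move/cvgrPdist_le; apply.
    by rewrite exprn_gt0.
  by rewrite sub0r normrN ger0_norm.
split=> //.
- split=> [b n|beta gb]; first by rewrite addr_ge0 ?sqrtr_ge0 ?invr_ge0.
  rewrite -[0 in X in _ --> X]addr0; apply: cvgD; first by have [_ /(_ beta gb)] := sv.
  apply: (@cvg_of_rate _ _ _ 1) => k k0.
  by rewrite subr0 ger0_norm ?invr_ge0 // div1r.
- move=> beta gb n n0; have db := gd beta gb n; have fb := f0 n _ n0 db.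
  set b := beta n in db fb *.
  have c0 : 0 < Num.sqrt (h b n) + n%:R^-1.
    by rewrite ltr_wpDl ?sqrtr_ge0 // invr_gt0 ltr0n.
  have mY : measurable_fun [set: Om n] (fun t => X n b t - f n b).
    by apply: measurable_funB => //; exact: mX.
  have : (I b n <= (h b n * f n b)%:E)%E by rewrite IE.
  move/(markov_L1 mY (mulr_gt0 c0 fb)) => /le_trans; apply; rewrite lee_fin.
  rewrite -mulf_div divff ?gt_eqF // mulr1 ler_pdivrMr // mulrDr.
  by rewrite -expr2 sqr_sqrtr // lerDl mulr_ge0 ?sqrtr_ge0 ?invr_ge0.
Unshelve. all: by end_near.
Qed.

End Assembly.

Section LowDisorder.
Local Open Scope classical_set_scope.
Variable R : realType.

(** The grid is refined with N = n k, which makes the layers have integral length 100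
    k. *)
Lemma low_L1 d (Om : measurableType d) (P : probability Om R) (n : nat)
    (omega : edge n -> {RV P >-> R}) (b eps f : R) (m : nat) :
  f = n%:R * laplace1 b / laplace0 b -> iid_uniform01 omega -> (2 < n)%N -> 0 < b -> (0 < m)%N ->
  100 * m%:R * (1 + b) <= n%:R -> 0 < eps ->
  (\int[P]_t `|mean_length b (fun e => omega e t) - f|%:E <=
   (f * (8 / m%:R + 6 * eps + 2 / (eps * m%:R) + 2 / m%:R) + (n ^ 2)%:R * (2 / 5) ^+ m)%:E)%E.
Proof.
move=> fE iid n2 b0 m0 mn eps0.
have n0 : (0 < n)%N by apply: leq_trans n2.
have b1 : 0 < 1 + b by rewrite addr_gt0.
set K := 8 / m%:R + _ + _ + _; set Q := _ * _ ^+ m.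
apply/lee_addgt0Pr => dl dl0.
pose mu k := avg (fun x : 'I_(n * k) => expR (- b * (x%:R / (n * k)%:R))).
pose mu2 k := avg (fun x : 'I_(n * k) =>
  x%:R / (n * k)%:R * expR (- b * (x%:R / (n * k)%:R))).
have cmu : mu k @[k --> \oo] --> laplace0 b by exact: cvg_laplace0.
have cmu2 : mu2 k @[k --> \oo] --> laplace1 b by exact: cvg_laplace1.
have l0 := laplace0_gt0 b0.
have l1 := laplace1_gt0 b0.
pose fk k := n%:R * mu2 k / mu k.
have cf : fk k @[k --> \oo] --> f.
  rewrite fE; apply: cvgM; first by apply: cvgM => //; exact: cvg_cst.
  by apply: cvgV => //; rewrite gt_eqF.
pose g k := fk k * K + Q + `|fk k - f|.
have cg : g k @[k --> \oo] --> f * K + Q.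
  rewrite -[X in _ --> X]addr0; apply: cvgD.
    apply: cvgD; last exact: cvg_cst.
    by apply: cvgM => //; exact: cvg_cst.
  rewrite -(normr0 R) -(subrr f); apply: cvg_norm; apply: cvgB => //; exact: cvg_cst.
have [N0 HN] := grid_approx iid n0 f (ltW b0) (divr_gt0 dl0 (ltr0Sn R 1)).
have [k] : exists k, [/\ (0 < k)%N, (N0 <= n * k)%N, 1 / (2 * (1 + b)) <= mu k,
    1 / (8 * (1 + b) ^+ 2) <= mu2 k & g k <= f * K + Q + dl / 2].
  have ev : \forall k \near \oo, [/\ (0 < k)%N, (N0 <= n * k)%N, 1 / (2 * (1 + b)) <= mu k,
    1 / (8 * (1 + b) ^+ 2) <= mu2 k & g k <= f * K + Q + dl / 2].
    near=> k; split.
    - by near: k; exact: nbhs_infty_gt.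
    - apply: (@leq_trans k); last by rewrite leq_pmull.
      by near: k; exact: nbhs_infty_ge.
    - near: k; apply: (cvgr_ge (laplace0 b)) => //.
      apply: lt_le_trans (laplace0_ge b0).
      rewrite !div1r ltf_pV2 ?posrE ?mulr_gt0 //; lra.
    - near: k; apply: (cvgr_ge (laplace1 b)) => //.
      apply: lt_le_trans (laplace1_ge b0).
      have sq : 0 < (1 + b) ^+ 2 by rewrite exprn_gt0.
      rewrite !div1r ltf_pV2 ?posrE ?mulr_gt0 //; lra.
    - near: k; apply: (cvgr_le (f * K + Q)) => //.
      by rewrite ltrDl divr_gt0.
  have [k0 _ /(_ k0 (leqnn _))] := ev; by exists k0.
case=> k0 kN muk mu2k gk.
have nk : (0 < n * k)%N by rewrite muln_gt0 n0.
apply: le_trans (HN _ kN nk) _; rewrite -EFinD lee_fin.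
have lg := low_grid n2 b0 k0 m0 mn muk mu2k eps0.
apply: le_trans (_ : g k + dl / 2 <= _); last by lra.
rewrite lerD2r /g -/K -/Q.
apply: le_trans (_ : avg (fun a : {ffun edge n -> 'I_(n * k)} =>
   `|mean_length b (grid R a) - fk k| + `|fk k - f|) <= _).
  by apply: le_avg => a; rewrite -[X in `|X|](subrKA (fk k)) ler_normD.
rewrite avgD avg_cst ?lerD2r //.
by rewrite card_ffun expn_gt0 card_ord nk.
Unshelve. all: by end_near.
Qed.

Lemma ln_ge1 n : (4 <= n)%N -> 1 <= ln n%:R :> R.
Proof.
move=> n4; apply: le_trans (_ : ln (expR 1) <= _); first by rewrite expRK.
have n0 : (0 < n)%N by apply: leq_trans n4.
rewrite ler_ln ?posrE ?expR_gt0 ?ltr0n //.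
have : 2^-1 <= expR (- 2^-1) :> R by have := expR_ge1Dx (- (2^-1) : R); lra.
rewrite expRN lef_pV2 ?posrE ?expR_gt0 // => h2.
apply: le_trans (_ : 4 <= _); last by rewrite ler_nat.
have -> : expR 1 = expR (2%:R * 2^-1) :> R by congr expR; field.
rewrite expRM_natl; have -> : 4 = 2 ^+ 2 :> R by ring.
by rewrite lerXn2r // nnegrE ?expR_ge0.
Qed.

Lemma ln_le_sqrt n : (0 < n)%N -> ln n%:R <= 2 * Num.sqrt n%:R :> R.
Proof.
move=> n0; have nr : 0 < n%:R :> R by rewrite ltr0n.
have s0 : 0 < Num.sqrt n%:R :> R by rewrite sqrtr_gt0.
rewrite -{1}(sqr_sqrtr (ltW nr)) lnXn // -[_ *+ 2]mulr_natl ler_wpM2l //.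
by rewrite ltW // ln_sublinear.
Qed.

Lemma near_ln_le (kap : R) : 0 < kap -> \forall n \near \oo, ln n%:R <= kap * n%:R :> R.
Proof.
move=> k0; near=> n.
have n0 : (0 < n)%N by near: n; exact: nbhs_infty_gt.
have nr : 0 < n%:R :> R by rewrite ltr0n.
have s0 : 0 < Num.sqrt n%:R :> R by rewrite sqrtr_gt0.
apply: le_trans (ln_le_sqrt n0) _.
rewrite -{2}(sqr_sqrtr (ltW nr)) expr2 mulrA ler_wpM2r ?(ltW s0) //.
rewrite mulrC -ler_pdivrMr //.
have -> : 2 / kap = Num.sqrt ((2 / kap) ^+ 2) :> R.
  by rewrite sqrtr_sqr ger0_norm // divr_ge0 // ltW.
rewrite ler_wsqrtr //.
have x0 : 0 <= (2 / kap) ^+ 2 by rewrite sqr_ge0.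
have /andP[_ /ltW h] := truncn_itv x0; apply: le_trans h _; rewrite ler_nat.
near: n; exact: nbhs_infty_ge.
Unshelve. all: by end_near.
Qed.

Lemma low_tail n m : (0 < n)%N -> 6 * ln n%:R <= m%:R :> R ->
  (n ^ 2)%:R * (2 / 5) ^+ m <= n%:R^-1 :> R.
Proof.
move=> n0 H; have nr : 0 < n%:R :> R by rewrite ltr0n.
have e25 : 2 / 5 <= expR (- (2^-1)) :> R.
  by have := expR_ge1Dx (- (2^-1) : R); lra.
have : (2 / 5) ^+ m <= (n%:R^-1) ^+ 3 :> R.
  apply: le_trans (_ : expR (- (2^-1)) ^+ m <= _).
    by rewrite lerXn2r // nnegrE ?expR_ge0 ?divr_ge0.
  rewrite -expRM_natl -[n%:R^-1]lnK ?posrE ?invr_gt0 // -expRM_natl ler_expR lnV ?posrE //.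
  lra.
move=> le; apply: le_trans (ler_wpM2l (ler0n _ _) le) _.
by rewrite natrX le_eqVlt; apply/orP; left; apply/eqP; field; rewrite gt_eqF.
Qed.

(** The number m of layers is of order n / (1 + beta). The growth condition says that
    beta ln n is small compared with n, so that m exceeds any multiple of ln n, as
    [low_tail] requires. *)
Lemma near_low (beta : nat -> R) (M : nat) : low_disorder beta ->
  \forall n \near \oo, exists m : nat, [/\ (M <= m)%N, (0 < m)%N,
    100 * m%:R * (1 + beta n) <= n%:R & 6 * ln n%:R <= m%:R :> R].
Proof.
move=> [bpos [_ lim]]; pose kap : R := (200 * (M%:R + 8))^-1.
have M8 : 0 < M%:R + 8 :> R by rewrite ltr_wpDl.
have kap0 : 0 < kap by rewrite invr_gt0 mulr_gt0.
near=> n.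
have n4 : (4 <= n)%N by near: n; exact: nbhs_infty_ge.
have nr : 0 < n%:R :> R by rewrite ltr0n (leq_trans _ n4).
have l1 := ln_ge1 n4; have l0 : 0 < ln n%:R :> R by apply: lt_le_trans l1.
have b1 : 0 < 1 + beta n by rewrite addr_gt0.
have bl : beta n * ln n%:R <= kap * n%:R.
  have : `|0 - beta n / (n%:R / ln n%:R)| <= kap.
    by near: n; move/cvgrPdist_le : lim; apply.
  rewrite sub0r normrN ger0_norm; last by rewrite divr_ge0 ?divr_ge0 // ltW.
  by rewrite ler_pdivrMr ?divr_gt0 // mulrA ler_pdivlMr.
have ln_small : ln n%:R <= kap * n%:R by near: n; exact: near_ln_le.
have key : 100 * (1 + beta n) * ((M%:R + 8) * ln n%:R) <= n%:R.
  have : (1 + beta n) * ln n%:R <= 2 * kap * n%:R by lra.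
  have c0 : 0 <= 100 * (M%:R + 8) :> R by rewrite mulr_ge0 // ltW.
  move=> /(ler_wpM2l c0).
  have -> : 100 * (M%:R + 8) * (2 * kap * n%:R) = n%:R by rewrite /kap; field; rewrite gt_eqF.
  by apply: le_trans; rewrite le_eqVlt; apply/orP; left; apply/eqP; ring.
pose y := n%:R / (100 * (1 + beta n)).
have h0 : 0 < 100 * (1 + beta n) by rewrite mulr_gt0.
have y0 : 0 <= y by rewrite divr_ge0 // ltW.
have /andP[t1 t2] := truncn_itv y0.
have yl : (M%:R + 8) * ln n%:R <= y by rewrite /y ler_pdivlMr // mulrC.
have Ml : M%:R <= M%:R * ln n%:R :> R by rewrite ler_peMr.
have big : M%:R + 6 * ln n%:R + 1 <= (Num.truncn y)%:R :> R.
  have : y < (Num.truncn y)%:R + 1 by rewrite natr1.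
  by move=> ty; move: yl; rewrite mulrDl => yl; lra.
exists (Num.truncn y); split.
- rewrite -(ler_nat R); lra.
- have M0 : 0 <= M%:R :> R by [].
  rewrite -(ltr0n R); lra.
- apply: le_trans (_ : 100 * (1 + beta n) * y <= _); last by rewrite /y mulrC divfK // gt_eqF.
  by rewrite mulrAC ler_wpM2l // ltW.
- have M0 : 0 <= M%:R :> R by [].
  lra.
Unshelve. all: by end_near.
Qed.

Theorem low_disorder_asymp (d : nat -> measure_display)
    (Om : forall n : nat, measurableType (d n))
    (P : forall n : nat, probability (Om n) R)
    (omega : forall n : nat, edge n -> {RV (P n) >-> R})
    (omega_iid : forall n : nat, iid_uniform01 (omega n)) :
  let X := fun (n : nat) (b : R) (t : Om n) => mean_length b (fun e => omega n e t) in
  let f := fun (n : nat) (b : R) =>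
    n%:R / b * ((1 - b * expR (- b) - expR (- b)) / (1 - expR (- b))) in
  asymp_whp (@low_disorder R) P X f /\ asymp_expectation (@low_disorder R) P X f.
Proof.
move=> X f; apply: (asymp_of_L1 (dom := fun b => 0 < b)).
- by move=> beta [].
- move=> n b n0; exact: measurable_mean_length.
- move=> n b c n0 b0.
  have [N0 H] := grid_approx (omega_iid n) n0 c (ltW b0) (@ltr01 R).
  exact: le_lt_trans (H N0.+1 (leqnSn _) isT) (ltry _).
- move=> n b n0 b0; rewrite /f laplace_ratio //.
  apply: divr_gt0 (laplace0_gt0 b0); apply: mulr_gt0 (laplace1_gt0 b0).
  by rewrite ltr0n.
- move=> beta low e e0; have bpos := low.1.
  pose eps := e / 24.
  have eps0 : 0 < eps by rewrite divr_gt0.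
  have e1 : 0 <= 40 / e + 8 / (e * eps) by rewrite addr_ge0 // divr_ge0 // ?mulr_ge0 // ltW.
  pose M := (Num.truncn (40 / e + 8 / (e * eps))).+1.
  near=> n.
  have n4 : (4 <= n)%N by near: n; exact: nbhs_infty_ge.
  have nr : 0 < n%:R :> R by rewrite ltr0n (leq_trans _ n4).
  have [m [Mm m0 mn ml]] : exists m : nat, [/\ (M <= m)%N, (0 < m)%N,
    100 * m%:R * (1 + beta n) <= n%:R & 6 * ln n%:R <= m%:R :> R].
    by near: n; exact: near_low.
  rewrite /f laplace_ratio //; set F := _ / laplace0 _.
  apply: le_trans (low_L1 erefl (omega_iid n) (ltnW n4) (bpos n) m0 mn eps0) _.
  rewrite -/F lee_fin.
  have mr : 0 < m%:R :> R by rewrite ltr0n.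
  have b1 : 0 < 1 + beta n by rewrite addr_gt0.
  have m1 : 1 <= m%:R :> R by rewrite ler1n.
  have F1 : 1 <= F.
    have h1 := laplace1_ge (bpos n); have h0 := laplace0_le (bpos n).
    have l0 := laplace0_gt0 (bpos n).
    rewrite /F ler_pdivlMr // mul1r; apply: le_trans h0 _.
    apply: le_trans (ler_wpM2l (ler0n R n) h1).
    rewrite mulrA mulr1 ler_pdivlMr ?mulr_gt0 ?exprn_gt0 //.
    have -> : 2 / (1 + beta n) * (4 * (1 + beta n) ^+ 2) = 8 * (1 + beta n).
      by field; rewrite gt_eqF.
    apply: le_trans mn; rewrite ler_wpM2r ?(ltW b1) //; lra.
  have Q1 : (n ^ 2)%:R * (2 / 5) ^+ m <= F * n%:R^-1.
    apply: le_trans (low_tail _ ml) _; first by rewrite (leq_trans _ n4).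
    by rewrite ler_peMl // invr_ge0.
  apply: le_trans (lerD (lexx _) Q1) _; rewrite -mulrDr mulrC ler_wpM2r ?(le_trans ler01) //.
  have bigm : 40 / e + 8 / (e * eps) <= m%:R.
    have /andP[_ /ltW h] := truncn_itv e1; apply: le_trans h _.
    by rewrite ler_nat.
  have in_ : n%:R^-1 <= e / 4.
    rewrite -[X in _ <= X]invrK lef_pV2 ?posrE ?invr_gt0 ?divr_gt0 // invfM invrK.
    near: n; exact: nbhs_infty_ger.
  have a1 : 40 / e <= m%:R.
    by apply: le_trans bigm; rewrite lerDl divr_ge0 // mulr_ge0 // ltW.
  have a2 : 8 / (e * eps) <= m%:R.
    by apply: le_trans bigm; rewrite lerDr divr_ge0 // ltW.
  have h1 : 1 / m%:R <= e / 40.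
    rewrite ler_pdivrMr // mulrAC ler_pdivlMr // mul1r mulrC.
    by rewrite ler_pdivrMr // mulrC in a1.
  have h2 : 2 / (eps * m%:R) <= e / 4.
    rewrite ler_pdivrMr ?mulr_gt0 // mulrAC ler_pdivlMr //.
    move: a2; rewrite ler_pdivrMr ?mulr_gt0 //; lra.
  have -> : 8 / m%:R = 8 * (1 / m%:R) :> R by rewrite mulrA mulr1.
  have -> : 2 / m%:R = 2 * (1 / m%:R) :> R by rewrite mulrA mulr1.
  have -> : 6 * eps = e / 4 by rewrite /eps; field.
  lra.
Unshelve. all: by end_near.
Qed.

End LowDisorder.

(** * Comparison with a minimal spanning tree; components of sublevel graphs *)

Section Gibbs.
Variables (R : realType) (n : nat).
Hypothesis n0 : (0 < n)%N.
Implicit Types (w : edge n -> R) (T : {set edge n}).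

Lemma count_trees : \sum_(T : {set edge n} | `[< spanning_tree T >]) (1 : R) <= (n ^ n)%:R.
Proof.
rewrite (sum_trees (Ordinal n0)) sumr_const ler_nat.
apply: leq_trans (max_card _) _; by rewrite card_ffun card_ord.
Qed.

(** Let y be b times the excess length of T over T0, so that q T * exp y <= 1. With exp
    A = n ^ n, the tangent inequality exp (y - A) >= 1 + y - A gives q T * y <= A * q T
    + exp (- A). Summing over the trees, of which there are at most exp A, bounds the
    mean of y by A + 1. *)
Lemma gibbs_upper b w T0 : 0 < b -> spanning_tree T0 ->
  mean_length b w <= tree_length w T0 + (1 + n%:R * ln n%:R) / b.
Proof.
move=> b0 st0; have Z0 := partition_function_gt0 n0 b w.
have nr : 0 < n%:R :> R by rewrite ltr0n.
set A := n%:R * ln n%:R.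
have eA : expR A = (n ^ n)%:R by rewrite /A expRM_natl lnK ?posrE // natrX.
pose q T := tree_weight b w T / partition_function b w.
have q0 T : 0 <= q T by rewrite divr_ge0 ?(ltW Z0) // prodr_ge0 // => e _; exact: expR_ge0.
have sq : \sum_(T : {set edge n} | `[< spanning_tree T >]) q T = 1.
  by rewrite -mulr_suml divff // gt_eqF.
have XE : mean_length b w =
    \sum_(T : {set edge n} | `[< spanning_tree T >]) q T * tree_length w T.
  rewrite /mean_length /quenched_expectation [RHS]big_mkcond; apply: eq_bigr => T _.
  by rewrite /quenched_law; case: ifP => // _; rewrite mul0r.
have wE T : tree_weight b w T = expR (- b * tree_length w T).
  by rewrite /tree_weight -expR_sum mulr_sumr.
have qle T : q T * expR (b * (tree_length w T - tree_length w T0)) <= 1.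
  rewrite /q wE mulrAC -expRD ler_pdivrMr // mul1r.
  have -> : - b * tree_length w T + b * (tree_length w T - tree_length w T0) =
    - b * tree_length w T0 by ring.
  rewrite -wE /partition_function (bigD1 T0) /=; last exact/asboolP.
  rewrite lerDl sumr_ge0 // => T' _; rewrite prodr_ge0 // => e _; exact: expR_ge0.
rewrite -lerBlDl ler_pdivlMr // -[tree_length w T0]mul1r -sq mulr_suml XE -sumrB mulr_suml.
apply: le_trans (_ : \sum_(T : {set edge n} | `[< spanning_tree T >])
    (A * q T + expR (- A)) <= _).
  apply: ler_sum => T _; set y := b * (tree_length w T - tree_length w T0).
  have -> : (q T * tree_length w T - q T * tree_length w T0) * b = q T * y by rewrite /y; ring.
  have := expR_ge1Dx (y - A); rewrite expRD => H.
  have qy := qle T; rewrite -/y in qy.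
  have h1 : q T * (y - A) <= q T * (expR y * expR (- A)) by rewrite ler_wpM2l //; lra.
  have h2 : q T * expR y * expR (- A) <= 1 * expR (- A) by rewrite ler_wpM2r ?expR_ge0.
  lra.
rewrite big_split /= -mulr_sumr sq mulr1 addrC lerD2r.
have -> : \sum_(T : {set edge n} | `[< spanning_tree T >]) expR (- A) =
    (\sum_(T : {set edge n} | `[< spanning_tree T >]) (1 : R)) * expR (- A).
  by rewrite mulr_suml; apply: eq_bigr => T _; rewrite mul1r.
rewrite expRN ler_pdivrMr ?expR_gt0 // mul1r eA; exact: count_trees.
Qed.

Lemma gibbs_lower b w c : (forall T, spanning_tree T -> c <= tree_length w T) ->
  c <= mean_length b w.
Proof.
move=> H; have Z0 := partition_function_gt0 n0 b w.
have Zn : partition_function b w != 0 by rewrite gt_eqF.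
rewrite -[c]mul1r -(divff Zn) {1}/partition_function !mulr_suml.
rewrite /mean_length /quenched_expectation [leLHS]big_mkcond; apply: ler_sum => T _.
rewrite /quenched_law; case: ifP => [/asboolP /H cT|_]; last by rewrite mul0r.
rewrite ler_wpM2l // divr_ge0 ?(ltW Z0) // prodr_ge0 // => e _; exact: expR_ge0.
Qed.

End Gibbs.

Section Components.
Variable n : nat.
Let V := 'I_n.
Implicit Types (G T : {set edge n}) (B S : {set V}) (p q : {ffun V -> V}) (x y v r : V).

Definition component G x : {set V} := [set y | connect (adj G) x y]%SET.
Definition components G : {set {set V}} := [set component G x | x : V]%SET.

Lemma mem_component G x y : (y \in component G x) = connect (adj G) x y.
Proof. by rewrite inE. Qed.

Lemma component_eq G x y : connect (adj G) x y -> component G x = component G y.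
Proof.
move=> c; apply/finset.setP => z; rewrite !inE; apply/idP/idP => H.
  by apply: connect_trans H; rewrite connect_adjC.
exact: connect_trans c H.
Qed.

Lemma component_of_mem G S x : S \in components G -> x \in S -> S = component G x.
Proof. by case/imsetP => y _ ->; rewrite mem_component; exact: component_eq. Qed.

Lemma sum_parent_edges (R : realFieldType) (g : edge n -> R) B p : parent_map B p ->
  \sum_(e in parent_edges B p) g e = \sum_(v | v \notin B) pair_weight g v (p v).
Proof.
move=> pm; pose h (o : option (edge n)) := if o is Some e then g e else 0.
transitivity (\sum_(o in [set Some e | e in parent_edges B p]%SET) h o).
  by rewrite big_imset //= => ? ? _ _ [].
rewrite parent_edges_image // big_imset /=; last exact: parent_edge_inj.
by apply: eq_bigl => v; rewrite inE.
Qed.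

(** The root, and the vertices cut off from their parent by the edges outside G: the
    pieces of the tree inside G are rooted there. *)
Definition cut_roots r p G : {set V} := [set v | (v == r) || ~~ adj G v (p v)]%SET.

Lemma card_cut_roots r p G : parent_map [set r]%SET p ->
  #|cut_roots r p G| = #|parent_edges [set r]%SET p :\: G|.+1.
Proof.
move=> pm.
have -> : cut_roots r p G = r |: [set v | (v != r) && ~~ adj G v (p v)]%SET.
  by apply/finset.setP => v; rewrite !inE; case: eqP.
rewrite cardsU1 !inE eqxx /= add1n; congr _.+1.
apply/eqP; rewrite -(eqr_nat rat) -!sum1_card !natr_sum; apply/eqP.
transitivity (\sum_(e in parent_edges [set r]%SET p) (e \notin G)%:R : rat); last first.
  rewrite [RHS](big_mkcond) [LHS]big_mkcond; apply: eq_bigr => e _.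
  by rewrite finset.in_setD andbC; case: (_ \in parent_edges _ _); case: (e \in G).
rewrite sum_parent_edges // big_mkcond [RHS]big_mkcond; apply: eq_bigr => v _.
rewrite !inE; case: (eqVneq v r) => //= vr.
have [|e E ie] := @insub_edge _ v (p v); first by rewrite eq_sym (parent_map_neq pm) ?inE.
by rewrite /pair_weight ie (adj_mem _ E); case: (e \in G).
Qed.

Lemma cut_roots_cover r p G v : parent_map [set r]%SET p ->
  exists2 b, b \in cut_roots r p G & connect (adj G) v b.
Proof.
move=> pm; move: v; apply: (parent_map_ind pm) => v.
  by rewrite inE => vr; exists v; rewrite // inE vr.
rewrite inE => vr [b bB c]; have [a|na] := boolP (adj G v (p v)).
  by exists b => //; apply: connect_trans c; exact: connect1.
by exists v; rewrite // inE na orbT.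
Qed.

(** Every component of G meets [cut_roots], since following parents inside G ends
    there. *)
Lemma components_le_tree r p G : parent_map [set r]%SET p ->
  (#|components G| <= #|parent_edges [set r]%SET p :\: G|.+1)%N.
Proof.
move=> pm; rewrite -(card_cut_roots G pm); apply: leq_trans (leq_imset_card (component G) _).
apply/subset_leq_card/fintype.subsetP => S /imsetP[x _ ->].
have [b bB c] := cut_roots_cover G x pm.
by apply/imsetP; exists b => //; exact: component_eq.
Qed.

Lemma parent_edges_root B q b y : parent_map B q -> b \in B -> y \in B ->
  connect (adj (parent_edges B q)) b y -> y = b.
Proof.
move=> pm bB yB c.
suff : fconnect q y b.
  move/iter_findex; elim: (findex q y b) => [|k IH] //.
  by rewrite iterSr (parent_map_fix pm yB).
have cl : fingraph.closed (adj (parent_edges B q)) [pred v | fconnect q v b].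
  have H v v' : adj (parent_edges B q) v v' -> fconnect q v b -> fconnect q v' b.
    rewrite adj_parent_edges // => /orP[/andP[vB /eqP <-]|/andP[_ /eqP <-]].
      move/iter_findex; case: (findex q v b) => [|k]; first by move=> /= E; rewrite E bB in vB.
      by rewrite iterSr => <-; exact: fconnect_iter.
    exact: connect_trans (fconnect1 _ _).
  move=> v v' a; apply/idP/idP; first exact: H a.
  by apply: H; rewrite adj_sym.
have := closed_connect cl c; rewrite !inE connect0 => <- //.
Qed.

Lemma cut_roots_separated r p G b y : parent_map [set r]%SET p ->
  b \in cut_roots r p G -> y \in cut_roots r p G ->
  connect (adj (parent_edges [set r]%SET p :&: G)) b y -> y = b.
Proof.
move=> pm bB yB c; pose B := cut_roots r p G.
pose q : {ffun V -> V} := [ffun v => if v \in B then v else p v].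
have pq : parent_map B q.
  apply: parent_mapP => [v vB|v]; first by rewrite ffunE vB.
  move: v; apply: (parent_map_ind pm) => v.
    by rewrite inE => vr; exists v; rewrite // inE vr.
  move=> _ [z zB cz]; have [vB|vB] := boolP (v \in B); first by exists v.
  exists z => //; apply: connect_trans cz; apply: connect1; by rewrite /= ffunE (negbTE vB).
apply: (parent_edges_root pq bB yB); apply: connect_sub c => v v' a; apply: connect1.
move: a; apply: adj_sub; apply/fintype.subsetP => e; rewrite inE => /andP[/parent_edgesP[x xr E] eG].
apply/parent_edgesP; have xB : x \notin B.
  by rewrite inE negb_or negbK (adj_mem _ E) eG andbT; rewrite inE in xr.
by exists x => //; rewrite ffunE (negbTE xB).
Qed.

(** If the edges of the tree inside G connect whatever G connects, the pieces of the
    tree are exactly the components. *)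
Lemma components_ge_tree r p G : parent_map [set r]%SET p ->
  (forall x y, connect (adj G) x y ->
     connect (adj (parent_edges [set r]%SET p :&: G)) x y) ->
  (#|parent_edges [set r]%SET p :\: G|.+1 <= #|components G|)%N.
Proof.
move=> pm H; rewrite -(card_cut_roots G pm).
rewrite -(card_in_imset (f := component G) (D := cut_roots r p G)).
  apply/subset_leq_card/fintype.subsetP => S /imsetP[x _ ->]; exact: imset_f.
move=> x y xB yB E; apply/esym; apply: (cut_roots_separated pm xB yB); apply: H.
by rewrite -mem_component E mem_component.
Qed.

Section Kruskal.
Variables (N : nat) (a : edge n -> 'I_N).

Definition sublevel (j : nat) : {set edge n} := [set e | (a e <= j)%N]%SET.

(** Minimal spanning trees are the minimal sets of this kind: they span the components
    of all the sublevel graphs at the same time. *)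
Definition preserving T : bool :=
  [forall j : 'I_N, forall x : V, forall y : V,
    connect (adj (sublevel j)) x y ==> connect (adj (T :&: sublevel j)) x y].

Lemma preservingP T : reflect
  (forall (j : 'I_N) x y, connect (adj (sublevel j)) x y -> connect (adj (T :&: sublevel j)) x y)
  (preserving T).
Proof.
apply: (iffP forallP) => [H j x y|H j].
  by have /forallP /(_ x) /forallP /(_ y) /implyP := H j.
by apply/forallP => x; apply/forallP => y; apply/implyP; exact: H.
Qed.

(** On a cycle, an edge f of largest label could be removed: at every level where f is
    present the rest of the cycle is present too, and still joins the ends of f. *)
Lemma minimal_preserving_acyclic T : minset preserving T -> acyclic_graph T.
Proof.
case/minsetP => /preservingP pT Tmin c sc /andP[cy uc].
pose A x y : nat := if insub [set x; y]%SET is Some e then a e else 0%N.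
have AE (e : edge n) x y : val e = [set x; y]%SET -> A x y = a e.
  by move=> E; rewrite /A -E valK.
have [v0 v0c] : exists v0, v0 \in c by case: c sc {cy uc} => // v0 c' _; exists v0; rewrite mem_head.
case: (arg_maxnP (fun x => A x (next c x)) v0c) => v vc vmax.
have [i c' E] := rot_to vc.
have nxt : path.cycle (frel (next c)) (v :: c') by rewrite -E rot_cycle cycle_next.
have /andP[cy' uc'] : path.cycle (adj T) (v :: c') && uniq (v :: c').
  by rewrite -E rot_cycle cy rot_uniq.
have sc' : (1 < size c')%N by rewrite -ltnS -[(size c').+1]/(size (v :: c')) -E size_rot.
have sub x : x \in v :: c' -> x \in c by rewrite -E mem_rot.
case: c' E nxt cy' uc' sc' sub => [|y [|z s]] // E.
rewrite /= !rcons_path => /and4P[/eqP nv /eqP ny nzs /eqP nl] /and4P[avy ayz azs alv].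
move=> /and4P[vys yzs zs us] _ sub.
case/existsP: (avy) => f /andP[fT /eqP fE].
pose T' := T :\ f.
have af : A v (next c v) = a f by rewrite nv; exact: AE.
have stay x x' : x \in c -> next c x = x' -> adj T x x' -> [set x; x']%SET != [set v; y]%SET ->
    adj (T' :&: sublevel (a f)) x x'.
  move=> xc nx /existsP[e /andP[eT /eqP eE]] ne; rewrite (adj_mem _ eE) !inE eT.
  rewrite andbT; apply/andP; split.
    by apply: contra ne => /eqP ef; rewrite -eE ef fE.
  by rewrite -(AE _ _ _ eE) -nx -af; exact: vmax.
have yv : connect (adj (T' :&: sublevel (a f))) y v.
  have c1 : connect (adj (T' :&: sublevel (a f))) y (last z s).
    apply/connectP; exists (z :: s) => //.
    have pz : path (fun x x' => (next c x == x') && adj T x x') y (z :: s).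
      rewrite /= ny eqxx ayz /=; elim: (s) (z) nzs azs => //= t s' IH z' /andP[-> h1] /andP[-> h2].
      exact: IH.
    apply: (@sub_in_path _ (mem (y :: z :: s)) (fun x x' => (next c x == x') && adj T x x') _ _ _ _ _ pz); last by apply/allP.
    move=> x x' xin x'in /andP[/eqP nx ax]; apply: stay => //.
      by apply: sub; rewrite inE xin orbT.
    rewrite eq_set2; apply/negP; case/orP => /andP[/eqP Ex /eqP Ex'].
      by move: vys; rewrite -Ex xin.
    by move: vys; rewrite -Ex' x'in.
  apply: connect_trans c1 _; apply: connect1; apply: stay => //.
    by apply: sub; rewrite 2!inE mem_last !orbT.
  rewrite eq_set2; apply/negP; case/orP => /andP[/eqP Ex /eqP Ex'].
    by move: vys; rewrite -Ex inE mem_last orbT.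
  by move: yzs; rewrite -Ex mem_last.
have : preserving T'.
  apply/preservingP => j x x' /pT; apply: connect_sub => u u' uu'.
  case/existsP: uu' => e /andP[]; rewrite inE => /andP[eT ej] /eqP eE.
  have [ef|ef] := eqVneq e f; last first.
    by apply: connect1; rewrite (adj_mem _ eE) !inE ef eT /=; rewrite inE in ej.
  (* The level j contains f, hence the whole cycle, whose labels are at most that of
     f. *)
  have subl : T' :&: sublevel (a f) \subset T' :&: sublevel j.
    apply: finset.setIS; apply/fintype.subsetP => h; rewrite !inE => hf.
    by apply: leq_trans hf _; move: ej; rewrite ef inE.
  have yvj : connect (adj (T' :&: sublevel j)) y v.
    by apply: connect_sub yv => s1 s2 h; apply: connect1; exact: adj_sub h.
  have : [set u; u']%SET == [set v; y]%SET by rewrite -eE ef fE.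
  rewrite eq_set2 => /orP[/andP[/eqP -> /eqP ->]|/andP[/eqP -> /eqP ->]] //.
  by rewrite connect_adjC.
move=> /Tmin /(_ (subsetDl _ _)) T'T.
by move: fT; rewrite -T'T !inE eqxx.
Qed.

(** A minimal spanning tree: at every level it has as few edges above the level as the
    number of components allows. *)
Lemma exists_kruskal_tree : (0 < n)%N -> exists2 T, spanning_tree T &
  forall j : 'I_N, (#|T :\: sublevel j|.+1 <= #|components (sublevel j)|)%N.
Proof.
move=> n0.
have pre : preserving [set: edge n]%SET by apply/preservingP => j x y; rewrite finset.setTI.
have [T Tmin _] := minset_exists pre.
have /preservingP pT : preserving T by case/minsetP: Tmin.
have st : spanning_tree T.
  split; last exact: minimal_preserving_acyclic.
  move=> x y; have [->|xy] := eqVneq x y; first exact: connect0.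
  have [e E _] := insub_edge xy.
  have Ng : (N.-1 < N)%N by rewrite prednK // (leq_ltn_trans _ (ltn_ord (a e))).
  have c1 : connect (adj (sublevel (Ordinal Ng))) x y.
    apply: connect1; rewrite (adj_mem _ E) inE /=.
    by rewrite -ltnS prednK ?ltn_ord // (leq_ltn_trans _ (ltn_ord (a e))).
  apply: connect_sub (pT _ _ _ c1) => u u' h; apply: connect1.
  by move: h; apply: adj_sub; exact: finset.subsetIl.
exists T => // j; have [p pm TE] := tree_parent_edges (Ordinal n0) st.
rewrite TE; apply: components_ge_tree => // x y /pT; by rewrite TE.
Qed.

End Kruskal.
End Components.

(** * Cayley's formula and the law of small components *)

Section Determinant.
Variable R : comUnitRingType.

(** Sylvester's identity, from the two block triangular factorisations of the matrix
    with diagonal blocks 1 and off-diagonal blocks u and v. *)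
Lemma det_sub_rank1 m (u : 'cV[R]_m) (v : 'rV[R]_m) :
  \det (1%:M - u *m v) = 1 - (v *m u) 0 0.
Proof.
pose M : 'M[R]_(m + 1) := block_mx 1%:M u v 1%:M.
have L : M = block_mx 1%:M 0 v 1%:M *m block_mx 1%:M u 0 (1%:M - v *m u).
  by rewrite mulmx_block !(mul1mx, mul0mx, mulmx0, mulmx1) !addr0 [v *m u + _]addrC subrK.
have U : M = block_mx 1%:M u 0 1%:M *m block_mx (1%:M - u *m v) 0 v 1%:M.
  by rewrite mulmx_block !(mul1mx, mul0mx, mulmx0, mulmx1) subrK !add0r.
have := congr1 determinant L; rewrite {1}U !det_mulmx.
rewrite !det_lblock !det_ublock !det1 !mul1r !mulr1 => ->.
by rewrite [1%:M - _]mx11_scalar det_scalar1 !mxE eqxx.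
Qed.

End Determinant.

Section Patterns.
Variables (R : realFieldType) (F : finType) (N : nat).
Hypothesis N0 : (0 < N)%N.
Implicit Types (O C : {set F}) (a : {ffun F -> 'I_N}) (j : nat).

Definition pattern O C j a : bool :=
  [forall f, ((f \in O) ==> (a f <= j)%N) && ((f \in C) ==> (j < a f)%N)].

Lemma patternP O C j a : reflect
  ((forall f, f \in O -> (a f <= j)%N) /\ (forall f, f \in C -> (j < a f)%N)) (pattern O C j a).
Proof.
apply: (iffP forallP) => [H|[HO HC] f].
  by split=> f fi; have /andP[/implyP h1 /implyP h2] := H f; [exact: h1|exact: h2].
by apply/andP; split; apply/implyP; [exact: HO|exact: HC].
Qed.

Definition open_prob j : R := avg (fun x : 'I_N => (x <= j)%N%:R).

Lemma open_prob_ge0 j : 0 <= open_prob j.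
Proof. by apply: avg_ge0 => x; rewrite ler0n. Qed.

Lemma open_prob_le1 j : open_prob j <= 1.
Proof. by apply: avg_le_cst; rewrite ?card_ord // => x; rewrite lern1 leq_b1. Qed.

Lemma open_probE j : (j < N)%N -> open_prob j = j.+1%:R / N%:R.
Proof.
move=> jN; rewrite /open_prob /avg card_ord; congr (_ / _).
rewrite -natr_sum; congr _%:R.
rewrite -(big_mkord xpredT (fun i => nat_of_bool (i <= j)%N)) (big_cat_nat (n := j.+1)) //=.
rewrite [X in (X + _)%N](eq_big_nat _ _ (F2 := fun=> 1%N)); last by move=> i /andP[_]; rewrite ltnS => ->.
rewrite [X in (_ + X)%N]big_nat [X in (_ + X)%N]big1 ?addn0 ?sum_nat_const_nat ?subn0 ?muln1 //.
by move=> i /andP[ji _]; rewrite leqNgt ji.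
Qed.

Lemma avg_pattern O C j : [disjoint O & C] ->
  avg (fun a => (pattern O C j a)%:R) = open_prob j ^+ #|O| * (1 - open_prob j) ^+ #|C| :> R.
Proof.
move=> dOC.
pose u f (x : 'I_N) : R := (if f \in O then (x <= j)%N%:R else 1) *
   (if f \in C then 1 - (x <= j)%N%:R else 1).
have E a : (pattern O C j a)%:R = \prod_f u f (a f) :> R.
  have [/patternP[HO HC]|] := boolP (pattern O C j a).
    rewrite big1 // => f _; rewrite /u.
    have hC : f \in C -> (a f <= j)%N = false by move/HC; rewrite ltnNge => /negbTE.
    case: ifP => [/HO h|_]; case: ifP => [/hC h'|_]; rewrite ?mul1r ?mulr1 //.
    - by rewrite h' in h.
    - by rewrite h.
    by rewrite h' subr0.
  rewrite negb_forall => /existsP[f]; rewrite negb_and !negb_imply => H.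
  rewrite (bigD1 f) //= [X in X * _](_ : _ = 0) ?mul0r // /u.
  case/orP: H => /andP[-> h]; first by rewrite (negbTE h) mul0r.
  by move: h; rewrite -leqNgt => ->; rewrite subrr mulr0.
rewrite (eq_avg E) avg_prod ?card_ord //.
have A f : avg (u f) = (if f \in O then open_prob j else 1) * (if f \in C then 1 - open_prob j else 1).
  have c1 : (0 < #|'I_N|)%N by rewrite card_ord.
  rewrite /u; case: (boolP (f \in O)) => fO.
    have -> : (f \in C) = false by apply/negbTE; rewrite (disjointFr dOC).
    by rewrite mulr1; apply: eq_avg => x; rewrite mulr1.
  case: ifP => _; rewrite mul1r.
    rewrite -[X in X - _](avg_cst 1 c1) -avgB; apply: eq_avg => x; by rewrite mul1r.
  by rewrite avg_cst.
under eq_bigr => f _ do rewrite A.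
by rewrite big_split /= -!big_mkcond !prodr_const.
Qed.

End Patterns.

Section InnerTrees.
Variable n : nat.
Hypothesis n0 : (0 < n)%N.
Let V := 'I_n.
Implicit Types (G T : {set edge n}) (B S : {set V}) (p q : {ffun V -> V}) (x y v r : V).

Definition pick_root S : V := odflt (Ordinal n0) [pick x in S].

Lemma pick_root_mem S : (0 < #|S|)%N -> pick_root S \in S.
Proof.
by rewrite card_gt0 /pick_root; case: pickP => //= H /set0Pn[x]; rewrite H.
Qed.

Definition off_root S : {set V} := (pick_root S |: ~: S)%SET.

(** Trees with vertex set S, oriented towards the root of S. The vertices outside S are
    additional roots, so that the theory of parent maps on the whole vertex set
    applies. *)
Definition inner_tree S p := parent_map (off_root S) p && [forall v in S, p v \in S].

Definition touching S : {set edge n} := [set e : edge n | val e :&: S != finset.set0]%SET.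
Definition boundary S : {set edge n} := [set e in touching S | ~~ (val e \subset S)]%SET.

Lemma notin_off_root S v : (v \notin off_root S) = (v != pick_root S) && (v \in S).
Proof. by rewrite !inE negb_or negbK. Qed.

Lemma inner_edge_sub S p (e : edge n) : inner_tree S p ->
  e \in parent_edges (off_root S) p -> val e \subset S.
Proof.
case/andP=> _ /forallP H /parent_edgesP[v]; rewrite notin_off_root => /andP[_ vS] ->.
by rewrite finset.subUset !finset.sub1set vS; exact: (implyP (H v)).
Qed.

Lemma card_inner_edges S p : (0 < #|S|)%N -> inner_tree S p ->
  #|parent_edges (off_root S) p| = #|S|.-1.
Proof.
move=> S0 /andP[pm _]; rewrite card_parent_edges // [in RHS](cardsD1 (pick_root S)) pick_root_mem //.
rewrite add1n /=; congr #|pred_of_set _|; apply/finset.setP => v.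
by rewrite finset.in_setC notin_off_root finset.in_setD1.
Qed.

Lemma mem_touching S (e : edge n) v : v \in val e -> v \in S -> e \in touching S.
Proof. by move=> ve vS; rewrite inE; apply/set0Pn; exists v; rewrite inE ve. Qed.

Lemma touchingP S (e : edge n) : reflect (exists2 v, v \in val e & v \in S) (e \in touching S).
Proof.
apply: (iffP idP) => [|[v]]; last exact: mem_touching.
by rewrite inE => /set0Pn[v]; rewrite inE => /andP[]; exists v.
Qed.

Lemma inner_edge_touching S p : inner_tree S p -> parent_edges (off_root S) p \subset touching S.
Proof.
move=> iT; apply/fintype.subsetP => e eT; have := inner_edge_sub iT eT.
have [x [y [xy E]]] := edge_ends e; move/fintype.subsetP => H.
by apply: (mem_touching (v := x)); rewrite ?H // E !inE eqxx.
Qed.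

Lemma inner_boundary_disjoint S p : inner_tree S p ->
  [disjoint parent_edges (off_root S) p & boundary S].
Proof.
move=> iT; rewrite disjoint_subset; apply/fintype.subsetP => e eT.
by rewrite !inE (inner_edge_sub iT eT) andbF.
Qed.

Lemma boundaryP S (e : edge n) : reflect
  (exists x y, [/\ x \in S, y \notin S & val e = [set x; y]%SET]) (e \in boundary S).
Proof.
apply: (iffP idP) => [|[x [y [xS yS E]]]]; last first.
  rewrite inE (mem_touching (v := x)) ?E ?inE ?eqxx //=.
  by apply/negP => /fintype.subsetP /(_ y); rewrite !inE eqxx orbT (negbTE yS) => /(_ isT).
rewrite inE => /andP[/touchingP[x xe xS]] /subsetPn[y ye yS]; exists x, y; split=> //.
have [x' [y' [xy E]]] := edge_ends e.
apply/eqP; rewrite eq_sym eqEcard finset.subUset !finset.sub1set xe ye (eqP (valP e)) cards2.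
by have -> : x != y by apply: contraNneq yS => <-.
Qed.

Lemma card_boundary S : #|boundary S| = (#|S| * (n - #|S|))%N.
Proof.
have -> : (n - #|S|)%N = #|~: S| by rewrite [#|~: S|]finset.cardsCs finset.setCK card_ord.
rewrite -cardsX -(card_imset (mem (boundary S)) val_inj).
rewrite -[RHS](card_in_imset (f := fun xy : V * V => [set xy.1; xy.2]%SET)); last first.
  move=> [x y] [x' y']; rewrite !inE /= => /andP[xS yS] /andP[xS' yS'] /eqP.
  rewrite eq_set2 => /orP[/andP[/eqP-> /eqP->]|/andP[/eqP xy _]] //.
  by rewrite -xy xS in yS'.
congr #|pred_of_set _|; apply/finset.setP => A; apply/imsetP/imsetP => [[e /boundaryP[x [y [xS yS E]]] ->]|].
  by exists (x, y); rewrite ?inE /= ?xS.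
case=> [[x y]]; rewrite !inE /= => /andP[xS yS] ->.
have xy : x != y by apply: contraNneq yS => <-.
have [e E _] := insub_edge xy; exists e => //; apply/boundaryP; by exists x, y.
Qed.

Lemma card_touching S : (#|touching S| <= #|S| * n)%N.
Proof.
pose g x y : option (edge n) := insub [set x; y]%SET.
have sub : [set Some e | e in touching S]%SET \subset
    [set g xy.1 xy.2 | xy in finset.setX S [set: V]%SET]%SET.
  apply/fintype.subsetP => o /imsetP[e /touchingP[v ve vS] ->].
  have [x [y [xy E]]] := edge_ends e.
  move: ve; rewrite E !inE => /orP[/eqP vx|/eqP vy].
    by apply/imsetP; exists (x, y); [rewrite !inE -vx vS|rewrite /g /= -E valK].
  by apply/imsetP; exists (y, x); [rewrite !inE -vy vS|rewrite /g /= finset.setUC -E valK].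
rewrite -(card_imset (mem (touching S)) (@Some_inj _)).
apply: leq_trans (subset_leq_card sub) _; apply: leq_trans (leq_imset_card _ _) _.
by rewrite cardsX cardsT card_ord.
Qed.

(** Cayley's formula, with k ^ (k - 2) written so that the exponent is not truncated at
    k = 1. The Laplacian of the complete graph on S is a diagonal matrix minus a matrix
    of rank one. *)
Theorem card_inner_trees (R : fieldType) S : (0 < #|S|)%N -> #|S|%:R != 0 :> R ->
  \sum_(p | inner_tree S p) (1 : R) = #|S|%:R ^+ #|S|.-1 / #|S|%:R.
Proof.
set k := #|S| => S0 k0; pose c v u : R := (u \in S)%:R.
transitivity (\sum_(p : {ffun V -> V} | parent_map (off_root S) p)
    \prod_(v | v \notin off_root S) c v (p v)).
  rewrite big_mkcondr /=; apply: eq_bigr => p pm.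
  have pr : p (pick_root S) \in S by rewrite (parent_map_fix pm) ?pick_root_mem // !inE eqxx.
  case: ifP => [/forallP H|/negbT].
    by rewrite big1 // => v; rewrite notin_off_root => /andP[_ vS]; rewrite /c (implyP (H v) vS).
  rewrite negb_forall => /existsP[v]; rewrite negb_imply => /andP[vS pv].
  rewrite (bigD1 v) /=; first by rewrite /c (negbTE pv) mul0r.
  by rewrite notin_off_root vS andbT; apply: contraNneq pv => ->.
rewrite matrix_forest.
pose d : 'rV[R]_n := \row_v (if v \in off_root S then 1 else k%:R).
pose u : 'cV[R]_n := \col_v ((v \notin off_root S)%:R / k%:R).
pose w : 'rV[R]_n := \row_v (v \in S)%:R.
have -> : rooted_laplacian (off_root S) c = diag_mx d *m (1%:M - u *m w).
  apply/matrixP => v x; rewrite mul_diag_mx !mxE big_ord1 !mxE.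
  have [vB|vB] := boolP (v \in off_root S); first by rewrite mul1r mul0r mul0r subr0.
  rewrite mulrBr mul1r mulrA divff // mul1r /c; congr (_ * _ - _).
  by rewrite -natr_sum -big_mkcond /= sum1_card.
have cS : \sum_(v | v \notin off_root S) 1 = k.-1 :> nat.
  rewrite sum1_card /k [in RHS](cardsD1 (pick_root S)) pick_root_mem // add1n /=.
  by apply: eq_card => v; rewrite finset.in_setD1 -notin_off_root.
rewrite det_mulmx det_diag det_sub_rank1; congr (_ * _).
  rewrite (bigID (fun v => v \in off_root S)) /= big1 ?mul1r; last by move=> v vB; rewrite mxE vB.
  rewrite (eq_bigr (fun=> k%:R)); last by move=> v /negbTE vB; rewrite mxE vB.
  by rewrite prodr_const -sum1_card cS.
rewrite mxE (eq_bigr (fun v => if v \notin off_root S then k%:R^-1 else 0)); last first.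
  move=> v _; rewrite !mxE notin_off_root; case: (v \in S); rewrite ?andbF ?mul0r //.
  by case: (v != _); rewrite /= ?mul1r ?mul0r ?mulr0.
rewrite -big_mkcond sumr_const -sum1_card cS -[_ *+ _]mulr_natr.
apply: (mulfI k0); rewrite mulrBr mulr1 divff // mulrA divff // mul1r.
by rewrite -{1}(prednK S0) -natr1 addrAC subrr add0r.
Qed.

Section Events.
Variables (N : nat).
Implicit Types (a : {ffun edge n -> 'I_N}) (j : nat).

(** Orient a spanning tree of the component towards its root. *)
Lemma component_tree a j S : S \in components (sublevel a j) ->
  (0 < #|S|)%N /\ exists2 p, inner_tree S p &
    pattern (parent_edges (off_root S) p) (boundary S) j a.
Proof.
move=> SC; have SE v : v \in S -> S = component (sublevel a j) v by exact: component_of_mem.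
have S0 : (0 < #|S|)%N.
  by case/imsetP: (SC) => x _ ->; apply/card_gt0P; exists x; rewrite mem_component connect0.
split=> //; have rS := pick_root_mem S0.
have adjS v x : v \in S -> adj (sublevel a j) v x -> x \in S.
  by move=> /SE ES vx; rewrite ES mem_component connect1.
have [|p pm pe] := @exists_parent_map n (adj (sublevel a j)) (off_root S).
  move=> v; have [vS|vS] := boolP (v \in S); last by exists v; rewrite ?inE ?vS ?orbT ?connect0.
  by exists (pick_root S); rewrite ?inE ?eqxx // -mem_component -(SE v).
exists p.
  rewrite /inner_tree pm; apply/forallP => v; apply/implyP => vS.
  have [vB|/pe] := boolP (v \in off_root S); first by rewrite (parent_map_fix pm).
  exact: adjS.
apply/patternP; split=> e.
  by case/parent_edgesP => v /pe av E; rewrite (adj_mem _ E) inE in av.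
case/boundaryP => x [y [xS yS E]]; rewrite ltnNge; apply: contra yS => ej.
by apply: (adjS x) => //; rewrite (adj_mem _ E) inE.
Qed.

(** The component of S is exactly the tree p: all other edges touching S are closed. *)
Definition isolated_tree S p j a :=
  inner_tree S p && pattern (parent_edges (off_root S) p)
    (touching S :\: parent_edges (off_root S) p) j a.

Lemma isolated_tree_edges S p j a : isolated_tree S p j a ->
  parent_edges (off_root S) p = (touching S :&: sublevel a j)%SET.
Proof.
case/andP=> iT /patternP[Ho Hc]; apply/finset.setP => e; rewrite finset.in_setI [e \in sublevel _ _]inE.
have [eT|eT] := boolP (e \in parent_edges _ _).
  by rewrite (fintype.subsetP (inner_edge_touching iT)) // Ho.
apply/esym/negbTE; rewrite negb_and -ltnNge.
by have [et|] //= := boolP (e \in touching S); rewrite Hc // finset.in_setD eT.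
Qed.

(** The tree is determined by the open edges touching S. *)
Lemma isolated_tree_uniq S p q j a :
  isolated_tree S p j a -> isolated_tree S q j a -> p = q.
Proof.
move=> ip iq; apply: (@parent_edges_inj _ (off_root S)); do ?[by case/andP: ip => /andP[]].
  by case/andP: iq => /andP[].
by rewrite (isolated_tree_edges ip) (isolated_tree_edges iq).
Qed.

Lemma isolated_tree_component S p j a : (0 < #|S|)%N -> isolated_tree S p j a ->
  S \in components (sublevel a j).
Proof.
move=> S0 ip; have rS := pick_root_mem S0; have TE := isolated_tree_edges ip.
case/andP: ip => iT _; have /andP[pm _] := iT.
apply/imsetP; exists (pick_root S) => //; apply/finset.setP => y; rewrite mem_component.
apply/idP/idP => [yS|c].
  have [b bB c] := connect_parent_edges y pm.
  have cS : fingraph.closed (adj (parent_edges (off_root S) p)) (mem S).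
    move=> x x' /existsP[e /andP[/(inner_edge_sub iT) /fintype.subsetP es /eqP E]].
    by rewrite !es // E !inE eqxx ?orbT.
  have bS : b \in S by rewrite -(closed_connect cS c).
  have -> : pick_root S = b.
    by apply/esym/eqP; move: bB; rewrite !inE bS orbF.
  rewrite connect_adjC; apply: connect_sub c => x x' h; apply: connect1; move: h.
  by apply: adj_sub; rewrite TE; exact: finset.subsetIr.
have cS : fingraph.closed (adj (sublevel a j)) (mem S).
  have H x x' : adj (sublevel a j) x x' -> x \in S -> x' \in S.
    case/existsP=> e /andP[eO /eqP E] xS.
    have : e \in parent_edges (off_root S) p.
      by rewrite TE finset.in_setI eO (mem_touching (v := x)) // E !inE eqxx.
    by move/(inner_edge_sub iT)/fintype.subsetP; apply; rewrite E !inE eqxx orbT.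
  by move=> x x' h; apply/idP/idP; apply: H; rewrite // adj_sym.
by have <- : (pick_root S \in S) = (y \in S) by exact: (closed_connect cS c).
Qed.

Variable R : realFieldType.
Hypothesis N0 : (0 < N)%N.

(** The expected number of trees on k vertices whose k - 1 edges are open while M
    further edges are closed, when edges are open independently with probability P. With
    M = k (n - k), the size of the boundary, this bounds the number of components of
    size k from above; with M = k n it bounds the number of isolated trees from
    below. *)
Definition tree_profile (k M : nat) (P : R) : R :=
  'C(n, k)%:R * (k%:R ^+ k.-1 / k%:R) * (P ^+ k.-1 * (1 - P) ^+ M).

Lemma sum_subsets_card k (c : R) : \sum_(S : {set V} | #|S| == k) c = 'C(n, k)%:R * c.
Proof.
rewrite sumr_const -[c *+ _]mulr_natl; congr (_%:R * _).
rewrite -[n in RHS]card_ord -card_draws; apply: eq_card => S; by rewrite !inE.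
Qed.

(** Union bound over the spanning trees given by [component_tree]. *)
Lemma avg_components j k : (0 < k)%N ->
  avg (fun a => #|[set S in components (sublevel a j) | #|S| == k]|%:R) <=
  tree_profile k (k * (n - k)) (open_prob R N j).
Proof.
move=> k0.
pose u S a : R := \sum_(p | inner_tree S p) (pattern (parent_edges (off_root S) p) (boundary S) j a)%:R.
apply: le_trans (_ : avg (fun a => \sum_(S : {set V} | #|S| == k) u S a) <= _).
  apply: le_avg => a; rewrite -sum1_card natr_sum big_mkcond [leRHS]big_mkcond.
  apply: ler_sum => S _; rewrite inE; have [Sk|] := eqVneq #|S| k; last by rewrite andbF.
  rewrite andbT; case: ifP => [/component_tree[_ [p ip pa]]|_]; last exact: sumr_ge0.
  by rewrite /u (bigD1 p) //= pa lerDl sumr_ge0.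
rewrite avg_sum /tree_profile -mulrA -sum_subsets_card; apply: ler_sum => S /eqP Sk.
have S0 : (0 < #|S|)%N by rewrite Sk.
rewrite avg_sum -[X in X * _]mul1r -{1}Sk -{1}Sk -{1}Sk.
rewrite mul1r -card_inner_trees // ?pnatr_eq0 -?lt0n // mulr_suml.
apply: ler_sum => p iT; rewrite avg_pattern ?inner_boundary_disjoint //.
by rewrite (card_inner_edges S0 iT) card_boundary Sk mul1r.
Qed.

End Events.
End InnerTrees.

(** * Isolated trees: first and second moments *)

Lemma bernoulli_ineq (R : realFieldType) (x : R) m : 0 <= x -> x <= 1 ->
  1 - m%:R * x <= (1 - x) ^+ m.
Proof.
move=> x0 x1; elim: m => [|m IH]; first by rewrite mul0r subr0 expr0.
rewrite exprS; apply: le_trans (_ : (1 - x) * (1 - m%:R * x) <= _); last first.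
  by rewrite ler_wpM2l // subr_ge0.
have : 0 <= m%:R * x * x by rewrite !mulr_ge0.
rewrite -(@natr1 R m); lra.
Qed.

Section IsolatedTrees.
Variables (R : realFieldType) (n N K j : nat).
Hypotheses (n0 : (0 < n)%N) (N0 : (0 < N)%N).
Let V := 'I_n.
Let P : R := open_prob R N j.
Implicit Types (S : {set V}) (p q : {ffun V -> V}) (a : {ffun edge n -> 'I_N}).

Let P0 : 0 <= P. Proof. exact: open_prob_ge0. Qed.
Let P1 : 0 <= 1 - P. Proof. by rewrite subr_ge0; exact: open_prob_le1. Qed.
Let P1le : 1 - P <= 1. Proof. by rewrite lerBlDr lerDl. Qed.
Let L0 : (0 < #|'I_N|)%N. Proof. by rewrite card_ord. Qed.

Definition small_tree (i : {set V} * {ffun V -> V}) : bool :=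
  (0 < #|i.1| <= K)%N && inner_tree n0 i.1 i.2.

Let O (i : {set V} * {ffun V -> V}) := parent_edges (off_root n0 i.1) i.2.
Let C (i : {set V} * {ffun V -> V}) := touching i.1 :\: O i.
Let A (i : {set V} * {ffun V -> V}) a : R := (pattern (O i) (C i) j a)%:R.

Definition tree_count a : R := \sum_(i | small_tree i) A i a.

Let isoE i a : small_tree i -> pattern (O i) (C i) j a = isolated_tree n0 i.1 i.2 j a.
Proof. by case/andP=> _ iT; rewrite /isolated_tree iT. Qed.

(** Isolated trees on distinct sets are distinct components, and each set carries at
    most one. *)
Lemma tree_count_le a : tree_count a <= #|components (sublevel a j)|%:R.
Proof.
rewrite /tree_count -(pair_big_dep (fun S : {set V} => (0 < #|S| <= K)%N) (inner_tree n0)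
  (fun S p => A (S, p) a)) /=.
rewrite -sum1_card natr_sum big_mkcond [leRHS]big_mkcond; apply: ler_sum => S _.
case: ifP => [SK|_]; last by case: ifP.
have [/existsP[p ip]|N1] := boolP [exists p, isolated_tree n0 S p j a].
  have S0 : (0 < #|S|)%N by case/andP: SK.
  rewrite (isolated_tree_component S0 ip) (bigD1 p) /=; last by case/andP: ip.
  rewrite big1 ?addr0 ?lern1 ?leq_b1 // => q /andP[iq qp]; rewrite /A isoE; last first.
    by rewrite /small_tree /= SK.
  apply/eqP; rewrite pnatr_eq0 eqb0; apply: contra qp => iq'.
  by apply/eqP; exact: isolated_tree_uniq iq' ip.
rewrite big1 => [|p iT]; first by case: ifP.
rewrite /A isoE; last by rewrite /small_tree /= SK.
apply/eqP; rewrite pnatr_eq0 eqb0; apply: contra N1 => ip; apply/existsP; by exists p.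
Qed.

Let dOC i : [disjoint O i & C i].
Proof. by rewrite disjoint_sym disjoint_subset; apply/fintype.subsetP => e; rewrite !inE => /andP[]. Qed.

Let avgA i : avg (A i) = P ^+ #|O i| * (1 - P) ^+ #|C i|.
Proof. exact: avg_pattern. Qed.

Let A0 i a : 0 <= A i a. Proof. by rewrite ler0n. Qed.

Lemma sum_small_sets (F : nat -> R) :
  \sum_(S : {set V} | (0 < #|S| <= K)%N) F #|S| = \sum_(1 <= k < K.+1) 'C(n, k)%:R * F k.
Proof.
under [RHS]eq_bigr => k _ do rewrite -sum_subsets_card.
rewrite (exchange_big_dep xpredT) //= big_mkcond; apply: eq_bigr => S _.
by rewrite (eq_bigl (fun k => k == #|S|)) => [|k]; rewrite ?big_nat1_eq ?ltnS // eq_sym.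
Qed.

Lemma avg_tree_count_ge :
  \sum_(1 <= k < K.+1) tree_profile n k (k * n) P <= avg tree_count.
Proof.
have -> : avg tree_count = \sum_(S : {set V} | (0 < #|S| <= K)%N) \sum_(p | inner_tree n0 S p) avg (A (S, p)).
  by rewrite /tree_count avg_sum pair_big_dep.
pose F k := k%:R ^+ k.-1 / k%:R * (P ^+ k.-1 * (1 - P) ^+ (k * n)).
have -> : \sum_(1 <= k < K.+1) tree_profile n k (k * n) P =
    \sum_(S : {set V} | (0 < #|S| <= K)%N) F #|S|.
  by rewrite sum_small_sets; apply: eq_bigr => k _; rewrite /tree_profile /F !mulrA.
apply: ler_sum => S /andP[S0 _].
rewrite /F -(@card_inner_trees n n0 R S) ?pnatr_eq0 -?lt0n // mulr_suml.
apply: ler_sum => p iT; rewrite mul1r avgA /O (card_inner_edges S0 iT).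
rewrite ler_wpM2l ?exprn_ge0 // ler_wiXn2l //.
by apply: leq_trans (card_touching S); apply/subset_leq_card/fintype.subsetP => e; rewrite inE => /andP[].
Qed.

Lemma avg_tree_count_le : avg tree_count <= n%:R.
Proof.
apply: avg_le_cst; first exact: card_env_gt0.
move=> a; apply: le_trans (tree_count_le a) _; rewrite ler_nat.
by apply: leq_trans (leq_imset_card _ _) _; rewrite card_ord.
Qed.

Let card_meet S S' : (#|S| <= K)%N -> (#|S'| <= K)%N -> [disjoint S & S'] ->
  (#|touching S :&: touching S'| <= K ^ 2)%N.
Proof.
move=> SK SK' dS.
pose g (x y : V) : option (edge n) := insub [set x; y]%SET.
have sub : [set Some e | e in touching S :&: touching S']%SET \subset
    [set g xy.1 xy.2 | xy in finset.setX S S']%SET.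
  apply/fintype.subsetP => o /imsetP[e]; rewrite finset.in_setI.
  case/andP=> /touchingP[x xe xS] /touchingP[y ye yS] ->.
  have xy : x != y by apply: contraTneq yS => <-; rewrite (disjointFr dS xS).
  have E : val e = [set x; y]%SET.
    apply/eqP; rewrite eq_sym eqEcard finset.subUset !finset.sub1set xe ye (eqP (valP e)) cards2.
    by rewrite xy.
  by apply/imsetP; exists (x, y); [rewrite inE /= xS|rewrite /g /= -E valK].
rewrite -(card_imset (mem (touching S :&: touching S')) (@Some_inj _)).
apply: leq_trans (subset_leq_card sub) _; apply: leq_trans (leq_imset_card _ _) _.
by rewrite cardsX; exact: leq_mul.
Qed.

Let inner_not_touching (i i' : {set V} * {ffun V -> V}) : small_tree i -> [disjoint i.1 & i'.1] ->
  [disjoint O i & touching i'.1].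
Proof.
move=> /andP[_ iT] d; rewrite disjoint_subset; apply/fintype.subsetP => e eO.
have es := fintype.subsetP (inner_edge_sub iT eO).
by apply/negP => /touchingP[v /es vS]; rewrite (disjointFr d vS).
Qed.

Let O_sub i : small_tree i -> O i \subset touching i.1.
Proof. by case/andP=> _ /inner_edge_touching. Qed.

(** Isolated trees on disjoint sets are independent except for the edges between the
    sets, at most K ^ 2 of them, which both require to be closed; on sets that overlap
    without being equal they exclude each other. *)
Lemma avg_pair (i i' : {set V} * {ffun V -> V}) : small_tree i -> small_tree i' ->
  avg (fun a => A i a * A i' a) * (1 - P) ^+ (K ^ 2) <=
  (i == i')%:R * avg (A i) + avg (A i) * avg (A i').
Proof.
move=> gi gi'; have q1 : 0 <= (1 - P) ^+ (K ^ 2) <= 1 by rewrite exprn_ge0 // exprn_ile1.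
have AA0 : 0 <= avg (A i) * avg (A i') by rewrite mulr_ge0 // avg_ge0.
have [dS|ndS] := boolP [disjoint i.1 & i'.1].
  apply: le_trans (_ : avg (A i) * avg (A i') <= _); last first.
    by rewrite lerDr mulr_ge0 // avg_ge0.
  have dS' : [disjoint i'.1 & i.1] by rewrite disjoint_sym.
  have d1 := inner_not_touching gi dS; have d2 := inner_not_touching gi' dS'.
  have dO : [disjoint O i :|: O i' & C i :|: C i'].
    rewrite disjoint_sym disjoint_subset; apply/fintype.subsetP => e.
    rewrite finset.in_setU !finset.in_setD => eC.
    suff : e \notin O i :|: O i' by [].
    rewrite finset.in_setU negb_or; case/orP: eC => /andP[eO et]; rewrite eO ?andbT /=.
      by apply/negP => eO'; rewrite (disjointFr d2 eO') in et.
    by apply/negP => eO'; rewrite (disjointFr d1 eO') in et.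
  have -> : avg (fun a => A i a * A i' a) =
      avg (fun a => (pattern (O i :|: O i') (C i :|: C i') j a)%:R : R).
    apply: eq_avg => a; rewrite /A -natrM mulnb; congr (nat_of_bool _)%:R.
    apply/andP/patternP => [[/patternP[h1 h2] /patternP[h3 h4]]|[h1 h2]].
      by split=> e; rewrite finset.in_setU => /orP[]; auto.
    by split; apply/patternP; split=> e h; rewrite ?h1 ?h2 // finset.in_setU h ?orbT.
  rewrite avg_pattern // !avgA mulrACA -exprD -exprD.
  (* The open edges of one tree lie inside its set, and touch no vertex of the other
     set. *)
  have OO : #|O i :&: O i'| = 0%N.
    apply/eqP; rewrite cards_eq0 -finset.subset0; apply/fintype.subsetP => e.
    rewrite finset.in_setI => /andP[e1 e2].
    by move: (disjointFr d1 e1); rewrite (fintype.subsetP (O_sub gi') e e2).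
  rewrite -(cardsUI (O i)) OO addn0 -mulrA -exprD ler_wpM2l ?exprn_ge0 // ler_wiXn2l //.
  rewrite -cardsUI leq_add2l.
  have SK : (#|i.1| <= K)%N by case/andP: gi => /andP[].
  have SK' : (#|i'.1| <= K)%N by case/andP: gi' => /andP[].
  apply: leq_trans (card_meet SK SK' dS); apply: subset_leq_card; apply: finset.setISS; exact: finset.subsetDl.
have [->|ne] := eqVneq i i'.
  rewrite mul1r (eq_avg (h := A i')); last first.
    by move=> a; rewrite /A -natrM mulnb andbb.
  have AA' : 0 <= avg (A i') by exact: avg_ge0.
  apply: le_trans (_ : avg (A i') * 1 <= _); last by rewrite mulr1 lerDl mulr_ge0.
  by rewrite ler_wpM2l //; case/andP: q1.
rewrite mul0r add0r (eq_avg (h := fun=> 0)) ?avg_cst ?card_env_gt0 ?mul0r // => a.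
rewrite /A -natrM mulnb; apply/eqP; rewrite pnatr_eq0 eqb0; apply: contra ne => /andP[].
rewrite !isoE // => t t'.
have S0 : (0 < #|i.1|)%N by case/andP: gi => /andP[].
have S0' : (0 < #|i'.1|)%N by case/andP: gi' => /andP[].
have c := isolated_tree_component S0 t; have c' := isolated_tree_component S0' t'.
have SS : i.1 = i'.1.
  move: ndS; rewrite -setI_eq0 => /set0Pn[v]; rewrite inE => /andP[v1 v2].
  by rewrite (component_of_mem c v1) (component_of_mem c' v2).
case: i i' SS t t' {AA0 gi gi' ndS S0 S0' c c'} => [S p] [S' p'] /= <- t t'.
by rewrite (isolated_tree_uniq t t').
Qed.

(** [avg_pair] bounds the variance; then 2 |z| <= t + z ^ 2 / t. *)
Lemma tree_count_deviation (t : R) : 0 < t -> (K ^ 2)%:R * P <= 1 / 2 ->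
  avg (fun a => `|tree_count a - avg tree_count|) <=
  (t + 2 * (n%:R + (K ^ 2)%:R * P * n%:R ^+ 2) / t) / 2.
Proof.
move=> t0 KP; set mu := avg tree_count; set q := (1 - P) ^+ (K ^ 2).
have mu0 : 0 <= mu by apply: avg_ge0 => a; exact: sumr_ge0.
have mun : mu <= n%:R := avg_tree_count_le.
have q_ge : 1 - (K ^ 2)%:R * P <= q by apply: bernoulli_ineq; rewrite // -subr_ge0.
have q_gt : 1 / 2 <= q by apply: le_trans q_ge; lra.
have sq : avg (fun a => tree_count a ^+ 2) * q <= mu + mu ^+ 2.
  have -> : avg (fun a => tree_count a ^+ 2) =
      \sum_(i | small_tree i) \sum_(i' | small_tree i') avg (fun a => A i a * A i' a).
    under [RHS]eq_bigr => i _ do rewrite -avg_sum.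
    rewrite -avg_sum; apply: eq_avg => a; rewrite expr2 mulr_suml; apply: eq_bigr => i _.
    by rewrite mulr_sumr.
  have -> : mu + mu ^+ 2 = \sum_(i | small_tree i) \sum_(i' | small_tree i')
      ((i == i')%:R * avg (A i) + avg (A i) * avg (A i')).
    rewrite /mu /tree_count avg_sum expr2 mulr_suml -big_split /=; apply: eq_bigr => i gi.
    rewrite big_split /= mulr_sumr; congr (_ + _).
    by rewrite (bigD1 i) //= eqxx mul1r big1 ?addr0 // => i' /andP[_ /negbTE]; rewrite eq_sym => ->; rewrite mul0r.
  rewrite mulr_suml; apply: ler_sum => i gi; rewrite mulr_suml; apply: ler_sum => i' gi'.
  exact: avg_pair.
have var : avg (fun a => (tree_count a - mu) ^+ 2) <= 2 * (n%:R + (K ^ 2)%:R * P * n%:R ^+ 2).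
  have -> : avg (fun a => (tree_count a - mu) ^+ 2) = avg (fun a => tree_count a ^+ 2) - mu ^+ 2.
    rewrite (eq_avg (h := fun a => tree_count a ^+ 2 - (2 * mu * tree_count a - mu ^+ 2))); last first.
      by move=> a; ring.
    rewrite avgB avgB avgZ avg_cst ?card_env_gt0 // -/mu; ring.
  set W := avg _ in sq *; have n1 : mu ^+ 2 <= n%:R ^+ 2 by rewrite lerXn2r // nnegrE // ltW.
  have k0 : 0 <= (K ^ 2)%:R * P by rewrite mulr_ge0.
  set x := (K ^ 2)%:R * P in KP q_ge k0 *.
  have h1 : (W - mu ^+ 2) * q <= n%:R + x * n%:R ^+ 2.
    have : (1 - q) * mu ^+ 2 <= x * n%:R ^+ 2.
      apply: le_trans (_ : x * mu ^+ 2 <= _); last by rewrite ler_wpM2l.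
      by rewrite ler_wpM2r ?sqr_ge0 //; lra.
    lra.
  have [Wn|Wp] := ltP (W - mu ^+ 2) 0.
    apply: ltW; apply: lt_le_trans Wn _; rewrite mulr_ge0 // addr_ge0 // mulr_ge0 // sqr_ge0.
  have : (W - mu ^+ 2) * (1 / 2) <= (W - mu ^+ 2) * q by rewrite ler_wpM2l.
  lra.
apply: le_trans (_ : avg (fun a => (t + (tree_count a - mu) ^+ 2 / t) / 2) <= _).
  apply: le_avg => a; set z := tree_count a - mu; rewrite ler_pdivlMr //.
  have : 0 <= (`|z| - t) ^+ 2 / t by rewrite divr_ge0 ?sqr_ge0 // ltW.
  have -> : (`|z| - t) ^+ 2 / t = t + z ^+ 2 / t - `|z| * 2.
    by rewrite -[z ^+ 2]real_normK ?num_real //; field; rewrite gt_eqF.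
  lra.
have -> : avg (fun a => (t + (tree_count a - mu) ^+ 2 / t) / 2) =
    (t + avg (fun a => (tree_count a - mu) ^+ 2) / t) / 2.
  rewrite (eq_avg (h := fun a => t / 2 + (t^-1 / 2) * (tree_count a - mu) ^+ 2)); last first.
    by move=> a; field; rewrite gt_eqF.
  by rewrite avgD avg_cst ?card_env_gt0 // avgZ; field; rewrite gt_eqF.
rewrite ler_pM2r ?invr_gt0 // lerD2l ler_pM2r ?invr_gt0 //.
Qed.

End IsolatedTrees.

(** * Beta integrals and Apery's constant *)

Section BetaIntegral.
Local Open Scope classical_set_scope.
Variable R : realType.

Lemma is_derive_pow (f : R -> R) (x df : R) m : is_derive x (1 : R) f df ->
  is_derive x (1 : R) (fun y => f y ^+ m) (m%:R * f x ^+ m.-1 * df).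
Proof.
move=> fd; have -> : (fun y => f y ^+ m) = f ^+ m.
  by apply/funext => y; elim: m => [|m IH]; rewrite ?expr0 // !exprS IH.
exact: is_deriveX.
Qed.

Definition beta_fun (a M : nat) (x : R) : R := x ^+ a * (1 - x) ^+ M.

Lemma is_derive_beta a M (x : R) : is_derive x (1 : R) (beta_fun a M)
  (a%:R * beta_fun a.-1 M x - M%:R * beta_fun a M.-1 x).
Proof.
have h1 : is_derive x (1 : R) (fun y : R => y ^+ a) (a%:R * x ^+ a.-1 * 1).
  exact: is_derive_pow.
have h0 : is_derive x (1 : R) (fun y : R => 1 - y) (-1).
  by apply: is_derive_eq; rewrite add0r mul1r.
have h2 := is_derive_pow M h0.
rewrite /beta_fun; apply: is_derive_eq; rewrite /GRing.scale /=; ring.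
Qed.

(** Integration by parts lowers the exponent of x and raises that of 1 - x. *)
Lemma beta_antiderivative a M : exists F : R -> R,
  (forall x : R, is_derive x (1 : R) F (beta_fun a M x)) /\
  F 1 - F 0 = a`!%:R * M`!%:R / (a + M).+1`!%:R.
Proof.
elim: a M => [|a IH] M.
  exists (fun x => - (M.+1%:R^-1) * beta_fun 0 M.+1 x); split.
    move=> x; have H := is_derive_beta 0 M.+1 x; apply: is_derive_eq.
    by rewrite /GRing.scale /= mul0r sub0r mulrN mulNr opprK mulrA mulVf ?mul1r ?pnatr_eq0.
  rewrite /beta_fun subrr subr0 !expr0n !expr1n /= add0n factS natrM mulr0.
  have h1 : M.+1%:R != 0 :> R by rewrite pnatr_eq0.
  have h2 : M`!%:R != 0 :> R by rewrite pnatr_eq0 -lt0n fact_gt0.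
  rewrite fact0; move: M.+1%:R M`!%:R h1 h2 => u v h1 h2.
  by field; rewrite ?h1 ?h2.
have [F [dF EF]] := IH M.+1.
have h1 : M.+1%:R != 0 :> R by rewrite pnatr_eq0.
exists (fun x => - (M.+1%:R^-1) * beta_fun a.+1 M.+1 x + a.+1%:R / M.+1%:R * F x); split.
  move=> x; have H := is_derive_beta a.+1 M.+1 x; have H' := dF x; apply: is_derive_eq.
  rewrite /GRing.scale /=; move: M.+1%:R h1 => u h1; by field.
have h2 : (a + M.+1).+1`!%:R != 0 :> R by rewrite pnatr_eq0 -lt0n fact_gt0.
rewrite [X in X - _]addrC [X in _ - X]addrC opprD addrACA -mulrBr EF addSnnS.
move: (a + M.+1).+1`!%:R h2 => v h2.
rewrite /beta_fun subrr subr0 !expr0n !expr1n /= (factS a) (factS M) !natrM.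
rewrite !(mul0r, mulr0, subr0, addr0).
move: M.+1%:R h1 => u h1; by field; rewrite h1 h2.
Qed.

Definition beta_mean N a M : R := (\sum_(j < N) beta_fun a M (open_prob R N j)) / N%:R.

Lemma beta_mean_close N a M : (0 < N)%N ->
  `|beta_mean N a M - a`!%:R * M`!%:R / (a + M).+1`!%:R| <= (a%:R + M%:R) / N%:R.
Proof.
move=> N0; have [F [dF <-]] := beta_antiderivative a M.
have dB (x : R) : is_derive x (1 : R) (beta_fun a M) (a%:R * beta_fun a.-1 M x - M%:R * beta_fun a M.-1 x).
  exact: is_derive_beta.
have b1 a' M' (x : R) : 0 <= x <= 1 -> `|beta_fun a' M' x| <= 1.
  move=> /andP[x0 x1]; rewrite /beta_fun normrM !normrX -[leRHS]mulr1.
  have y0 : 0 <= 1 - x by rewrite subr_ge0.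
  have y1 : 1 - x <= 1 by rewrite lerBlDr lerDl.
  by rewrite ler_pM ?exprn_ge0 // exprn_ile1 ?ger0_norm.
apply: (riemann_sum N0 dF dB) => [x xI|j jN].
  apply: le_trans (ler_normB _ _) _; rewrite (normrM a%:R) (normrM M%:R) !normr_nat.
  by rewrite lerD // ler_piMr // b1.
by rewrite open_probE // lexx andbT ler_wpM2r ?invr_ge0 // ler_nat.
Qed.

End BetaIntegral.

Section Zeta.
Local Open Scope classical_set_scope.
Variable R : realType.

Definition zeta3_sum (m : nat) : R := \sum_(1 <= k < m) k%:R ^- 3.

Lemma zeta3_sum_nondecreasing : {homo zeta3_sum : m n / (m <= n)%N >-> m <= n}.
Proof.
apply: homo_leq => [m|m n p|m]; [exact: lexx|exact: le_trans|].
rewrite /zeta3_sum; case: m => [|m]; first by rewrite !big_geq.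
by rewrite [leRHS]big_nat_recr //= lerDl invr_ge0 exprn_ge0.
Qed.

(** Comparison with a telescoping sum: the cube of the inverse of m + 1 is at most 1 / m
    - 1 / (m + 1). *)
Lemma zeta3_sum_le2 m : zeta3_sum m <= 2.
Proof.
case: m => [|m]; first by rewrite /zeta3_sum big_geq.
case: m => [|m]; first by rewrite /zeta3_sum big_geq.
suff : zeta3_sum m.+2 <= 2 - m.+1%:R^-1 by move=> /le_trans; apply; rewrite lerBlDr lerDl invr_ge0.
elim: m => [|m IH].
  by rewrite /zeta3_sum big_nat1 expr1n invr1; lra.
rewrite /zeta3_sum big_nat_recr //=; apply: le_trans (lerD IH (lexx _)) _.
set x : R := m.+1%:R; have x1 : 1 <= x by rewrite ler1n.
have -> : m.+2%:R = x + 1 :> R by rewrite natr1.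
have x0 : 0 < x by apply: lt_le_trans x1.
have y0 : 0 < x + 1 by apply: addr_gt0.
rewrite -addrA lerD2l -lerBrDl -subr_ge0.
have -> : - (x + 1)^-1 - - x^-1 - (x + 1) ^- 3 = (x ^+ 2 + x + 1) / (x * (x + 1) ^+ 3).
  by field; rewrite !gt_eqF.
by rewrite divr_ge0 ?addr_ge0 ?mulr_ge0 ?exprn_ge0 // ltW.
Qed.

Lemma cvg_zeta3 : zeta3_sum m @[m --> \oo] --> zeta3 R.
Proof.
apply: nondecreasing_is_cvgn; first exact: zeta3_sum_nondecreasing.
exists 2 => _ [m _ <-]; exact: zeta3_sum_le2.
Qed.

Lemma zeta3_sum_le m : zeta3_sum m <= zeta3 R.
Proof.
apply: nondecreasing_cvgn_le; first exact: zeta3_sum_nondecreasing.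
by apply/cvg_ex; exists (zeta3 R); exact: cvg_zeta3.
Qed.

Lemma zeta3_gt0 : 0 < zeta3 R.
Proof.
apply: lt_le_trans (zeta3_sum_le 2); by rewrite /zeta3_sum big_nat1 expr1n invr1.
Qed.

End Zeta.

Section ProfileLimit.
Local Open Scope classical_set_scope.
Variable R : realType.

(** The integral of the tree profile over P in [0, 1]. *)
Definition profile_limit n k M : R :=
  'C(n, k)%:R * (k%:R ^+ k.-1 / k%:R) * (k.-1`!%:R * M`!%:R / (k.-1 + M).+1`!%:R).

Lemma profile_limitE n k M : (0 < k)%N ->
  profile_limit n k M = k%:R ^+ k / k%:R ^+ 3 * \prod_(i < k) ((n - i)%:R / (M + i).+1%:R).
Proof.
move=> k0; have kr : k%:R != 0 :> R by rewrite pnatr_eq0 -lt0n.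
rewrite /profile_limit big_split /= prodfV -natr_prod -natr_prod -ffact_prod -bin_ffact.
have -> : (k.-1 + M).+1`! = (M`! * \prod_(i < k) (M + i).+1)%N.
  rewrite -addSn prednK // addnC; elim: (k) => [|m IH]; first by rewrite addn0 big_ord0 muln1.
  by rewrite addnS factS IH big_ord_recr /= [RHS]mulnA [RHS]mulnC.
set Q := (\prod_(i < k) _)%N.
have Q0 : Q%:R != 0 :> R by rewrite pnatr_eq0 -lt0n prodn_gt0.
have h2 : M`!%:R != 0 :> R by rewrite pnatr_eq0 -lt0n fact_gt0.
have -> : k`! = (k * k.-1`!)%N by rewrite -{1}(prednK k0) factS prednK.
have -> : k%:R ^+ k = k%:R * k%:R ^+ k.-1 :> R by rewrite -exprS prednK.
rewrite !natrM; move: (k.-1`!%:R) (M`!%:R) h2 Q%:R Q0 => u v h2 z Q0.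
by field; rewrite kr Q0 h2.
Qed.

Lemma cvg_prod_ord (u : nat -> nat -> R) (l : R) k :
  (forall i, u i n @[n --> \oo] --> l) -> \prod_(i < k) u i n @[n --> \oo] --> l ^+ k.
Proof.
move=> H; elim: k => [|k IH].
  by under eq_fun do rewrite big_ord0; rewrite expr0; exact: cvg_cst.
under eq_fun do rewrite big_ord_recr /=.
by rewrite exprSr; exact: cvgM.
Qed.

(** In the product formula [profile_limitE] each of the k factors tends to 1 / k. Both
    choices of M made below lie in the range allowed here. *)
Lemma cvg_profile_limit k (M : nat -> nat) : (0 < k)%N ->
  (forall n, (2 * k <= n)%N -> (k * (n - k) <= M n <= k * n)%N) ->
  profile_limit n k (M n) @[n --> \oo] --> (k%:R ^- 3 : R).
Proof.
move=> k0 HM; have kr : 0 < k%:R :> R by rewrite ltr0n.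
have -> : k%:R ^- 3 = k%:R ^+ k / k%:R ^+ 3 * k%:R^-1 ^+ k :> R.
  by rewrite exprVn mulrAC divff ?mul1r // expf_neq0 // gt_eqF.
under eq_fun do rewrite profile_limitE //.
apply: cvgM; first exact: cvg_cst.
apply: (@cvg_prod_ord (fun i n => (n - i)%:R / (M n + i).+1%:R)) => i.
pose C : R := (k * k + k * i + i.+1)%:R.
apply/cvgrPdist_le => e e0; near=> n.
have nk : (2 * k <= n)%N by near: n; exact: nbhs_infty_ge.
have ni : (i <= n)%N by near: n; exact: nbhs_infty_ge.
have nr : 0 < n%:R :> R by rewrite ltr0n; apply: leq_trans nk; rewrite muln_gt0.
have nC : 2 * C / e <= n%:R by near: n; exact: nbhs_infty_ger.
have /andP[M1 M2] := HM n nk.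
have Mk : k%:R * n%:R <= (M n)%:R + k%:R * k%:R :> R.
  by rewrite -!natrM -natrD ler_nat addnC -leq_subLR -mulnBr.
have M2' : (M n)%:R <= k%:R * n%:R :> R by rewrite -natrM ler_nat.
have nk' : 2 * k%:R <= n%:R :> R by rewrite -natrM ler_nat.
rewrite natrB // -(@natr1 R (M n + i)) natrD; set D : R := _ + 1.
have ir : 0 <= i%:R :> R by [].
have k1 : 1 <= k%:R :> R by rewrite ler1n.
have kn : 2 * (k%:R * k%:R) <= k%:R * n%:R :> R by rewrite mulrCA ler_wpM2l.
have D_ge : k%:R * n%:R / 2 <= D by rewrite /D; lra.
have D0 : 0 < D by apply: lt_le_trans D_ge; rewrite divr_gt0 ?mulr_gt0.
have -> : k%:R^-1 - (n%:R - i%:R) / D = (D - k%:R * (n%:R - i%:R)) / (k%:R * D).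
  by field; rewrite !gt_eqF.
have kD : 0 < k%:R * D by exact: mulr_gt0.
rewrite normrM [`|_^-1|]ger0_norm ?invr_ge0 ?(ltW kD) // ler_pdivrMr //.
apply: le_trans (_ : C <= _).
  rewrite /C natrD natrD !natrM -(@natr1 R i) ler_norml /D; apply/andP.
  have ki : 0 <= k%:R * i%:R :> R by rewrite mulr_ge0.
  have kk : 0 <= k%:R * k%:R :> R by rewrite mulr_ge0.
  split; lra.
apply: le_trans (_ : e * (n%:R / 2) <= _).
  by move: nC; rewrite ler_pdivrMr // => nC; lra.
rewrite ler_wpM2l ?(ltW e0) //; apply: le_trans (_ : D <= _).
  apply: le_trans D_ge; rewrite ler_pM2r ?invr_gt0 // ler_peMl // ltW.
by rewrite ler_peMl // ltW.
Unshelve. all: by end_near. Qed.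

End ProfileLimit.

(** * Large components above the critical window *)

Section ProfileTail.
Local Open Scope classical_set_scope.
Variable R : realType.

Definition profile_mean n N k M : R :=
  (\sum_(j < N) tree_profile n k M (open_prob R N j)) / N%:R.

Lemma profile_mean_close n N k M : (0 < N)%N ->
  `|profile_mean n N k M - profile_limit R n k M| <=
  'C(n, k)%:R * (k%:R ^+ k.-1 / k%:R) * (k.-1%:R + M%:R) / N%:R.
Proof.
move=> N0; have -> : profile_mean n N k M =
    'C(n, k)%:R * (k%:R ^+ k.-1 / k%:R) * beta_mean R N k.-1 M.
  by rewrite /profile_mean /beta_mean [RHS]mulrA mulr_sumr.
have c0 : 0 <= 'C(n, k)%:R * (k%:R ^+ k.-1 / k%:R) :> R.
  by rewrite mulr_ge0 // divr_ge0 // exprn_ge0.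
rewrite /profile_limit -mulrBr normrM ger0_norm // -[leRHS]mulrA ler_wpM2l //.
exact: beta_mean_close.
Qed.

Lemma cvg_profile_mean n k M : profile_mean n N k M @[N --> \oo] --> profile_limit R n k M.
Proof. by apply: cvg_of_rate => N N0; exact: profile_mean_close. Qed.

(** By induction, from (1 + 1 / k) ^ k <= exp 1. *)
Lemma expn_le_fact_exp k : k%:R ^+ k <= k`!%:R * expR k%:R :> R.
Proof.
elim: k => [|k IH]; first by rewrite expr0 fact0 expR0 mulr1.
rewrite exprS factS natrM -mulrA ler_wpM2l //.
have [->|k0] := posnP k; first by rewrite expr0 fact0 mul1r -expR0 ler_expR.
have kr : 0 < k%:R :> R by rewrite ltr0n.
have -> : k.+1%:R = k%:R * (1 + k%:R^-1) :> R.
  by rewrite mulrDr mulr1 divff ?gt_eqF // natr1.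
have h : (1 + k%:R^-1) ^+ k <= expR 1 :> R.
  have -> : expR 1 = expR (k%:R^-1) ^+ k :> R.
    by rewrite -expRM_natl divff // gt_eqF.
  by rewrite lerXn2r ?nnegrE ?addr_ge0 ?invr_ge0 ?expR_ge0 // expR_ge1Dx.
have -> : k%:R * (1 + k%:R^-1) = k%:R + 1 :> R by rewrite mulrDr mulr1 divff // gt_eqF.
rewrite expRD mulrA; have -> : k%:R + 1 = k%:R * (1 + k%:R^-1) :> R.
  by rewrite mulrDr mulr1 divff // gt_eqF.
by rewrite exprMn ler_pM // exprn_ge0 // addr_ge0 // invr_ge0.
Qed.

(** With z = c / 4 - 1 the claim is 4 (z + 1) <= exp z, which follows from (1 + z / 4) ^
    4 <= exp z because z >= 7. *)
Lemma exp_beats_linear (c : R) : 32 <= c -> c * expR 1 <= expR (c / 4).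
Proof.
move=> c32; set z := c / 4 - 1; have z7 : 7 <= z by rewrite /z; lra.
have -> : expR (c / 4) = expR z * expR 1 by rewrite -expRD subrK.
rewrite ler_wpM2r ?expR_ge0 //.
have -> : expR z = expR (z / 4) ^+ 4.
  by rewrite -expRM_natl; congr expR; field.
have y0 : 11 / 4 <= 1 + z / 4 by lra.
set y := 1 + z / 4 in y0 *.
apply: le_trans (_ : y ^+ 4 <= _); last first.
  by rewrite lerXn2r ?nnegrE ?expR_ge0 ?expR_ge1Dx //; lra.
have -> : c = 16 * y - 12 by rewrite /y /z; field.
have y2 : (11 / 4) ^+ 3 <= y ^+ 3 by rewrite lerXn2r ?nnegrE; lra.
have : (11 / 4) ^+ 3 * y <= y ^+ 4 by rewrite [y ^+ 4]exprSr ler_wpM2r //; lra.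
rewrite !exprS expr0; lra.
Qed.

(** With c = n P, the number of trees on k vertices is at most (e n) ^ k, and k (n - k)
    >= k n / 2. The profile is thus at most (c e exp (- c / 2)) ^ k / P, and
    [exp_beats_linear] bounds the base by exp (- c / 4). *)
Lemma tree_profile_tail n k M (P : R) : (0 < k)%N -> (2 * k <= n)%N -> (k * (n - k) <= M)%N ->
  0 < P -> P <= 1 -> 32 <= n%:R * P ->
  tree_profile n k M P <= P^-1 * expR (- (k%:R * (n%:R * P / 4))).
Proof.
move=> k0 kn kM P0 P1 nP; have kr : 0 < k%:R :> R by rewrite ltr0n.
have k1 : 1 <= k%:R :> R by rewrite ler1n.
have fr : 0 < k`!%:R :> R by rewrite ltr0n fact_gt0.
set c := n%:R * P in nP *; have c0 : 0 < c by apply: lt_le_trans nP.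
have bin : 'C(n, k)%:R <= n%:R ^+ k / k`!%:R :> R.
  rewrite ler_pdivlMr // -natrM -natrX ler_nat bin_ffact ffact_prod.
  rewrite -[k in (n ^ k)%N]card_ord -prod_nat_const.
  by apply: leq_prod => i _; exact: leq_subr.
have Q0 : 0 <= 1 - P by rewrite subr_ge0.
have pw : (1 - P) ^+ M <= expR (- (k%:R * (c / 2))).
  apply: le_trans (_ : expR (- P) ^+ M <= _).
    by rewrite lerXn2r ?nnegrE ?expR_ge0 // expR_ge1Dx.
  rewrite -expRM_natl ler_expR mulrN lerN2 /c.
  have : k%:R * (n%:R / 2) <= M%:R :> R.
    apply: le_trans (_ : (k * (n - k))%:R <= _); last by rewrite ler_nat.
    rewrite natrM ler_wpM2l //; move: kn; rewrite -(ler_nat R) natrM => kn.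
    rewrite natrB; first lra.
    by rewrite -(ler_nat R); lra.
  move=> /(ler_wpM2r (ltW P0)); lra.
have base : c * expR 1 * expR (- (c / 2)) <= expR (- (c / 4)).
  apply: le_trans (ler_wpM2r (expR_ge0 _) (exp_beats_linear nP)) _.
  by rewrite -expRD ler_expR; lra.
rewrite /tree_profile.
have -> : expR (- (k%:R * (c / 4))) = expR (- (c / 4)) ^+ k.
  by rewrite -expRM_natl; congr expR; ring.
apply: le_trans (_ : P^-1 * (c * expR 1 * expR (- (c / 2))) ^+ k <= _); last first.
  rewrite ler_wpM2l ?invr_ge0 ?(ltW P0) // lerXn2r // nnegrE ?expR_ge0 //.
  by rewrite !mulr_ge0 ?expR_ge0 // ltW.
rewrite !exprMn -!expRM_natl mulr1.
apply: le_trans (_ : n%:R ^+ k / k`!%:R * (k%:R ^+ k.-1 / k%:R) *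
    (P ^+ k.-1 * expR (- (k%:R * (c / 2)))) <= _).
  have a0 : 0 <= k%:R ^+ k.-1 / k%:R :> R by rewrite divr_ge0 // exprn_ge0.
  apply: ler_pM.
  - by rewrite mulr_ge0.
  - by rewrite mulr_ge0 ?exprn_ge0 // ltW.
  - by rewrite ler_wpM2r.
  by rewrite ler_wpM2l // exprn_ge0 // ltW.
have kk : k%:R ^+ k.-1 / k%:R <= k`!%:R * expR k%:R :> R.
  apply: le_trans (expn_le_fact_exp k).
  by rewrite ler_pdivrMr // -exprSr ler_weXn2l // (leq_trans (leq_pred k)).
have Pk : P ^+ k.-1 = P^-1 * P ^+ k.
  by rewrite -{2}(prednK k0) exprS mulrA mulVf ?mul1r // gt_eqF.
rewrite Pk mulrN.
set E := expR (- (k%:R * (c / 2))).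
have E0 : 0 <= E := expR_ge0 _.
rewrite (_ : n%:R ^+ k / k`!%:R * (k%:R ^+ k.-1 / k%:R) * (P^-1 * P ^+ k * E) =
   (P^-1 * (n%:R ^+ k * P ^+ k) * E / k`!%:R) * (k%:R ^+ k.-1 / k%:R)); last by ring.
apply: le_trans (ler_wpM2l _ kk) _.
  by rewrite divr_ge0 // mulr_ge0 // mulr_ge0 ?invr_ge0 ?mulr_ge0 ?exprn_ge0 // ltW.
rewrite le_eqVlt; apply/orP; left; apply/eqP; field; by rewrite !gt_eqF.
Qed.

Lemma sum_exp_le N (c : R) : (0 < N)%N -> 0 < c ->
  (\sum_(j < N) expR (- (c * open_prob R N j))) / N%:R <= c^-1.
Proof.
move=> N0 c0; have Nr : 0 < N%:R :> R by rewrite ltr0n.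
set x := expR (- (c / N%:R)).
have x1 : x < 1 by rewrite -expR0 ltr_expR oppr_lt0 divr_gt0.
have -> : \sum_(j < N) expR (- (c * open_prob R N j)) = x * \sum_(j < N) x ^+ j.
  rewrite mulr_sumr; apply: eq_bigr => j _; rewrite -exprS open_probE // -expRM_natl.
  by congr expR; field; rewrite gt_eqF.
have geo : (1 - x) * \sum_(j < N) x ^+ j <= 1.
  have -> : (1 - x) * \sum_(j < N) x ^+ j = 1 - x ^+ N.
    by rewrite -opprB mulNr -subrX1 opprB.
  by rewrite lerBlDr lerDl exprn_ge0 // expR_ge0.
set S := \sum_(j < N) x ^+ j in geo *.
have S0 : 0 <= S by apply: sumr_ge0 => j _; rewrite exprn_ge0 // expR_ge0.
have cx : c / N%:R * x <= 1 - x.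
  have h := expR_ge1Dx (c / N%:R); have x0 : 0 <= x := expR_ge0 _.
  have := ler_wpM2r x0 h; rewrite /x -expRD subrr expR0; lra.
have : c / N%:R * x * S <= 1 by apply: le_trans geo; rewrite ler_wpM2r.
rewrite -[c^-1]mul1r ler_pdivlMr //; apply: le_trans.
by rewrite le_eqVlt; apply/orP; left; apply/eqP; ring.
Qed.

Definition profile_tail (x : R) n N k M : R :=
  (\sum_(j < N | x < open_prob R N j) tree_profile n k M (open_prob R N j)) / N%:R.

(** Half of the exponent in [tree_profile_tail] is estimated at the level A / n; the
    other half makes the sum over the levels geometric, and its sum absorbs the factor 1
    / P <= n / 32. *)
Lemma profile_tail_le (A : R) n N k M : (0 < N)%N -> (0 < k)%N -> (2 * k <= n)%N ->
  (k * (n - k) <= M)%N -> 32 <= A ->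
  profile_tail (A / n%:R) n N k M <= expR (- (k%:R * (A / 8))).
Proof.
move=> N0 k0 kn kM A32; have Nr : 0 < N%:R :> R by rewrite ltr0n.
have n0 : (0 < n)%N by apply: leq_trans kn; rewrite muln_gt0.
have nr : 0 < n%:R :> R by rewrite ltr0n.
have kr : 0 < k%:R :> R by rewrite ltr0n.
have k1 : 1 <= k%:R :> R by rewrite ler1n.
set c : R := k%:R * n%:R / 8; have c0 : 0 < c by rewrite divr_gt0 ?mulr_gt0.
set E := expR (- (k%:R * (A / 8))).
have E0 : 0 < E := expR_gt0 _.
apply: le_trans (_ : (\sum_(j < N) n%:R * E * expR (- (c * open_prob R N j))) / N%:R / 8 <= _).
  rewrite -[leRHS]mulrA [_ / 8]mulrC mulrA; rewrite ler_wpM2r ?invr_ge0 //.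
  rewrite mulr_suml big_mkcond; apply: ler_sum => j _.
  set P := open_prob R N j; case: ifP => [AP|_]; last first.
    by rewrite divr_ge0 // !mulr_ge0 ?expR_ge0 // ltW.
  have P1 : P <= 1 by exact: open_prob_le1.
  have AnP : A < n%:R * P by move: AP; rewrite ltr_pdivrMr // mulrC.
  have P0 : 0 < P by apply: lt_trans AP; rewrite divr_gt0 //; lra.
  have nP : 32 <= n%:R * P by lra.
  apply: le_trans (tree_profile_tail k0 kn kM P0 P1 nP) _.
  apply: le_trans (_ : n%:R / 8 * (E * expR (- (c * P))) <= _); last by rewrite le_eqVlt; apply/orP; left; apply/eqP; ring.
  apply: ler_pM; rewrite ?invr_ge0 ?expR_ge0 ?(ltW P0) //.
    by rewrite -[P^-1]mul1r ler_pdivrMr // mulrAC ler_pdivlMr //; lra.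
  rewrite /E -expRD ler_expR /c.
  have : k%:R * A <= k%:R * (n%:R * P) by rewrite ler_wpM2l // ltW.
  lra.
rewrite -mulr_sumr -mulrA -mulrA [X in _ * X]mulrA.
have := ler_wpM2l (ltW (mulr_gt0 nr E0)) (sum_exp_le N0 c0).
rewrite mulrA => H; rewrite !mulrA.
apply: le_trans (_ : n%:R * E * c^-1 / 8 <= _).
  by rewrite ler_wpM2r ?invr_ge0 //; move: H; rewrite !mulrA.
have -> : n%:R * E * c^-1 / 8 = E / k%:R by rewrite /c; field; rewrite !gt_eqF.
by rewrite ler_pdivrMr // ler_peMr // ltW.
Qed.

Lemma sum_exp_tail_le K m : (0 < K)%N ->
  \sum_(K.+1 <= k < m) expR (- (k%:R * 4)) <= K%:R^-1 :> R.
Proof.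
move=> K0; set q : R := expR (- 4).
have q0 : 0 <= q := expR_ge0 _.
have q2 : q <= 1 / 2.
  rewrite /q expRN mul1r lef_pV2 ?posrE ?expR_gt0 //.
  by apply: le_trans (expR_ge1Dx _); lra.
have E k : expR (- (k%:R * 4)) = q ^+ k :> R by rewrite -mulrN expRM_natl.
apply: le_trans (_ : (1 / 2) ^+ K <= _); last first.
  rewrite div1r exprVn lef_pV2 ?posrE ?exprn_gt0 ?ltr0n //.
  by rewrite -natrX ler_nat ltnW // ltn_expl.
have [mK|Km] := leqP m K.+1; first by rewrite big_geq // exprn_ge0 // divr_ge0.
suff : \sum_(K.+1 <= k < m) expR (- (k%:R * 4)) <= (1 / 2) ^+ K - (1 / 2) ^+ m.-1 :> R.
  by move=> /le_trans; apply; rewrite lerBlDr lerDl exprn_ge0 // divr_ge0.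
rewrite -(subnKC (ltnW Km)); elim: (m - K.+1)%N => [|i IH].
  by rewrite addn0 big_geq //= subrr.
rewrite addnS big_nat_recr ?leq_addr //=; apply: le_trans (lerD IH (lexx _)) _.
rewrite E addSn /= exprS.
have h1 : q ^+ (K + i) <= (1 / 2) ^+ (K + i) by rewrite lerXn2r // nnegrE divr_ge0.
have : q * q ^+ (K + i) <= 1 / 2 * (1 / 2) ^+ (K + i).
  by rewrite ler_pM // exprn_ge0.
rewrite [(1 / 2) ^+ (K + i).+1]exprS; lra.
Qed.

End ProfileTail.

(** * Mean number of excess components: upper bound *)

Section ComponentSizes.
Variables (n : nat) (G : {set edge n}).
Let D := components G.

Lemma card_component_gt0 S : S \in D -> (0 < #|S|)%N.
Proof. by case/imsetP => x _ ->; apply/card_gt0P; exists x; rewrite mem_component connect0. Qed.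

(** Every vertex belongs to one component only. *)
Lemma sum_card_components : (\sum_(S in D) #|S| <= n)%N.
Proof.
have -> : (\sum_(S in D) #|S| = \sum_(v : 'I_n) \sum_(S in D) (v \in S))%N.
  rewrite exchange_big /=; apply: eq_bigr => S _.
  by rewrite -sum1_card big_mkcond; apply: eq_bigr => v _; case: (v \in S).
rewrite -[n in leqRHS]card_ord -sum1_card; apply: leq_sum => v _.
rewrite -big_mkcondr sum1_card /= -(cards1 (component G v)).
apply: subset_leq_card; apply/fintype.subsetP => S; rewrite inE => /andP[SD vS].
by apply/eqP; exact: component_of_mem SD vS.
Qed.

Lemma card_large_components c :
  (#|[set S in D | (c <= #|S|)%N]%SET| * c <= n)%N.
Proof.
apply: leq_trans sum_card_components; rewrite -sum_nat_const.
rewrite big_mkcond [leqRHS]big_mkcond; apply: leq_sum => S _.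
by rewrite inE; case: (S \in D) => //=; case: ifP.
Qed.

Definition size_count k : nat := #|[set S in D | #|S| == k]%SET|.

Lemma sum_size_count a b :
  (\sum_(a <= k < b) size_count k = #|[set S in D | (a <= #|S| < b)%N]%SET|)%N.
Proof.
under eq_bigr => k _ do rewrite /size_count -sum1_card big_mkcond /=.
rewrite exchange_big /= -sum1_card [RHS]big_mkcond; apply: eq_bigr => S _.
rewrite inE -big_mkcond; under eq_bigl => k do rewrite inE.
case: (S \in D) => /=; last by rewrite big_pred0.
by rewrite (eq_bigl (fun k => k == #|S|)) => [|k]; rewrite ?big_nat1_eq // eq_sym.
Qed.

Lemma components_split K c : (K < c)%N ->
  (#|D| <= \sum_(1 <= k < K.+1) size_count k + \sum_(K.+1 <= k < c) size_count k +
     #|[set S in D | (c <= #|S|)%N]%SET|)%N.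
Proof.
move=> Kc; rewrite -big_cat_nat //= sum_size_count.
apply: leq_trans (leq_card_setU _ _); apply: subset_leq_card.
apply/fintype.subsetP => S SD; rewrite !inE SD (card_component_gt0 SD) /=.
by rewrite ltnNge orNb.
Qed.

End ComponentSizes.

Section ExcessUpper.
Variables (R : realType) (n N K : nat).
Hypotheses (n0 : (0 < n)%N) (N0 : (0 < N)%N) (K0 : (0 < K)%N).
Implicit Types (a : {ffun edge n -> 'I_N}).

(** The length of a minimal spanning tree of the grid environment: at each level such a
    tree has one edge less above the level than there are components. *)
Definition excess a : R := (\sum_(j < N) (#|components (sublevel a j)|%:R - 1)) / N%:R.

Let Nr : 0 < N%:R :> R. Proof. by rewrite ltr0n. Qed.
Let nr : 0 < n%:R :> R. Proof. by rewrite ltr0n. Qed.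
Let Kr : 0 < K%:R :> R. Proof. by rewrite ltr0n. Qed.

Lemma open_prob_count (x : R) : 0 <= x ->
  (\sum_(j < N | open_prob R N j <= x) 1) / N%:R <= x.
Proof.
move=> x0; rewrite ler_pdivrMr // (eq_bigl (fun j : 'I_N => j.+1%:R <= x * N%:R)); last first.
  by move=> j; rewrite open_probE // ler_pdivrMr.
rewrite big_mkcond.
have : 0 <= x * N%:R by rewrite mulr_ge0.
move: (x * N%:R) => y y0; elim: (N) => [|m IH]; first by rewrite big_ord0.
rewrite big_ord_recr /=; case: ifP => [my|_]; last by rewrite addr0.
apply: le_trans my; rewrite -(@natr1 R m) lerD2r.
apply: le_trans (_ : \sum_(i < m) (1 : R) <= _); first by apply: ler_sum => i _; case: ifP.
by rewrite sumr_const card_ord.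
Qed.

(** One component is discounted. At levels below 32 / n the components larger than K
    number at most n / K; above, at most one component has more than n / 2 vertices, and
    it is the one discounted. *)
Lemma avg_components_excess j :
  avg (fun a => #|components (sublevel a j)|%:R - 1) <=
  \sum_(1 <= k < K.+1) tree_profile n k (k * (n - k)) (open_prob R N j) +
  (if open_prob R N j <= 32 / n%:R then n%:R / K%:R else
   \sum_(K.+1 <= k < n./2.+1) tree_profile n k (k * (n - k)) (open_prob R N j)).
Proof.
set P := open_prob R N j.
have e0 : (0 < #|{ffun edge n -> 'I_N}|)%N by rewrite card_env_gt0 // card_ord.
have tp0 k : 0 <= tree_profile n k (k * (n - k)) P.
  have P0 : 0 <= P := open_prob_ge0 _ _ _.
  have P1 : 0 <= 1 - P by rewrite subr_ge0 open_prob_le1.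
  by rewrite /tree_profile !mulr_ge0 ?invr_ge0 ?exprn_ge0.
have av c d : (0 < c)%N ->
    avg (fun a => \sum_(c <= k < d) (size_count (sublevel a j) k)%:R) <=
    \sum_(c <= k < d) tree_profile n k (k * (n - k)) P.
  move=> c0; have -> : avg (fun a => \sum_(c <= k < d) (size_count (sublevel a j) k)%:R) =
      \sum_(c <= k < d) avg (fun a => (size_count (sublevel a j) k)%:R : R).
    by rewrite /avg exchange_big /= mulr_suml.
  rewrite big_nat_cond [leRHS]big_nat_cond; apply: ler_sum => k /andP[/andP[ck _] _].
  by apply: avg_components; rewrite // (leq_trans c0).
case: ifP => _.
  apply: le_trans (lerD (av 1%N K.+1 isT) (lexx _)).
  rewrite -[X in _ <= _ + X](avg_cst _ e0) -avgD; apply: le_avg => a.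
  rewrite lerBlDr; have := components_split (sublevel a j) (ltnSn K).
  rewrite [X in (_ + X + _)%N]big_geq // addn0 -(ler_nat R) natrD natr_sum => h.
  apply: le_trans h _; rewrite -addrA lerD2l -[leLHS]addr0 lerD //.
  rewrite ler_pdivlMr // -natrM ler_nat; apply: leq_trans (card_large_components (sublevel a j) K.+1).
  by rewrite leq_mul2l leqnSn orbT.
have [Kn|nK] := ltnP K n./2.+1; last first.
  rewrite [X in _ <= _ + X]big_geq ?(ltnW nK) ?addr0 //; last exact: leqW.
  apply: le_trans (av 1%N K.+1 isT).
  apply: le_avg => a; rewrite lerBlDr; have := components_split (sublevel a j) (ltnSn K).
  rewrite [X in (_ + X + _)%N]big_geq // addn0 -(ler_nat R) natrD natr_sum => h.
  apply: le_trans h _; rewrite lerD2l lern1.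
  have := card_large_components (sublevel a j) K.+1.
  case: #|_| => [|[|m]] // h; exfalso; move: h; rewrite leqNgt => /negP; apply.
  apply: leq_trans (_ : 2 * K.+1 <= _)%N; last by rewrite leq_mul2r.
  have := odd_double_half n; rewrite -muln2; case: (odd n); lia.
apply: le_trans (lerD (av 1%N K.+1 isT) (av K.+1 n./2.+1 isT)).
rewrite -avgD; apply: le_avg => a; rewrite lerBlDr.
have := components_split (sublevel a j) Kn.
rewrite -(ler_nat R) !natrD !natr_sum => h.
apply: le_trans h _; rewrite lerD2l lern1.
have := card_large_components (sublevel a j) n./2.+1.
case: #|_| => [|[|m]] // h; exfalso; move: h; rewrite leqNgt => /negP; apply.
apply: leq_trans (_ : 2 * n./2.+1 <= _)%N; last by rewrite leq_mul2r.
have := odd_double_half n; rewrite -muln2; case: (odd n); lia.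
Qed.

(** The levels below 32 / n contribute 32 / K in total, and those above at most 1 / K by
    [sum_exp_tail_le]. *)
Lemma avg_excess_le :
  avg excess <= \sum_(1 <= k < K.+1) profile_mean R n N k (k * (n - k)) + 33 / K%:R.
Proof.
have -> : avg excess = (\sum_(j < N) avg (fun a => #|components (sublevel a j)|%:R - 1)) / N%:R.
  rewrite (eq_avg (h := fun a => N%:R^-1 * \sum_(j < N) (#|components (sublevel a j)|%:R - 1))).
    by rewrite avgZ avg_sum mulrC.
  by move=> a; rewrite mulrC.
apply: le_trans (_ : (\sum_(j < N) (\sum_(1 <= k < K.+1) tree_profile n k (k * (n - k)) (open_prob R N j) +
  (if open_prob R N j <= 32 / n%:R then n%:R / K%:R else
   \sum_(K.+1 <= k < n./2.+1) tree_profile n k (k * (n - k)) (open_prob R N j)))) / N%:R <= _).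
  by rewrite ler_wpM2r ?invr_ge0 ?(ltW Nr) // ler_sum // => j _; exact: avg_components_excess.
rewrite big_split /= mulrDl; apply: lerD.
  by rewrite exchange_big /= mulr_suml.
rewrite (bigID (fun j : 'I_N => open_prob R N j <= 32 / n%:R)) /= mulrDl.
have -> : 33 / K%:R = 32 / K%:R + K%:R^-1 :> R by rewrite -[X in _ + X]mul1r -mulrDl; congr (_ / _); lra.
apply: lerD.
  rewrite (eq_bigr (fun=> 1 * (n%:R / K%:R))); last by move=> j ->; rewrite mul1r.
  rewrite -mulr_suml mulrAC.
  have h : (0 : R) <= 32 / n%:R by rewrite divr_ge0.
  have := open_prob_count h => /(ler_wpM2r (divr_ge0 (ltW nr) (ltW Kr))).
  by rewrite (_ : 32 / n%:R * (n%:R / K%:R) = 32 / K%:R) //; field; rewrite !gt_eqF.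
rewrite (eq_bigr (fun j : 'I_N => \sum_(K.+1 <= k < n./2.+1) tree_profile n k (k * (n - k)) (open_prob R N j)));
  last by move=> j /negbTE ->.
rewrite exchange_big /= mulr_suml; apply: le_trans (sum_exp_tail_le R n./2.+1 K0).
rewrite big_nat_cond [leRHS]big_nat_cond; apply: ler_sum => k /andP[/andP[Kk kn] _].
have k0 : (0 < k)%N by apply: leq_trans Kk.
have kn2 : (2 * k <= n)%N.
  rewrite ltnS in kn; have := odd_double_half n; rewrite -muln2; move: kn; case: (odd n); lia.
have := profile_tail_le N0 k0 kn2 (leqnn _) (lexx (32 : R)).
rewrite (_ : 32 / 8 = 4 :> R); last by field.
apply: le_trans; rewrite /profile_tail le_eqVlt; apply/orP; left; apply/eqP; congr (_ / _).
by apply: eq_bigl => j; rewrite real_ltNge ?num_real.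
Qed.

End ExcessUpper.

(** * Mean number of excess components: lower bound, and the length on a grid *)

Section ExcessLower.
Variables (R : realType) (n N K : nat) (A eps : R).
Hypotheses (n0 : (0 < n)%N) (N0 : (0 < N)%N) (K0 : (0 < K)%N) (A32 : 32 <= A) (eps0 : 0 < eps).
Hypotheses (Kn : (2 * K <= n)%N) (KA : (K ^ 2)%:R * (A / n%:R) <= 1 / 2).
Implicit Types (a : {ffun edge n -> 'I_N}) (j : nat).

Let Nr : 0 < N%:R :> R. Proof. by rewrite ltr0n. Qed.
Let nr : 0 < n%:R :> R. Proof. by rewrite ltr0n. Qed.
Let Kr : 0 < K%:R :> R. Proof. by rewrite ltr0n. Qed.
Let A0 : 0 < A. Proof. by apply: lt_le_trans A32. Qed.
Let An : 0 <= A / n%:R. Proof. by rewrite divr_ge0 // ltW. Qed.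
Let e0 : (0 < #|{ffun edge n -> 'I_N}|)%N. Proof. by rewrite card_env_gt0 // card_ord. Qed.

Let Y j a : R := tree_count R K j n0 a.
Let low j := open_prob R N j <= A / n%:R.
Let dev : R := (eps * n%:R + 2 * (n%:R + (K ^ 2)%:R * (A / n%:R) * n%:R ^+ 2) / (eps * n%:R)) / 2.

Let excess_ge a :
  (\sum_(j < N | low j) (avg (Y j) - `|Y j a - avg (Y j)| - 1)) / N%:R <= excess R a.
Proof.
rewrite ler_pM2r ?invr_gt0 // big_mkcond; apply: ler_sum => j _.
case: ifP => _; last first.
  rewrite subr_ge0 ler1n card_gt0; apply/set0Pn.
  by exists (component (sublevel a j) (Ordinal n0)); exact: imset_f.
rewrite lerD2r; apply: le_trans (_ : Y j a <= _); last exact: tree_count_le.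
have := ler_norm (Y j a - avg (Y j)); have := ler_norm (avg (Y j) - Y j a).
rewrite distrC -/(Y j a); lra.
Qed.

(** Only the levels below A / n and the isolated trees of at most K vertices are kept.
    The mean of this lower bound misses the full mean profile by the tail above A / n,
    and its fluctuations are those of [tree_count_deviation] with t = eps n. *)
Lemma avg_shortfall_le (z : R) :
  avg (fun a => Num.max 0 (z - excess R a)) <=
  Num.max 0 (z - \sum_(1 <= k < K.+1) profile_mean R n N k (k * n) + 8 * K%:R / A) +
  (A / n%:R + A * eps / 2 + A * (1 + (K ^ 2)%:R * A) / (eps * n%:R)).
Proof.
pose m : R := (\sum_(j < N | low j) avg (Y j)) / N%:R.
have m_ge : \sum_(1 <= k < K.+1) profile_mean R n N k (k * n) - 8 * K%:R / A <= m.
  rewrite lerBlDr.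
  apply: le_trans (_ : (\sum_(j < N | low j) \sum_(1 <= k < K.+1) tree_profile n k (k * n) (open_prob R N j)) / N%:R +
     \sum_(1 <= k < K.+1) profile_tail (A / n%:R) n N k (k * n) <= _).
    rewrite exchange_big /= mulr_suml -big_split /= le_eqVlt; apply/orP; left; apply/eqP.
    apply: eq_bigr => k _; rewrite /profile_mean /profile_tail -mulrDl; congr (_ / _).
    rewrite (bigID (fun j : 'I_N => low j)) /=; congr (_ + _).
    by apply: eq_bigl => j; rewrite real_ltNge ?num_real.
  apply: lerD.
    rewrite ler_pM2r ?invr_gt0 //; apply: ler_sum => j _; exact: avg_tree_count_ge.
  apply: le_trans (_ : \sum_(1 <= k < K.+1) 8 / A <= _).
    rewrite big_nat_cond [leRHS]big_nat_cond; apply: ler_sum => k /andP[/andP[k0 kK] _].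
    apply: le_trans (profile_tail_le N0 k0 _ _ A32) _.
    - by apply: leq_trans Kn; rewrite leq_mul2l -ltnS kK orbT.
    - by rewrite leq_mul2l leq_subr orbT.
    have k1 : 1 <= k%:R :> R by rewrite ler1n.
    rewrite expRN -[8 / A]invrK lef_pV2 ?posrE ?expR_gt0 ?invr_gt0 ?divr_gt0 //.
    apply: le_trans (expR_ge1Dx _); rewrite invfM invrK mulrC.
    have : A / 8 <= k%:R * (A / 8) by rewrite ler_peMl // divr_ge0 // ltW.
    lra.
  by rewrite sumr_const_nat subn1 /= -[leLHS]mulr_natr mulrAC.
have devj j : low j -> avg (fun a => `|Y j a - avg (Y j)|) <= dev.
  move=> lj; have en : 0 < eps * n%:R by exact: mulr_gt0.
  have KP : (K ^ 2)%:R * open_prob R N j <= (K ^ 2)%:R * (A / n%:R) by rewrite ler_wpM2l.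
  apply: le_trans (tree_count_deviation n0 N0 en _) _; first exact: le_trans KP KA.
  rewrite /dev ler_pM2r ?invr_gt0 // lerD2l ler_pM2r ?invr_gt0 // ler_pM2l //.
  by rewrite lerD2l ler_wpM2r // exprn_ge0.
have devE : dev = eps * n%:R / 2 + (1 + (K ^ 2)%:R * A) / eps.
  by rewrite /dev; field; rewrite !gt_eqF.
have dev0 : 0 <= dev.
  rewrite devE addr_ge0 // divr_ge0 ?addr_ge0 ?mulr_ge0 // ltW //.
pose g a : R := (\sum_(j < N | low j) (`|Y j a - avg (Y j)| + 1)) / N%:R.
have g0 a : 0 <= g a by rewrite divr_ge0 // sumr_ge0 // => j _; rewrite addr_ge0.
apply: le_trans (_ : avg (fun a => Num.max 0 (z - m) + g a) <= _).
  apply: le_avg => a; have := excess_ge a.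
  have -> : (\sum_(j < N | low j) (avg (Y j) - `|Y j a - avg (Y j)| - 1)) / N%:R = m - g a.
    rewrite /m /g -mulrBl -sumrB; congr (_ / _); apply: eq_bigr => j _; ring.
  move=> h; have h1 : z - m <= Num.max 0 (z - m) by rewrite le_max lexx orbT.
  have h2 : 0 <= Num.max 0 (z - m) by rewrite le_max lexx.
  rewrite ge_max; apply/andP; split; first exact: addr_ge0.
  lra.
rewrite avgD avg_cst //; apply: lerD.
  rewrite ge_max !le_max lexx /=; apply/orP; right; lra.
have -> : avg g = (\sum_(j < N | low j) (avg (fun a => `|Y j a - avg (Y j)|) + 1)) / N%:R.
  rewrite (eq_avg (h := fun a => N%:R^-1 * \sum_(j < N | low j) (`|Y j a - avg (Y j)| + 1))).
    rewrite avgZ avg_sum mulrC; congr (_ * _); apply: eq_bigr => j _.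
    by rewrite avgD avg_cst.
  by move=> a; rewrite mulrC.
apply: le_trans (_ : (dev + 1) * (A / n%:R) <= _).
  apply: le_trans (_ : (dev + 1) * ((\sum_(j < N | low j) 1) / N%:R) <= _).
    rewrite mulrA ler_pM2r ?invr_gt0 // mulr_sumr; apply: ler_sum => j lj.
    by rewrite mulr1 lerD2r devj.
  rewrite ler_wpM2l ?addr_ge0 //; exact: open_prob_count.
rewrite devE le_eqVlt; apply/orP; left; apply/eqP; field; by rewrite !gt_eqF.
Qed.

End ExcessLower.

Section GridLength.
Variables (R : realType) (n N : nat) (b : R).
Hypotheses (n0 : (0 < n)%N) (N0 : (0 < N)%N) (b0 : 0 < b).
Implicit Types (a : {ffun edge n -> 'I_N}) (T : {set edge n}).

(** The label of an edge is the number of levels at which it is closed. *)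
Lemma tree_length_grid a T :
  tree_length (grid R a) T = (\sum_(j < N) #|T :\: sublevel a j|%:R) / N%:R.
Proof.
rewrite /tree_length /grid -mulr_suml; congr (_ / _).
have -> : \sum_(j < N) #|T :\: sublevel a j|%:R = \sum_(j < N) \sum_(e in T) (j < a e)%N%:R :> R.
  apply: eq_bigr => j _; rewrite -sum1_card natr_sum big_mkcond [RHS]big_mkcond.
  apply: eq_bigr => e _; rewrite finset.in_setD andbC inE -ltnNge.
  by case: (e \in T); case: (j < a e)%N.
rewrite exchange_big /=; apply: eq_bigr => e _; rewrite -natr_sum; congr _%:R.
have ea := ltnW (ltn_ord (a e)).
rewrite -(big_mkord xpredT (fun j => nat_of_bool (j < a e)%N)) (big_cat_nat (n := a e)) //=.
rewrite [X in (X + _)%N](eq_big_nat _ _ (F2 := fun=> 1%N)); last by move=> i /andP[_ ->].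
rewrite [X in (_ + X)%N]big_nat [X in (_ + X)%N]big1 ?addn0 ?sum_nat_const_nat ?subn0 ?muln1 //.
by move=> i /andP[ai _]; rewrite ltnNge ai.
Qed.

Lemma excess_le_length a : excess R a <= mean_length b (grid R a).
Proof.
apply: (gibbs_lower n0) => T st; rewrite tree_length_grid ler_pM2r ?invr_gt0 ?ltr0n //.
apply: ler_sum => j _; have [p pm ->] := tree_parent_edges (Ordinal n0) st.
by rewrite lerBlDr natr1 ler_nat components_le_tree.
Qed.

Lemma length_le_excess a :
  mean_length b (grid R a) <= excess R a + (1 + n%:R * ln n%:R) / b.
Proof.
have [T st HT] := exists_kruskal_tree a n0.
apply: le_trans (gibbs_upper n0 _ b0 st) _; rewrite lerD2r tree_length_grid.
rewrite ler_pM2r ?invr_gt0 ?ltr0n //; apply: ler_sum => j _.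
by rewrite lerBrDr natr1 ler_nat.
Qed.

(** The mean length is squeezed between the minimal length and the Gibbs bound; the
    minimal length is compared with z by [avg_abs]. *)
Lemma grid_distance (K : nat) (A eps z : R) : (0 < K)%N -> 32 <= A -> 0 < eps ->
  (2 * K <= n)%N -> (K ^ 2)%:R * (A / n%:R) <= 1 / 2 ->
  avg (fun a => `|mean_length b (grid R a) - z|) <=
  (\sum_(1 <= k < K.+1) profile_mean R n N k (k * (n - k)) + 33 / K%:R - z) +
  2 * (Num.max 0 (z - \sum_(1 <= k < K.+1) profile_mean R n N k (k * n) + 8 * K%:R / A) +
     (A / n%:R + A * eps / 2 + A * (1 + (K ^ 2)%:R * A) / (eps * n%:R))) +
  (1 + n%:R * ln n%:R) / b.
Proof.
move=> K0 A32 eps0 Kn KA.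
have e0 : (0 < #|{ffun edge n -> 'I_N}|)%N by rewrite card_env_gt0 // card_ord.
set r := (1 + n%:R * ln n%:R) / b.
apply: le_trans (_ : avg (fun a => `|excess R a - z| + r) <= _).
  apply: le_avg => a; have := excess_le_length a; have := length_le_excess a; rewrite -/r.
  set x := mean_length _ _; set l := excess _ _ => h1 h2.
  have -> : x - z = (l - z) + (x - l) by ring.
  apply: le_trans (ler_normD _ _) _; rewrite lerD2l ger0_norm; lra.
rewrite avgD avg_cst // lerD2r avg_abs avgB avg_cst //; apply: lerD.
  by rewrite lerD2r avg_excess_le.
rewrite ler_pM2l // (eq_avg (h := fun a => Num.max 0 (z - excess R a))).
  exact: avg_shortfall_le.
by move=> a; rewrite opprB.
Qed.

End GridLength.

(** * The high disorder regime *)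

Section HighDisorder.
Local Open Scope classical_set_scope.
Variable R : realType.

Lemma cvg_sum_range (F : nat -> nat -> R) (l : nat -> R) K :
  (forall k, (0 < k)%N -> F k m @[m --> \oo] --> l k) ->
  \sum_(1 <= k < K.+1) F k m @[m --> \oo] --> \sum_(1 <= k < K.+1) l k.
Proof.
move=> H; elim: K => [|K IH].
  under eq_fun do rewrite big_geq //; rewrite big_geq //; exact: cvg_cst.
under eq_fun do rewrite big_nat_recr //=.
by rewrite big_nat_recr //=; apply: cvgD => //; exact: H.
Qed.

Definition limit_sum n (M : nat -> nat) K : R := \sum_(1 <= k < K.+1) profile_limit R n k (M k).

(** Refine the grid: the mean profiles converge to Beta integrals. *)
Lemma high_L1 d (Om : measurableType d) (P : probability Om R) (n : nat)
    (omega : edge n -> {RV P >-> R}) (b A eps z : R) (K : nat) :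
  iid_uniform01 omega -> (0 < n)%N -> 0 < b -> (0 < K)%N -> 32 <= A -> 0 < eps ->
  (2 * K <= n)%N -> (K ^ 2)%:R * (A / n%:R) <= 1 / 2 ->
  (\int[P]_t `|mean_length b (fun e => omega e t) - z|%:E <=
   ((limit_sum n (fun k => k * (n - k))%N K + 33 / K%:R - z) +
    2 * (Num.max 0 (z - limit_sum n (fun k => k * n)%N K + 8 * K%:R / A) +
     (A / n%:R + A * eps / 2 + A * (1 + (K ^ 2)%:R * A) / (eps * n%:R))) +
    (1 + n%:R * ln n%:R) / b)%:E)%E.
Proof.
move=> iid n0 b0 K0 A32 eps0 Kn KA.
apply/lee_addgt0Pr => dl dl0.
have d4 : 0 < dl / 4 by rewrite divr_gt0.
have [N0 HN] := grid_approx iid n0 z (ltW b0) d4.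
pose S (M : nat -> nat) N := \sum_(1 <= k < K.+1) profile_mean R n N k (M k).
have cS M : S M N @[N --> \oo] --> limit_sum n M K.
  by apply: cvg_sum_range => k k0; exact: cvg_profile_mean.
have [N [N0' NN h1 h2]] : exists N, [/\ (0 < N)%N, (N0 <= N)%N,
    S (fun k => k * (n - k))%N N <= limit_sum n (fun k => k * (n - k))%N K + dl / 4 &
    limit_sum n (fun k => k * n)%N K - dl / 4 <= S (fun k => k * n)%N N].
  have ev : \forall N \near \oo, [/\ (0 < N)%N, (N0 <= N)%N,
    S (fun k => k * (n - k))%N N <= limit_sum n (fun k => k * (n - k))%N K + dl / 4 &
    limit_sum n (fun k => k * n)%N K - dl / 4 <= S (fun k => k * n)%N N].
    near=> N; split.
    - by near: N; exact: nbhs_infty_gt.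
    - by near: N; exact: nbhs_infty_ge.
    - by near: N; apply: (cvgr_le (limit_sum n (fun k => k * (n - k))%N K)) => //; rewrite ltrDl.
    - by near: N; apply: (cvgr_ge (limit_sum n (fun k => k * n)%N K)) => //; rewrite ltrBlDr ltrDl.
  have [N1 _ /(_ N1 (leqnn _))] := ev; by exists N1.
apply: le_trans (HN _ NN N0') _; rewrite -EFinD lee_fin.
have := grid_distance n0 N0' b0 z K0 A32 eps0 Kn KA.
rewrite -/(S (fun k => k * (n - k))%N N) -/(S (fun k => k * n)%N N).
set m1 := Num.max 0 _; set m2 := Num.max 0 _.
have m12 : m1 <= m2 + dl / 4.
  have g0 : 0 <= m2 by rewrite le_max lexx.
  have g1 : z - limit_sum n (fun k => k * n)%N K + 8 * K%:R / A <= m2 by rewrite le_max lexx orbT.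
  rewrite ge_max; apply/andP; split; first by rewrite addr_ge0 // ltW.
  lra.
lra.
Unshelve. all: by end_near. Qed.

Lemma cvg_limit_sum K (M : nat -> nat -> nat) :
  (forall n k, (2 * k <= n)%N -> (k * (n - k) <= M n k <= k * n)%N) ->
  limit_sum n (M n) K @[n --> \oo] --> zeta3_sum R K.+1.
Proof.
move=> HM; apply: (@cvg_sum_range (fun k n => profile_limit R n k (M n k))) => k k0.
by apply: cvg_profile_limit => // n kn; exact: HM.
Qed.

Lemma gibbs_error_small (beta : nat -> R) (e : R) : high_disorder beta -> 0 < e ->
  \forall n \near \oo, 0 < beta n /\ (1 + n%:R * ln n%:R) / beta n <= e.
Proof.
move=> [b0 [bn lim]] e0; near=> n.
have bpos : 0 < beta n.
  by rewrite lt_def b0 andbT; near: n.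
split=> //; have n4 : (4 <= n)%N by near: n; exact: nbhs_infty_ge.
have l1 : 1 <= ln n%:R :> R := ln_ge1 R n4.
have n1 : 1 <= n%:R :> R by rewrite ler1n (leq_trans _ n4).
have h : n%:R * ln n%:R ^+ 5 / beta n <= e / 2.
  by near: n; apply: (cvgr_le (0 : R)) => //; rewrite divr_gt0.
apply: le_trans (_ : 2 * (n%:R * ln n%:R ^+ 5 / beta n) <= _); last lra.
rewrite mulrA ler_pM2r ?invr_gt0 //.
have h5 : ln n%:R <= ln n%:R ^+ 5 :> R by rewrite -{1}[ln _]expr1 ler_weXn2l.
have : n%:R * ln n%:R <= n%:R * ln n%:R ^+ 5 :> R by rewrite ler_wpM2l.
have : 1 * 1 <= n%:R * ln n%:R :> R by rewrite ler_pM.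
lra.
Unshelve. all: by end_near. Qed.

(** K is chosen first, so that the partial sum of the zeta series up to K is close to
    its value; then A of order K ^ 2 and eps small compared with 1 / A; finally n is
    large. *)
Theorem high_disorder_asymp (d : nat -> measure_display)
    (Om : forall n : nat, measurableType (d n))
    (P : forall n : nat, probability (Om n) R)
    (omega : forall n : nat, edge n -> {RV (P n) >-> R})
    (omega_iid : forall n : nat, iid_uniform01 (omega n)) :
  let X := fun (n : nat) (b : R) (t : Om n) => mean_length b (fun e => omega n e t) in
  let z := fun (n : nat) (b : R) => zeta3 R in
  asymp_whp (@high_disorder R) P X z /\ asymp_expectation (@high_disorder R) P X z.
Proof.
move=> X z; apply: (asymp_of_L1 (dom := fun b => 0 <= b)).
- by move=> beta [].
- move=> n b n0; exact: measurable_mean_length.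
- move=> n b c n0 b0.
  have [N0 H] := grid_approx (omega_iid n) n0 c b0 (@ltr01 R).
  exact: le_lt_trans (H N0.+1 (leqnSn _) isT) (ltry _).
- by move=> n b n0 b0; exact: zeta3_gt0.
move=> beta high e e0; rewrite /z; have z0 := zeta3_gt0 R.
(* Fifteen errors of at most eta are added up at the end. *)
pose eta := e * zeta3 R / 15.
have eta0 : 0 < eta by rewrite divr_gt0 ?mulr_gt0.
have [K [K0 zK K33]] : exists K, [/\ (0 < K)%N, zeta3 R - eta <= zeta3_sum R K.+1 & 33 / eta <= K%:R].
  have ev : \forall K \near \oo, [/\ (0 < K)%N, zeta3 R - eta <= zeta3_sum R K.+1 & 33 / eta <= K%:R].
    near=> K; split.
    - by near: K; exact: nbhs_infty_gt.
    - near: K; apply: (cvgr_ge (zeta3 R)); last by rewrite ltrBlDr ltrDl.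
      by have := @cvg_zeta3 R; rewrite -(cvg_shiftS (zeta3_sum R)).
    - by near: K; exact: nbhs_infty_ger.
  have [K1 _ /(_ K1 (leqnn _))] := ev; by exists K1.
have Kr : 0 < K%:R :> R by rewrite ltr0n.
pose A : R := (K ^ 2)%:R + 32.
have A32 : 32 <= A by rewrite lerDr.
have A0 : 0 < A by apply: lt_le_trans A32.
pose eps := eta / A; have eps0 : 0 < eps by rewrite divr_gt0.
have inv_small (C : R) : \forall n \near \oo, C / n%:R <= eta.
  near=> n; have nr : 0 < n%:R :> R by rewrite ltr0n; near: n; exact: nbhs_infty_gt.
  by rewrite ler_pdivrMr // -ler_pdivrMl // mulrC; near: n; exact: nbhs_infty_ger.
near=> n.
have n0 : (0 < n)%N by near: n; exact: nbhs_infty_gt.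
have nr : 0 < n%:R :> R by rewrite ltr0n.
have [b0 gib] : 0 < beta n /\ (1 + n%:R * ln n%:R) / beta n <= eta.
  by near: n; exact: gibbs_error_small.
have Kn : (2 * K <= n)%N by near: n; exact: nbhs_infty_ge.
have KA : (K ^ 2)%:R * (A / n%:R) <= 1 / 2.
  rewrite mulrA ler_pdivrMr // -ler_pdivrMl ?divr_gt0 //.
  by near: n; exact: nbhs_infty_ger.
apply: le_trans (high_L1 (zeta3 R) (omega_iid n) n0 b0 K0 A32 eps0 Kn KA) _.
rewrite lee_fin.
have u1 : limit_sum n (fun k => k * (n - k))%N K <= zeta3_sum R K.+1 + eta.
  near: n; apply: (cvgr_le (zeta3_sum R K.+1)); last by rewrite ltrDl.
  by apply: cvg_limit_sum => n k kn; rewrite leqnn /= leq_mul2l leq_subr orbT.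
have u2 : zeta3_sum R K.+1 - eta <= limit_sum n (fun k => k * n)%N K.
  near: n; apply: (cvgr_ge (zeta3_sum R K.+1)); last by rewrite ltrBlDr ltrDl.
  by apply: cvg_limit_sum => n k kn; rewrite leqnn andbT leq_mul2l leq_subr orbT.
have u3 : A / n%:R <= eta by near: n; exact: inv_small.
have u4 : A * (1 + (K ^ 2)%:R * A) / (eps * n%:R) <= eta.
  rewrite invfM mulrA; near: n; exact: inv_small.
have u5 : A * eps / 2 <= eta.
  by rewrite /eps mulrCA divff ?gt_eqF // mulr1; lra.
have u6 : 33 / K%:R <= eta.
  by rewrite ler_pdivrMr // mulrC -ler_pdivrMr.
have u7 : 8 * K%:R / A <= eta.
  apply: le_trans u6; rewrite ler_pdivrMr // mulrAC ler_pdivlMr //.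
  rewrite /A natrX; have : 0 <= K%:R ^+ 2 :> R by rewrite exprn_ge0.
  by rewrite -mulrA -expr2; lra.
have zs := zeta3_sum_le R K.+1.
have mx : Num.max 0 (zeta3 R - limit_sum n (fun k => k * n)%N K + 8 * K%:R / A) <= 3 * eta.
  by rewrite ge_max; apply/andP; split; lra.
have e15 : e * zeta3 R = 15 * eta by rewrite /eta; field.
lra.
Unshelve. all: by end_near. Qed.

End HighDisorder.

(** * Both regimes *)

Theorem theorem1p4 (R : realType) (d : nat -> measure_display)
    (Om : forall n : nat, measurableType (d n))
    (P : forall n : nat, probability (Om n) R)
    (omega : forall n : nat, edge n -> {RV (P n) >-> R})
    (omega_iid : forall n : nat, iid_uniform01 (omega n)) :
  let X := fun (n : nat) (b : R) (t : Om n) =>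
    mean_length b (fun e => omega n e t) in
  let f := fun (n : nat) (b : R) =>
    n%:R / b * ((1 - b * expR (- b) - expR (- b)) / (1 - expR (- b))) in
  let z := fun (n : nat) (b : R) => zeta3 R in
  (asymp_whp (@low_disorder R) P X f /\
   asymp_expectation (@low_disorder R) P X f) /\
  (asymp_whp (@high_disorder R) P X z /\
   asymp_expectation (@high_disorder R) P X z).
Proof.
split; first exact: (low_disorder_asymp omega_iid).
exact: (high_disorder_asymp omega_iid).
Qed.
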